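(* Let $N\ge3$, $p_S<p<p_{JL}$ and $n\ge1$. Then $\lambda_n(\gamma)$ oscillates around $\lambda_n^*$ infinitely many times as $\gamma\to\infty$: there is a sequence $\gamma_1<\gamma_2<\cdots\to\infty$ such that $\lambda_n(\gamma_j)-\lambda_n^*$ is nonzero and alternates in sign in $j$.
   Context: $p_S:=\frac{N+2}{N-2}$; $p_{JL}:=1+\frac{4}{N-4-2\sqrt{N-1}}$ if $N\ge11$, $p_{JL}:=\infty$ if $N\le10$. $f(U):=-U+U^p$. For $\gamma>1$, $\lambda_n(\gamma)$ is the square of the $n$-th positive critical point of the solution $u(s,\gamma)$ of $u''+\frac{N-1}{s}u'+f(u)=0$, $u(0)=\gamma$, $u'(0)=0$ (so $(\lambda_n(\gamma),u(\sqrt{\lambda_n(\gamma)}\,r,\gamma))$ is the solution on the $n$-th bifurcation branch of $U''+\frac{N-1}{r}U'+\lambda f(U)=0$, $U'(1)=0$). $\lambda_n^*:=(s_n^* )^2$ where $s_n^*$ is the $n$-th positive critical point of the singular solution $u^*(s):=As^{-\theta}y^*(m^{-1}\log s)$, with $\theta=\frac2{p-1}$, $A=\{\theta(N-2-\theta)\}^{1/(p-1)}$, $m=\{\theta(N-2-\theta)\}^{-1/2}$, $\alpha=m(N-2-2\theta)$, and $y^*$ the unique solution on $\mathbb{R}$ of $y''+\alpha y'-y+y^p-m^2e^{2mt}y=0$ with $y(-\infty)=1$. *)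

(* Defs.v *)
From Stdlib Require Import Reals Lra List.
Open Scope R_scope.

(* Real power x^p, extended oddly to x <= 0 (solutions considered are positive). *)
Definition powr (p x : R) : R :=
  match Rlt_dec 0 x with
  | left _ => Rpower x p
  | right _ => match Req_EM_T x 0 with
               | left _ => 0
               | right _ => - Rpower (- x) p
               end
  end.

Definition fN (p U : R) : R := - U + powr p U.

Definition pS (N : nat) : R := (INR N + 2) / (INR N - 2).

(* p < p_JL, with p_JL = +infinity when N <= 10 *)
Definition lt_pJL (N : nat) (p : R) : Prop :=
  (11 <= N)%nat -> p < 1 + 4 / (INR N - 4 - 2 * sqrt (INR N - 1)).

(* u solves u'' + (N-1)/s u' + f(u) = 0 on (0,oo), u(0) = gamma, u'(0) = 0;
   u is C^1 on [0,oo) (one-sided at 0) and C^2 on (0,oo). *)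
Definition is_radial_sol (N : nat) (p gamma : R) (u : R -> R) : Prop :=
  exists u' u'' : R -> R,
    (forall s, 0 < s -> derivable_pt_lim u s (u' s)) /\
    (forall s, 0 < s -> derivable_pt_lim u' s (u'' s)) /\
    (forall s, 0 < s -> u'' s + (INR N - 1) / s * u' s + fN p (u s) = 0) /\
    u 0 = gamma /\
    (forall eps, 0 < eps -> exists delta, 0 < delta /\
        forall s, 0 < s < delta -> Rabs (u s - gamma) < eps /\ Rabs (u' s) < eps).

Definition is_nth_crit (u : R -> R) (n : nat) (s : R) : Prop :=
  0 < s /\ derivable_pt_lim u s 0 /\
  exists l : list R, NoDup l /\ length l = (n - 1)%nat /\
    forall t, In t l <-> (0 < t < s /\ derivable_pt_lim u t 0).

Definition theta (p : R) : R := 2 / (p - 1).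
Definition Acst (N : nat) (p : R) : R :=
  Rpower (theta p * (INR N - 2 - theta p)) (1 / (p - 1)).
Definition mcst (N : nat) (p : R) : R :=
  Rpower (theta p * (INR N - 2 - theta p)) (- (1 / 2)).
Definition alpha (N : nat) (p : R) : R :=
  mcst N p * (INR N - 2 - 2 * theta p).

Definition is_ystar (N : nat) (p : R) (y : R -> R) : Prop :=
  (exists y' y'' : R -> R,
    (forall t, derivable_pt_lim y t (y' t)) /\
    (forall t, derivable_pt_lim y' t (y'' t)) /\
    (forall t, y'' t + alpha N p * y' t - y t + powr p (y t)
                 - (mcst N p) ^ 2 * exp (2 * mcst N p * t) * y t = 0)) /\
  (forall eps, 0 < eps -> exists T, forall t, t < T -> Rabs (y t - 1) < eps).

Definition ustar (N : nat) (p : R) (y : R -> R) (s : R) : R :=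
  Acst N p * Rpower s (- theta p) * y (ln s / mcst N p).

(* Main.v *)
Require Import Defs.
From Stdlib Require Import Reals Lra Lia List Psatz Classical IndefiniteDescription.
From Coquelicot Require Import Coquelicot.
Open Scope R_scope.

(** In the Emden-Fowler variables [u(s) = A e^(-k t) y(t)], [s = e^(m t)], [k = m theta],
    the equation becomes the planar system [y' = c + k y], [c' = - be c + eps y - y^p], where
    [be = m (N - 2 - theta)] and [eps = m^2 e^(2 m t)]; critical points of [u] are the zeros
    of [c]. As [p > p_S], the energy [energy] decreases and is negative on the solutions at
    hand, which bounds them and keeps them positive. A regular solution with [u(0) = gamma]
    reaches, at a time [- (p - 1) / (2 m) log gamma + O(1)], a fixed neighbourhood of the
    equilibrium [(1, - k)] and stays there until a time [tz] independent of [gamma].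
    As [p < p_JL] this equilibrium is a focus: meanwhile the difference with the singular
    solution contracts exponentially (so the [n]-th zero of [c] converges to that of the
    singular solution, which is simple) and turns at a uniform positive speed. Hence its
    polar angle at the [n]-th singular zero [tau], which is continuous in [gamma], tends to
    minus infinity, and [c(tau)] takes both signs for arbitrarily large [gamma]; this sign
    decides on which side of [tau] the [n]-th zero lies. *)

(** The obstacle is uniformity in [gamma]. At minus infinity a regular solution tends to 0, far from
    the equilibrium, and linearisation says nothing until a transit is over whose position recedes
    with [gamma]. The energy settles this: while [u] is close to [gamma] it is about
    [(k^2 - 1) y^2 / 2], and [k < 1] because [k < be] and [k be = 1]. Hence, when [y] reaches a
    fixed small size, the energy is below some [- e0] that does not depend on [gamma], and every
    later estimate uses only [e0]. The turning estimate holds only next to the equilibrium.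
    Elsewhere the angular speed has no known sign, except where the difference [(z, w)] meets the
    axis [z = 0]: there [z' = w], so the axis is crossed clockwise only and less than half a turn
    can ever be lost. Continuity in [gamma] then suffices to reach any prescribed angle. Zeros can
    be counted because [c < 0] up to [tz], for the singular solution and for all [gamma >= 2]: they
    occur only after [tz], where the convergence is uniform on compact intervals. *)

Ltac derive_subst :=
  repeat match goal with
  | H : is_derive ?f ?t ?l |- context [Derive ?g ?t] =>
      replace (Derive g t) with l by (symmetry; apply is_derive_unique; exact H)
  end.

Ltac derive_auto :=
  auto_derive;
  [ repeat split; try (eexists; eassumption); try lra; auto | derive_subst ].

(** * Comparison, continuity and first zeros in one variable *)

Lemma is_derive_continuity_pt (f : R -> R) (x l : R) :
  is_derive f x l -> continuity_pt f x.
Proof.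
  intros H. apply continuity_pt_filterlim.
  apply (ex_derive_continuous f). now exists l.
Qed.

Lemma ex_derive_continuity_pt (f : R -> R) (x : R) : ex_derive f x -> continuity_pt f x.
Proof. intros [l H]. exact (is_derive_continuity_pt f x l H). Qed.

Lemma mean_value (f df : R -> R) (a b : R) :
  a < b -> (forall t, a <= t <= b -> is_derive f t (df t)) ->
  exists x, a <= x <= b /\ f b - f a = df x * (b - a).
Proof.
  intros Hab Hd.
  destruct (MVT_gen f a b df) as [x [Hx E]].
  - rewrite Rmin_left, Rmax_right by lra. intros x Hx. apply Hd; lra.
  - rewrite Rmin_left, Rmax_right by lra. intros x Hx.
    eapply is_derive_continuity_pt, Hd; lra.
  - rewrite Rmin_left, Rmax_right in Hx by lra. now exists x.
Qed.

Lemma derive_nonpos_decr (f df : R -> R) (a b : R) :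
  a <= b -> (forall t, a <= t <= b -> is_derive f t (df t)) ->
  (forall t, a <= t <= b -> df t <= 0) -> f b <= f a.
Proof.
  intros [Hab| <-] Hd Hn; [|lra].
  destruct (mean_value f df a b Hab Hd) as [x [Hx E]].
  specialize (Hn x Hx). nra.
Qed.

Lemma derive_nonneg_incr (f df : R -> R) (a b : R) :
  a <= b -> (forall t, a <= t <= b -> is_derive f t (df t)) ->
  (forall t, a <= t <= b -> 0 <= df t) -> f a <= f b.
Proof.
  intros [Hab| <-] Hd Hn; [|lra].
  destruct (mean_value f df a b Hab Hd) as [x [Hx E]].
  specialize (Hn x Hx). nra.
Qed.

Lemma derive_pos_incr (f df : R -> R) (a b : R) :
  a < b -> (forall t, a <= t <= b -> is_derive f t (df t)) ->
  (forall t, a <= t <= b -> 0 < df t) -> f a < f b.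
Proof.
  intros Hab Hd Hn.
  destruct (mean_value f df a b Hab Hd) as [x [Hx E]].
  specialize (Hn x Hx). nra.
Qed.

Lemma gronwall (f df : R -> R) (K a b : R) :
  a <= b -> (forall t, a <= t <= b -> is_derive f t (df t)) ->
  (forall t, a <= t <= b -> df t <= K * f t) -> f b <= f a * exp (K * (b - a)).
Proof.
  intros Hab Hd Hn.
  assert (H : f b * exp (- K * b) <= f a * exp (- K * a)).
  { apply (derive_nonpos_decr (fun t => f t * exp (- K * t))
      (fun t => (df t - K * f t) * exp (- K * t))); auto.
    - intros t Ht. specialize (Hd t Ht). derive_auto. ring.
    - intros t Ht. specialize (Hn t Ht). pose proof (exp_pos (- K * t)). nra. }
  replace (f b) with (f b * exp (- K * b) * exp (K * b)).
  2:{ rewrite Rmult_assoc, <- exp_plus.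
      replace (- K * b + K * b) with 0 by ring. rewrite exp_0; ring. }
  replace (f a * exp (K * (b - a))) with (f a * exp (- K * a) * exp (K * b)).
  2:{ rewrite Rmult_assoc, <- exp_plus. f_equal. f_equal. ring. }
  apply Rmult_le_compat_r; [left; apply exp_pos | exact H].
Qed.

Lemma gronwall_rev (f df : R -> R) (K a b : R) :
  a <= b -> (forall t, a <= t <= b -> is_derive f t (df t)) ->
  (forall t, a <= t <= b -> - K * f t <= df t) -> f a <= f b * exp (K * (b - a)).
Proof.
  intros Hab Hd Hn.
  assert (H : - f b <= - f a * exp (- K * (b - a))).
  { apply (gronwall (fun t => - f t) (fun t => - df t)); auto.
    - intros t Ht. specialize (Hd t Ht). derive_auto. ring.
    - intros t Ht. specialize (Hn t Ht). lra. }
  replace (f a) with (f a * exp (- K * (b - a)) * exp (K * (b - a))).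
  2:{ rewrite Rmult_assoc, <- exp_plus.
      replace (- K * (b - a) + K * (b - a)) with 0 by ring. rewrite exp_0; ring. }
  apply Rmult_le_compat_r; [left; apply exp_pos | lra].
Qed.

Lemma gronwall_source (f df : R -> R) (K C a b : R) :
  0 < K -> a <= b -> (forall t, a <= t <= b -> is_derive f t (df t)) ->
  (forall t, a <= t <= b -> df t <= - K * f t + C) ->
  f b <= (f a - C / K) * exp (- K * (b - a)) + C / K.
Proof.
  intros HK Hab Hd Hn.
  assert (H := gronwall (fun t => f t - C / K) df (- K) a b Hab).
  cbv beta in H. enough (f b - C / K <= (f a - C / K) * exp (- K * (b - a))) by lra.
  apply H.
  - intros t Ht. specialize (Hd t Ht). derive_auto. ring.
  - intros t Ht. specialize (Hn t Ht).
    replace (- K * (f t - C / K)) with (- K * f t + C) by (field; lra). exact Hn.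
Qed.

Lemma continuity_pt_eps (f : R -> R) (x : R) :
  continuity_pt f x -> forall e, 0 < e ->
  exists d, 0 < d /\ forall t, Rabs (t - x) < d -> Rabs (f t - f x) < e.
Proof.
  intros H e He. destruct (H e He) as [d [Hd Hc]].
  exists d. split; [exact Hd|]. intros t Ht.
  destruct (Req_dec t x) as [->|Hne].
  - rewrite Rminus_diag, Rabs_R0. exact He.
  - apply (Hc t). split; [split; [exact I|auto]|exact Ht].
Qed.

Lemma first_zero (f : R -> R) (a b : R) :
  a <= b -> (forall t, a <= t <= b -> continuity_pt f t) -> 0 < f a -> f b <= 0 ->
  exists T, a < T <= b /\ f T = 0 /\ forall t, a <= t < T -> 0 < f t.
Proof.
  intros Hab Hc Ha Hb.
  set (P := fun x => a <= x <= b /\ forall t, a <= t <= x -> 0 < f t).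
  assert (Pa : P a).
  { split; [lra|]. intros t Ht. replace t with a by lra. exact Ha. }
  destruct (completeness P) as [T [HT1 HT2]].
  { exists b. intros x [Hx _]. lra. }
  { now exists a. }
  assert (aT : a <= T) by now apply HT1.
  assert (Tb : T <= b) by (apply HT2; intros x [Hx _]; lra).
  assert (Hpos : forall t, a <= t < T -> 0 < f t).
  { intros t Ht. destruct (Rlt_le_dec 0 (f t)) as [|Hn]; [assumption|].
    exfalso. enough (T <= t) by lra. apply HT2. intros x [Hx Hx'].
    destruct (Rle_lt_dec x t) as [|Hl]; [assumption|].
    specialize (Hx' t ltac:(lra)). lra. }
  assert (HTc := continuity_pt_eps f T (Hc T (conj aT Tb))).
  destruct (Rtotal_order (f T) 0) as [Hn|[H0|Hp]].
  - exfalso. destruct (HTc (- f T) ltac:(lra)) as [d [Hd Hd']].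
    assert (a < T). { destruct aT as [|E]; [assumption|]. rewrite <- E in Hn. lra. }
    set (t := Rmax a (T - d / 2)).
    assert (Ht : a <= t < T /\ T - d / 2 <= t).
    { unfold t. split; [split; [apply Rmax_l|]|apply Rmax_r].
      apply Rmax_lub_lt; lra. }
    specialize (Hpos t (proj1 Ht)). specialize (Hd' t).
    rewrite Rabs_left in Hd' by lra.
    specialize (Hd' ltac:(lra)). apply Rabs_def2 in Hd'. lra.
  - exists T. split; [|split; assumption]. split; [|exact Tb].
    destruct aT as [|E]; [assumption|]. rewrite <- E in H0. lra.
  - exfalso. destruct (HTc (f T) Hp) as [d [Hd Hd']].
    assert (T < b). { destruct Tb as [|E]; [assumption|]. rewrite E in Hp. lra. }
    set (x := Rmin b (T + d / 2)).
    assert (Hx : T < x <= b /\ x <= T + d / 2).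
    { unfold x. split; [split; [|apply Rmin_l]|apply Rmin_r].
      apply Rmin_glb_lt; lra. }
    enough (x <= T) by lra. apply HT1. split; [lra|]. intros t Ht.
    destruct (Rlt_le_dec t T) as [|Hl]; [apply Hpos; lra|].
    specialize (Hd' t). rewrite Rabs_right in Hd' by lra.
    specialize (Hd' ltac:(lra)). apply Rabs_def2 in Hd'. lra.
Qed.

(** Continuation principle: a first zero is excluded by an argument that may itself use positivity
    before it, as an energy estimate does. *)
Lemma positivity_continuation (f : R -> R) (a : R) :
  (forall t, a <= t -> continuity_pt f t) -> 0 < f a ->
  (forall T, a < T -> (forall t, a <= t < T -> 0 < f t) -> f T <> 0) ->
  forall t, a <= t -> 0 < f t.
Proof.
  intros Hc Ha H t Ht.
  destruct (Rlt_le_dec 0 (f t)) as [|Hn]; [assumption|].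
  destruct (first_zero f a t Ht) as [T [HT [H0 Hp]]]; auto.
  - intros x Hx. apply Hc. lra.
  - exfalso. apply (H T); auto. lra.
Qed.

Lemma limit_le (f : R -> R) (a T B : R) :
  a < T -> continuity_pt f T -> (forall t, a <= t < T -> B <= f t) -> B <= f T.
Proof.
  intros Ha Hc H. destruct (Rle_lt_dec B (f T)) as [|Hl]; [assumption|exfalso].
  destruct (continuity_pt_eps f T Hc (B - f T) ltac:(lra)) as [d [Hd Hd']].
  set (t := Rmax a (T - d / 2)).
  assert (Ht : a <= t < T /\ T - d / 2 <= t).
  { unfold t. split; [split; [apply Rmax_l|]|apply Rmax_r]. apply Rmax_lub_lt; lra. }
  specialize (H t (proj1 Ht)). specialize (Hd' t).
  rewrite Rabs_left in Hd' by lra.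
  specialize (Hd' ltac:(lra)). apply Rabs_def2 in Hd'. lra.
Qed.

Lemma intermediate_value (f : R -> R) (a b : R) :
  a <= b -> (forall t, a <= t <= b -> continuity_pt f t) -> f a * f b <= 0 ->
  exists x, a <= x <= b /\ f x = 0.
Proof.
  intros Hab Hc Hs.
  destruct (Rtotal_order (f a) 0) as [Hn|[H0|Hp]].
  - destruct (first_zero (fun t => - f t) a b) as [T [HT [H0 _]]]; auto; try lra.
    + intros t Ht. apply continuity_pt_opp. now apply Hc.
    + nra.
    + exists T. split; lra.
  - exists a. split; lra.
  - destruct (first_zero f a b) as [T [HT [H0 _]]]; auto; try nra.
    exists T. split; lra.
Qed.

(** * Power functions *)

Lemma Rpower_pos (x p : R) : 0 < Rpower x p.
Proof. apply exp_pos. Qed.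

Lemma Rpower_split (x p : R) : 0 < x -> Rpower x p = x * Rpower x (p - 1).
Proof.
  intros Hx. rewrite <- (Rpower_1 x Hx) at 2. rewrite <- Rpower_plus. f_equal. ring.
Qed.

Lemma is_derive_Rpower (p x : R) :
  0 < x -> is_derive (fun x => Rpower x p) x (p * Rpower x (p - 1)).
Proof. intros Hx. apply is_derive_Reals. now apply derivable_pt_lim_power. Qed.

Lemma Rpower_base_1 (p : R) : Rpower 1 p = 1.
Proof. unfold Rpower. rewrite ln_1, Rmult_0_r. apply exp_0. Qed.

Lemma Rpower_mvt (p x y : R) : 0 < x -> 0 < y ->
  exists z, Rmin x y <= z <= Rmax x y /\
    Rpower x p - Rpower y p = p * Rpower z (p - 1) * (x - y).
Proof.
  intros Hx Hy.
  destruct (MVT_gen (fun x => Rpower x p) y x (fun z => p * Rpower z (p - 1)))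
    as [z [Hz E]].
  - intros z Hz. apply is_derive_Rpower.
    assert (0 < Rmin y x) by (apply Rmin_glb_lt; lra). lra.
  - intros z Hz. eapply is_derive_continuity_pt, is_derive_Rpower.
    assert (0 < Rmin y x) by (apply Rmin_glb_lt; lra). lra.
  - exists z. rewrite Rmin_comm, Rmax_comm. auto.
Qed.

Lemma Rpower_lipschitz (p B x y : R) : 1 < p -> 0 < x <= B -> 0 < y <= B ->
  Rabs (Rpower x p - Rpower y p) <= p * Rpower B (p - 1) * Rabs (x - y).
Proof.
  intros Hp Hx Hy. destruct (Rpower_mvt p x y) as [z [Hz ->]]; try lra.
  assert (0 < Rmin x y) by (apply Rmin_glb_lt; lra).
  assert (Rmax x y <= B) by (apply Rmax_lub; lra).
  rewrite Rabs_mult. apply Rmult_le_compat_r; [apply Rabs_pos|].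
  rewrite Rabs_right.
  - apply Rmult_le_compat_l; [lra|]. apply Rle_Rpower_l; lra.
  - apply Rle_ge, Rmult_le_pos; [lra|]. left; apply Rpower_pos.
Qed.

(** The error is measured against [x - y] and not against the distance to 1, because this is applied
    to the difference of two solutions that both stay near 1. *)
Lemma Rpower_linearization (p e : R) : 0 < e ->
  exists d, 0 < d < 1 /\ forall x y, Rabs (x - 1) <= d -> Rabs (y - 1) <= d ->
    Rabs (Rpower x p - Rpower y p - p * (x - y)) <= e * Rabs (x - y).
Proof.
  intros He.
  destruct (continuity_pt_eps (fun x => p * Rpower x (p - 1)) 1) with (e := e)
    as [d [Hd H]]; auto.
  { eapply continuity_pt_scal, is_derive_continuity_pt, is_derive_Rpower. lra. }
  exists (Rmin (1 / 2) (d / 2)).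
  assert (Hm1 := Rmin_l (1 / 2) (d / 2)). assert (Hm2 := Rmin_r (1 / 2) (d / 2)).
  split. { split; [apply Rmin_glb_lt; lra|lra]. }
  intros x y Hx Hy. apply Rabs_le_between in Hx, Hy.
  destruct (Rpower_mvt p x y) as [z [Hz E]]; try lra.
  rewrite E.
  replace (p * Rpower z (p - 1) * (x - y) - p * (x - y))
    with ((p * Rpower z (p - 1) - p * Rpower 1 (p - 1)) * (x - y)).
  2:{ rewrite Rpower_base_1. ring. }
  rewrite Rabs_mult. apply Rmult_le_compat_r; [apply Rabs_pos|].
  left. apply H. apply Rabs_def1.
  - assert (Rmax x y <= 1 + d / 2) by (apply Rmax_lub; lra). lra.
  - assert (1 - d / 2 <= Rmin x y) by (apply Rmin_glb; lra). lra.
Qed.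

(** Everything comes from [1 + x <= exp x]. Put [r = p - 1]. For [x >= 1], [x^r >= 1 + r ln x] and
    [x ln x >= x - 1]. For [x < 1], [x^(-r) >= 1 + r (1 - x)], and the right side is at most [p],
    whence the factor [1 / p]; the factor [b] bounds the [x] in [x^p - x = x (x^r - 1)]. *)
Lemma Rpower_sub_id_lower (p b x : R) : 1 < p -> 0 < b <= 1 -> b <= x ->
  b * (p - 1) / p * (x - 1) ^ 2 <= (Rpower x p - x) * (x - 1).
Proof.
  intros Hp Hb Hx. rewrite Rpower_split by lra.
  set (r := p - 1). assert (Hr : 0 < r) by (unfold r; lra).
  assert (Hc : b * r / p <= r).
  { unfold Rdiv. rewrite Rmult_assoc, (Rmult_comm r), <- Rmult_assoc.
    assert (b * / p <= 1). { apply Rmult_le_reg_r with p; [lra|]. replace (b * / p * p) with b by (field; lra). lra. }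
    nra. }
  destruct (Rle_lt_dec 1 x) as [H1|H1].
  - assert (Hl : 1 - / x <= ln x).
    { pose proof (exp_ineq1_le (- ln x)) as H. rewrite exp_Ropp, exp_ln in H by lra. lra. }
    assert (Hp1 : 1 + r * ln x <= Rpower x r) by apply exp_ineq1_le.
    assert (Hxl : x - 1 <= x * ln x).
    { apply Rle_trans with (x * (1 - / x)). right; field; lra.
      apply Rmult_le_compat_l; lra. }
    assert (r * (x - 1) <= x * Rpower x r - x) by nra.
    assert (0 <= b * r / p). { apply Rmult_le_pos; [nra|]. left; apply Rinv_0_lt_compat; lra. }
    apply Rle_trans with (r * (x - 1) ^ 2).
    + apply Rmult_le_compat_r; [apply pow2_ge_0|exact Hc].
    + replace (r * (x - 1) ^ 2) with (r * (x - 1) * (x - 1)) by ring.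
      apply Rmult_le_compat_r; lra.
  - assert (Hl : ln x <= x - 1).
    { pose proof (exp_ineq1_le (ln x)) as H. rewrite exp_ln in H by lra. lra. }
    assert (Hp1 : 1 - r * ln x <= / Rpower x r).
    { unfold Rpower. rewrite <- exp_Ropp. pose proof (exp_ineq1_le (- (r * ln x))). lra. }
    set (q := Rpower x r) in *. assert (Hq : 0 < q) by apply Rpower_pos.
    assert (Hq1 : q * (1 + r * (1 - x)) <= 1).
    { apply Rle_trans with (q * / q); [|right; field; lra].
      apply Rmult_le_compat_l; nra. }
    assert (Hq2 : r / p * (1 - x) <= 1 - q).
    { apply Rmult_le_reg_r with p; [lra|].
      replace (r / p * (1 - x) * p) with (r * (1 - x)) by (field; lra).
      assert (Hrx : 0 <= r * (1 - x)) by nra.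
      assert (q <= 1) by nra.
      assert (r * (1 - x) <= (1 - q) * (1 + r * (1 - x))) by lra.
      assert ((1 - q) * (1 + r * (1 - x)) <= (1 - q) * p).
      { apply Rmult_le_compat_l; [lra|]. unfold r in *. nra. }
      lra. }
    assert (0 <= r / p * (1 - x)).
    { unfold Rdiv. assert (0 < / p) by (apply Rinv_0_lt_compat; lra).
      assert (0 < r * / p) by nra. nra. }
    replace (b * r / p * (x - 1) ^ 2) with (b * (r / p * (1 - x)) * (1 - x)) by (field; lra).
    replace ((x * q - x) * (x - 1)) with (x * (1 - q) * (1 - x)) by ring.
    apply Rmult_le_compat_r; [lra|]. apply Rmult_le_compat; lra.
Qed.

(** * The Emden-Fowler system *)

(** [k < be] expresses [p > p_S] and makes the damping [alpha = be - k] positive; [k be = 1] places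
    the equilibrium at [y = 1]. As [(be + k)^2 = alpha^2 + 4], [ep_focus] says
    [alpha^2 < 4 (p - 1)]: the characteristic equation [r^2 + alpha r + p - 1 = 0] at the
    equilibrium has no real root. *)
Record emden_params (p k be m : R) : Prop := {
  ep_p : 1 < p;
  ep_k : 0 < k;
  ep_kbe : k < be;
  ep_prod : k * be = 1;
  ep_m : 0 < m;
  ep_scale : (p - 1) * k = 2 * m;
  ep_focus : (be + k) ^ 2 < 4 * p }.

Definition eps (m t : R) : R := m ^ 2 * exp (2 * m * t).

(** Positivity is part of the notion because [Rpower] is the intended power only on positive
    arguments. *)
Definition sol_at (p k be m : R) (y c : R -> R) (t : R) : Prop :=
  0 < y t /\ is_derive y t (c t + k * y t) /\
  is_derive c t (- be * c t + eps m t * y t - Rpower (y t) p).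

(** Mechanical energy of [y'' + (be - k) y' - (1 + eps) y + y^p = 0], with [c + k y] in place of
    [y']. Both the damping and the growth of [eps] dissipate it. *)
Definition energy (p k m : R) (y c : R -> R) (t : R) : R :=
  (c t + k * y t) ^ 2 / 2 - (1 + eps m t) * y t ^ 2 / 2
  + y t * Rpower (y t) p / (p + 1).

Lemma eps_pos (m t : R) : 0 < m -> 0 < eps m t.
Proof. intros Hm. apply Rmult_lt_0_compat; [now apply pow_lt|apply exp_pos]. Qed.

Lemma eps_le (m s t : R) : 0 < m -> s <= t -> eps m s <= eps m t.
Proof.
  intros Hm Hst. apply Rmult_le_compat_l; [apply pow2_ge_0|].
  destruct Hst as [Hst| ->]; [|lra]. left. apply exp_increasing. nra.
Qed.

Lemma eps_small (m e : R) : 0 < m -> 0 < e -> exists T, forall t, t <= T -> eps m t < e.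
Proof.
  intros Hm He. assert (Hq : 0 < e / (2 * m ^ 2)).
  { apply Rdiv_lt_0_compat; [lra|]. pose proof (pow_lt m 2 Hm). lra. }
  exists (ln (e / (2 * m ^ 2)) / (2 * m)). intros t Ht.
  apply Rle_lt_trans with (1 := eps_le m t _ Hm Ht). unfold eps.
  replace (2 * m * (ln (e / (2 * m ^ 2)) / (2 * m))) with (ln (e / (2 * m ^ 2)))
    by (field; lra).
  rewrite exp_ln by exact Hq.
  replace (m ^ 2 * (e / (2 * m ^ 2))) with (e / 2) by (field; lra). lra.
Qed.

Lemma is_derive_energy (p k be m : R) (y c : R -> R) (t : R) :
  emden_params p k be m -> sol_at p k be m y c t ->
  is_derive (energy p k m y c) t
    (- (be - k) * (c t + k * y t) ^ 2 - m * eps m t * y t ^ 2).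
Proof.
  intros [Hp _ _ Hkb _ _ _] [Hy [H1 H2]]. unfold energy, eps, Rpower in *.
  derive_auto.
  set (c0 := c t) in *. set (y0 := y t) in *. set (q := exp (p * ln y0)) in *.
  set (e := exp (2 * m * t)) in *.
  field_simplify; try lra.
  replace be with (/ k). 2:{ apply Rmult_eq_reg_l with k. rewrite Hkb. field.
    intros ->; lra. intros ->; lra. }
  field. split; [|lra]. intros ->; lra.
Qed.

Lemma energy_decr (p k be m : R) (y c : R -> R) (a b : R) :
  emden_params p k be m -> a <= b -> (forall t, a <= t <= b -> sol_at p k be m y c t) ->
  energy p k m y c b <= energy p k m y c a.
Proof.
  intros HP Hab Hs.
  apply (derive_nonpos_decr _ (fun t => - (be - k) * (c t + k * y t) ^ 2 - m * eps m t * y t ^ 2)); auto.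
  - intros t Ht. apply is_derive_energy; auto.
  - intros t Ht. destruct HP as [_ Hk Hkb _ Hm _ _].
    pose proof (eps_pos m t Hm). pose proof (pow2_ge_0 (c t + k * y t)).
    pose proof (pow2_ge_0 (y t)). assert (0 < m * eps m t) by nra. nra.
Qed.

(** The positive root of [y^(p+1) / (p + 1) = (1 + e) y^2 / 2], beyond which the energy cannot be
    negative when [eps] is at most [e]. *)
Definition amplitude (p e : R) : R := Rpower ((p + 1) / 2 * (1 + e)) (1 / (p - 1)).

Lemma amplitude_ge_1 (p e : R) : 1 < p -> 0 <= e -> 1 <= amplitude p e.
Proof.
  intros Hp He. unfold amplitude. apply Rle_trans with (Rpower 1 (1 / (p - 1))).
  { rewrite Rpower_base_1. lra. }
  apply Rle_Rpower_l; [|nra]. left. apply Rdiv_lt_0_compat; lra.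
Qed.

Lemma energy_upper (p k be m : R) (y c : R -> R) (t e : R) :
  emden_params p k be m -> 0 < y t -> energy p k m y c t < 0 -> eps m t <= e ->
  y t <= amplitude p e.
Proof.
  intros [Hp _ _ _ Hm _ _] Hy HE He. unfold energy in HE.
  rewrite Rpower_split in HE by exact Hy.
  assert (Hq : Rpower (y t) (p - 1) <= (p + 1) / 2 * (1 + e)).
  { set (q := Rpower (y t) (p - 1)) in *. set (y0 := y t) in *.
    pose proof (pow2_ge_0 (c t + k * y0)).
    assert (Hlt : y0 ^ 2 * (q / (p + 1)) < y0 ^ 2 * ((1 + e) / 2)).
    { replace (y0 ^ 2 * (q / (p + 1))) with (y0 * (y0 * q) / (p + 1)) by (field; lra).
      assert (eps m t * y0 ^ 2 <= e * y0 ^ 2) by (apply Rmult_le_compat_r; [apply pow2_ge_0|lra]).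
      lra. }
    apply Rmult_lt_reg_l in Hlt; [|now apply pow_lt].
    apply Rmult_lt_compat_r with (r := p + 1) in Hlt; [|lra].
    replace (q / (p + 1) * (p + 1)) with q in Hlt by (field; lra). lra. }
  assert (Hy' : y t = Rpower (Rpower (y t) (p - 1)) (1 / (p - 1))).
  { rewrite Rpower_mult. replace ((p - 1) * (1 / (p - 1))) with 1 by (field; lra).
    now rewrite Rpower_1. }
  rewrite Hy'. apply Rle_Rpower_l.
  - left. apply Rdiv_lt_0_compat; lra.
  - split; [apply Rpower_pos|exact Hq].
Qed.

Lemma energy_lower (p k be m : R) (y c : R -> R) (t e0 : R) :
  emden_params p k be m -> 0 < y t -> energy p k m y c t <= - e0 ->
  2 * e0 <= (1 + eps m t) * y t ^ 2.
Proof.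
  intros [Hp _ _ _ Hm _ _] Hy HE. unfold energy in HE.
  pose proof (pow2_ge_0 (c t + k * y t)).
  assert (0 <= y t * Rpower (y t) p / (p + 1)).
  { apply Rmult_le_pos; [|left; apply Rinv_0_lt_compat; lra].
    pose proof (Rpower_pos (y t) p). nra. }
  lra.
Qed.

Lemma energy_speed (p k be m : R) (y c : R -> R) (t : R) :
  emden_params p k be m -> 0 < y t -> energy p k m y c t < 0 ->
  (c t + k * y t) ^ 2 <= (1 + eps m t) * y t ^ 2.
Proof.
  intros [Hp _ _ _ Hm _ _] Hy HE. unfold energy in HE.
  assert (0 <= y t * Rpower (y t) p / (p + 1)).
  { apply Rmult_le_pos; [|left; apply Rinv_0_lt_compat; lra].
    pose proof (Rpower_pos (y t) p). nra. }
  lra.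
Qed.

(* The energy controls [y] from below, so a solution cannot reach 0. *)
Lemma sol_positive (p k be m : R) (y c : R -> R) (a e0 : R) :
  emden_params p k be m -> 0 < e0 -> (forall t, a <= t -> continuity_pt y t) ->
  (forall t, a <= t -> 0 < y t -> sol_at p k be m y c t) ->
  0 < y a -> energy p k m y c a <= - e0 -> forall t, a <= t -> 0 < y t.
Proof.
  intros HP He0 Hc Hs Ha HE. apply positivity_continuation; auto.
  intros T HaT Hpos HT.
  assert (Hm := ep_m _ _ _ _ HP). pose proof (eps_pos m T Hm).
  (* Freezing [eps] at [T], where it is largest, gives one lower bound for [y] before [T], and this
     bound passes to the limit. *)
  set (b := sqrt (2 * e0 / (1 + eps m T))).
  assert (Hb : 0 < 2 * e0 / (1 + eps m T)) by (apply Rdiv_lt_0_compat; lra).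
  enough (b <= y T). { assert (0 < b) by now apply sqrt_lt_R0. lra. }
  apply (limit_le y a T b HaT). apply Hc; lra.
  intros t Ht. assert (Hyt := Hpos t Ht).
  assert (HE' : energy p k m y c t <= - e0).
  { eapply Rle_trans; [|exact HE]. apply (energy_decr p k be m); auto; try lra.
    intros x Hx. apply Hs; [lra|]. apply Hpos. lra. }
  apply (energy_lower p k be m) in HE'; auto.
  assert (eps m t <= eps m T) by (apply eps_le; lra).
  unfold b. apply Rsqr_incr_0_var; [|lra]. rewrite Rsqr_sqrt by lra. unfold Rsqr.
  apply Rmult_le_reg_r with (1 + eps m T); [lra|].
  replace (2 * e0 / (1 + eps m T) * (1 + eps m T)) with (2 * e0) by (field; lra).
  assert (0 <= y t ^ 2) by apply pow2_ge_0. nra.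
Qed.

(** * Differences of two solutions *)

Definition dist2 (y1 c1 y2 c2 : R -> R) (t : R) : R :=
  (y1 t - y2 t) ^ 2 + (c1 t - c2 t) ^ 2.

(** [K] depends on the bounds [B] and [T] but not on the two solutions, so it serves a whole range
    of [gamma]. The backward inequality is used as much as the forward one: distinct solutions never
    meet, and their distance is bounded below on compact intervals. *)
Lemma dist2_growth (p k be m B T : R) : emden_params p k be m ->
  exists K, 0 < K /\ forall y1 c1 y2 c2 a b, a <= b <= T ->
    (forall t, a <= t <= b -> sol_at p k be m y1 c1 t /\ y1 t <= B) ->
    (forall t, a <= t <= b -> sol_at p k be m y2 c2 t /\ y2 t <= B) ->
    dist2 y1 c1 y2 c2 b <= dist2 y1 c1 y2 c2 a * exp (K * (b - a)) /\
    dist2 y1 c1 y2 c2 a <= dist2 y1 c1 y2 c2 b * exp (K * (b - a)).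
Proof.
  intros [Hp Hk Hkb _ Hm _ _].
  set (L := p * Rpower B (p - 1)).
  assert (HL : 0 < L). { pose proof (Rpower_pos B (p - 1)). unfold L. nra. }
  pose proof (eps_pos m T Hm) as HeT.
  set (K := 1 + 2 * k + 2 * be + eps m T + L).
  exists K. split; [unfold K; lra|]. intros y1 c1 y2 c2 a b Hab H1 H2.
  set (d := fun t => 2 * (y1 t - y2 t) * ((c1 t - c2 t) + k * (y1 t - y2 t))
    + 2 * (c1 t - c2 t) * (- be * (c1 t - c2 t) + eps m t * (y1 t - y2 t)
       - (Rpower (y1 t) p - Rpower (y2 t) p))).
  assert (Hd : forall t, a <= t <= b -> is_derive (dist2 y1 c1 y2 c2) t (d t)).
  { intros t Ht. destruct (H1 t Ht) as [[_ [D1 D2]] _]. destruct (H2 t Ht) as [[_ [D3 D4]] _].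
    unfold dist2. derive_auto. unfold d. ring. }
  assert (HK : forall t, a <= t <= b -> Rabs (d t) <= K * dist2 y1 c1 y2 c2 t).
  { intros t Ht. destruct (H1 t Ht) as [[P1 _] B1]. destruct (H2 t Ht) as [[P2 _] B2].
    pose proof (Rpower_lipschitz p B (y1 t) (y2 t) Hp (conj P1 B1) (conj P2 B2)) as HR.
    fold L in HR. pose proof (eps_pos m t Hm).
    assert (eps m t <= eps m T) by (apply eps_le; lra).
    unfold d, dist2. set (z := y1 t - y2 t) in *. set (w := c1 t - c2 t).
    set (r := Rpower (y1 t) p - Rpower (y2 t) p) in *. set (e := eps m t) in *.
    assert (Hzw : 2 * Rabs z * Rabs w <= z ^ 2 + w ^ 2).
    { rewrite <- (pow2_abs z), <- (pow2_abs w). pose proof (pow2_ge_0 (Rabs z - Rabs w)). lra. }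
    assert (Hwr : Rabs (2 * w * r) <= L * (z ^ 2 + w ^ 2)).
    { rewrite !Rabs_mult, (Rabs_right 2) by lra.
      pose proof (Rabs_pos w). pose proof (Rabs_pos z).
      apply Rle_trans with (2 * Rabs w * (L * Rabs z)); nra. }
    assert (Hzw' : Rabs (2 * z * w) <= z ^ 2 + w ^ 2).
    { rewrite !Rabs_mult, (Rabs_right 2) by lra. exact Hzw. }
    apply Rabs_le_between in Hwr, Hzw'. apply Rabs_le. unfold K.
    pose proof (pow2_ge_0 z). pose proof (pow2_ge_0 w).
    assert (0 <= (eps m T - e) * (z ^ 2 + w ^ 2)) by nra.
    assert (- (e * (z^2+w^2)) <= e * (2 * z * w) <= e * (z^2+w^2)) by nra.
    assert (0 <= k * z ^ 2) by nra. assert (0 <= be * w ^ 2) by nra.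
    assert (0 <= k * w ^ 2) by nra. assert (0 <= be * z ^ 2) by nra.
    split; nra. }
  split.
  - apply (gronwall _ d); auto; try lra. intros t Ht. specialize (HK t Ht).
    apply Rabs_le_between in HK. lra.
  - apply (gronwall_rev _ d); auto; try lra. intros t Ht. specialize (HK t Ht).
    apply Rabs_le_between in HK. lra.
Qed.

(** The left side is [z w' - w z'] for the difference [(z, w)] of two solutions, that is the squared
    radius times the angular speed. Linearised at the equilibrium it is
    [- (p z^2 + (be + k) z w + w^2)], which is negative definite exactly under [ep_focus]. *)
Lemma focus_rotation (p k be m : R) : emden_params p k be m ->
  exists d ka, 0 < d < 1 /\ 0 < ka /\ forall x1 x2 w e,
    Rabs (x1 - 1) <= d -> Rabs (x2 - 1) <= d -> 0 <= e <= d ->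
    (x1 - x2) * (- be * w + e * (x1 - x2) - (Rpower x1 p - Rpower x2 p))
      - w * (w + k * (x1 - x2)) <= - ka * ((x1 - x2) ^ 2 + w ^ 2).
Proof.
  intros [Hp Hk Hkb _ Hm _ Hf].
  (* Determinant over trace of the quadratic form, a lower bound for its smallest eigenvalue. *)
  set (s := be + k) in *. set (k0 := (p - s ^ 2 / 4) / (p + 1)).
  assert (Hk0 : 0 < k0) by (apply Rdiv_lt_0_compat; lra).
  assert (Hk1 : k0 * (p + 1) = p - s ^ 2 / 4) by (unfold k0; field; lra).
  assert (Hk2 : k0 < 1) by nra.
  assert (Hform : forall z w, k0 * (z ^ 2 + w ^ 2) <= p * z ^ 2 + s * z * w + w ^ 2).
  { intros z w. apply Rmult_le_reg_l with (4 * (1 - k0)); [lra|].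
    assert (0 <= (2 * (1 - k0) * w + s * z) ^ 2) by apply pow2_ge_0.
    assert (0 <= (4 * (1 - k0) * (p - k0) - s ^ 2) * z ^ 2).
    { apply Rmult_le_pos; [|apply pow2_ge_0]. nra. }
    nra. }
  destruct (Rpower_linearization p (k0 / 4) ltac:(lra)) as [d [Hd Hlin]].
  exists (Rmin d (k0 / 4)), (k0 / 2).
  pose proof (Rmin_l d (k0 / 4)). pose proof (Rmin_r d (k0 / 4)).
  split; [split; [apply Rmin_glb_lt|]; lra|]. split; [lra|].
  intros x1 x2 w e H1 H2 He.
  specialize (Hlin x1 x2 ltac:(lra) ltac:(lra)).
  set (z := x1 - x2) in *. set (r := Rpower x1 p - Rpower x2 p) in *.
  assert (Hzr : Rabs (z * (r - p * z)) <= k0 / 4 * z ^ 2).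
  { rewrite Rabs_mult. rewrite <- (pow2_abs z). pose proof (Rabs_pos z). nra. }
  apply Rabs_le_between in Hzr. specialize (Hform z w).
  assert (e * z ^ 2 <= k0 / 4 * z ^ 2) by (apply Rmult_le_compat_r; [apply pow2_ge_0|lra]).
  pose proof (pow2_ge_0 w). unfold s in Hform. nra.
Qed.

(** With [z] the difference of the [y] components and [v = z'], the quantity [z'' + al z' + q0 z] is
    a small multiple of [z]; the quadratic form [V] is a strict Lyapunov function for the constant
    coefficient part. *)
Lemma focus_contraction (p k be m : R) : emden_params p k be m ->
  exists d ka C, 0 < d < 1 /\ 0 < ka /\ 0 < C /\ forall y1 c1 y2 c2 a b, a <= b ->
    eps m b <= d ->
    (forall t, a <= t <= b -> sol_at p k be m y1 c1 t /\ Rabs (y1 t - 1) <= d) ->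
    (forall t, a <= t <= b -> sol_at p k be m y2 c2 t /\ Rabs (y2 t - 1) <= d) ->
    dist2 y1 c1 y2 c2 b <= C * dist2 y1 c1 y2 c2 a * exp (- ka * (b - a)).
Proof.
  intros [Hp Hk Hkb Hkb1 Hm _ Hf].
  set (al := be - k). assert (Hal : 0 < al) by (unfold al; lra).
  set (q0 := p - 1). assert (Hq0 : 0 < q0) by (unfold q0; lra).
  set (g := al * Rmin 1 q0 / 2).
  pose proof (Rmin_l 1 q0) as Hg1. pose proof (Rmin_r 1 q0) as Hg2.
  assert (Hg0 : 0 < Rmin 1 q0) by (apply Rmin_glb_lt; lra).
  assert (Hg : 0 < g) by (unfold g; nra).
  set (et := g / (2 + 2 * al)).
  assert (Het : 0 < et) by (apply Rdiv_lt_0_compat; lra).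
  assert (Hetg : et * (2 + 2 * al) = g) by (unfold et; field; lra).
  destruct (Rpower_linearization p et Het) as [d [Hd Hlin]].
  set (C2 := 1 + al / 2 + q0 + al ^ 2 / 2).
  set (D := 2 + (al ^ 2 / 2 + 1) / q0).
  assert (HC2 : 0 < C2). { unfold C2. pose proof (pow2_ge_0 al). lra. }
  assert (HD0 : 0 < (al ^ 2 / 2 + 1) / q0).
  { apply Rdiv_lt_0_compat; [|lra]. pose proof (pow2_ge_0 al). lra. }
  (* The term [al z v] creates decay in [z], and [q0 + al^2 / 2] is the coefficient for which the
     products [z v] cancel: along the linear part, [V' = - al v^2 - al q0 z^2]. *)
  set (V := fun v z => v ^ 2 + al * z * v + (q0 + al ^ 2 / 2) * z ^ 2).
  assert (HVu : forall v z, V v z <= C2 * (v ^ 2 + z ^ 2)).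
  { intros v z. unfold V, C2. pose proof (pow2_ge_0 (v - z)). pose proof (pow2_ge_0 v).
    pose proof (pow2_ge_0 z). pose proof (pow2_ge_0 al).
    assert (0 <= al * (v - z) ^ 2) by nra. assert (0 <= al ^ 2 * v ^ 2) by nra.
    assert (0 <= q0 * v ^ 2) by nra. nra. }
  assert (HVl : forall v z, v ^ 2 + z ^ 2 <= D * V v z).
  { intros v z. set (x := v + al * z / 2).
    assert (EV : V v z = x ^ 2 + (q0 + al ^ 2 / 4) * z ^ 2) by (unfold V, x; field).
    assert (v ^ 2 <= 2 * x ^ 2 + al ^ 2 / 2 * z ^ 2).
    { unfold x. pose proof (pow2_ge_0 (v + al * z)). nra. }
    assert (E1 : (al ^ 2 / 2 + 1) / q0 * (q0 * z ^ 2) = (al ^ 2 / 2 + 1) * z ^ 2)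
      by (field; lra).
    rewrite EV. unfold D. pose proof (pow2_ge_0 x). pose proof (pow2_ge_0 z).
    pose proof (pow2_ge_0 al).
    set (X := (al ^ 2 / 2 + 1) / q0) in *.
    assert (0 <= X * x ^ 2) by nra.
    assert (0 <= (2 + X) * (al ^ 2 / 4 * z ^ 2)) by nra. nra. }
  exists (Rmin d et), (g / C2), (D * C2 * (2 + 2 * k ^ 2) ^ 2).
  pose proof (Rmin_l d et). pose proof (Rmin_r d et).
  assert (HD : 0 < D) by (unfold D; lra).
  assert (Hk2 : 0 < 2 + 2 * k ^ 2) by (pose proof (pow2_ge_0 k); lra).
  split; [split; [apply Rmin_glb_lt|]; lra|].
  split; [apply Rdiv_lt_0_compat; lra|].
  split. { apply Rmult_lt_0_compat; [nra|]. now apply pow_lt. }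
  intros y1 c1 y2 c2 a b Hab Heb S1 S2.
  set (z := fun t => y1 t - y2 t). set (v := fun t => c1 t - c2 t + k * (y1 t - y2 t)).
  set (F := fun t => V (v t) (z t)).
  set (S := fun t => eps m t * z t - (Rpower (y1 t) p - Rpower (y2 t) p - p * z t)).
  set (F' := fun t => - al * v t ^ 2 - al * q0 * z t ^ 2 + 2 * v t * S t + al * z t * S t).
  assert (HF : forall t, a <= t <= b -> is_derive F t (F' t)).
  { intros t Ht. destruct (S1 t Ht) as [[_ [D1 D2]] _]. destruct (S2 t Ht) as [[_ [D3 D4]] _].
    unfold F, V, v, z. derive_auto. unfold F', S, v, z, q0, al.
    set (e := eps m t). set (r1 := Rpower (y1 t) p). set (r2 := Rpower (y2 t) p).
    replace be with (/ k). 2:{ apply Rmult_eq_reg_l with k; [|lra]. rewrite Hkb1. field. lra. }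
    field. lra. }
  assert (HF' : forall t, a <= t <= b -> F' t <= - (g / C2) * F t).
  { intros t Ht. destruct (S1 t Ht) as [_ N1]. destruct (S2 t Ht) as [_ N2].
    specialize (Hlin (y1 t) (y2 t) ltac:(lra) ltac:(lra)).
    assert (He : 0 < eps m t <= et).
    { split; [now apply eps_pos|]. apply Rle_trans with (eps m b); [apply eps_le; lra|lra]. }
    assert (HS : Rabs (S t) <= 2 * et * Rabs (z t)).
    { unfold S. eapply Rle_trans; [apply Rabs_triang|]. rewrite Rabs_Ropp, Rabs_mult.
      fold (z t) in Hlin. rewrite (Rabs_right (eps m t)) by lra.
      pose proof (Rabs_pos (z t)). nra. }
    assert (Hz2 : (Rabs (z t)) ^ 2 = z t ^ 2) by apply pow2_abs.
    assert (Hv2 : (Rabs (v t)) ^ 2 = v t ^ 2) by apply pow2_abs.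
    pose proof (Rabs_pos (z t)) as Pz. pose proof (Rabs_pos (v t)) as Pv.
    assert (I1 : v t * S t <= et * (v t ^ 2 + z t ^ 2)).
    { apply Rle_trans with (1 := Rle_abs _). rewrite Rabs_mult.
      apply Rle_trans with (Rabs (v t) * (2 * et * Rabs (z t))).
      - apply Rmult_le_compat_l; assumption.
      - rewrite <- Hz2, <- Hv2. pose proof (pow2_ge_0 (Rabs (v t) - Rabs (z t))). nra. }
    assert (I2 : z t * S t <= 2 * et * z t ^ 2).
    { apply Rle_trans with (1 := Rle_abs _). rewrite Rabs_mult.
      apply Rle_trans with (Rabs (z t) * (2 * et * Rabs (z t))).
      - apply Rmult_le_compat_l; assumption.
      - rewrite <- Hz2. right; ring. }
    assert (HF1 : F' t <= - g * (v t ^ 2 + z t ^ 2)).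
    { unfold F'. pose proof (pow2_ge_0 (v t)). pose proof (pow2_ge_0 (z t)).
      assert (al * (z t * S t) <= al * (2 * et * z t ^ 2)) by (apply Rmult_le_compat_l; lra).
      assert (al * Rmin 1 q0 * (v t ^ 2) <= al * v t ^ 2).
      { apply Rmult_le_compat_r; [lra|nra]. }
      assert (al * Rmin 1 q0 * (z t ^ 2) <= al * q0 * z t ^ 2).
      { apply Rmult_le_compat_r; [lra|]. apply Rmult_le_compat_l; lra. }
      assert (Hgg : al * Rmin 1 q0 = 2 * g) by (unfold g; field).
      rewrite Hgg in *.
      assert (et * (2 + 2 * al) * (v t ^ 2 + z t ^ 2) = g * (v t ^ 2 + z t ^ 2)) by (now rewrite Hetg).
      assert (0 <= et * al * v t ^ 2) by (apply Rmult_le_pos; [nra|lra]).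
      nra. }
    apply Rle_trans with (1 := HF1). unfold F. specialize (HVu (v t) (z t)).
    assert (g / C2 * V (v t) (z t) <= g / C2 * (C2 * (v t ^ 2 + z t ^ 2))).
    { apply Rmult_le_compat_l; [left; now apply Rdiv_lt_0_compat|exact HVu]. }
    replace (g / C2 * (C2 * (v t ^ 2 + z t ^ 2))) with (g * (v t ^ 2 + z t ^ 2)) in *
      by (field; lra). lra. }
  assert (HG := gronwall F F' (- (g / C2)) a b Hab HF HF').
  set (ex := exp (- (g / C2) * (b - a))) in *.
  assert (Hex : 0 < ex) by apply exp_pos.
  assert (N1 : forall t, dist2 y1 c1 y2 c2 t <= (2 + 2 * k ^ 2) * (v t ^ 2 + z t ^ 2)).
  { intros t. unfold dist2, v, z. set (w := c1 t - c2 t). set (x := y1 t - y2 t).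
    pose proof (pow2_ge_0 (w + 2 * k * x)). pose proof (pow2_ge_0 (w + k * x)).
    clearbody w x.
    pose proof (pow2_ge_0 x). pose proof (pow2_ge_0 (k * (w + k * x))). lra. }
  assert (N2 : forall t, v t ^ 2 + z t ^ 2 <= (2 + 2 * k ^ 2) * dist2 y1 c1 y2 c2 t).
  { intros t. unfold dist2, v, z. set (w := c1 t - c2 t). set (x := y1 t - y2 t).
    pose proof (pow2_ge_0 (w - k * x)).
    clearbody w x.
    pose proof (pow2_ge_0 x). pose proof (pow2_ge_0 (k * w)). lra. }
  apply Rle_trans with (1 := N1 b).
  replace (D * C2 * (2 + 2 * k ^ 2) ^ 2 * dist2 y1 c1 y2 c2 a * ex)
    with ((2 + 2 * k ^ 2) * (D * (C2 * ((2 + 2 * k ^ 2) * dist2 y1 c1 y2 c2 a) * ex))) by ring.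
  apply Rmult_le_compat_l; [lra|].
  apply Rle_trans with (1 := HVl (v b) (z b)). apply Rmult_le_compat_l; [lra|].
  apply Rle_trans with (1 := HG). apply Rmult_le_compat_r; [lra|].
  apply Rle_trans with (1 := HVu (v a) (z a)). apply Rmult_le_compat_l; [lra|]. apply N2.
Qed.

(** * The potential well and relaxation to the equilibrium *)

Definition potential (p x : R) : R :=
  x * Rpower x p / (p + 1) - x ^ 2 / 2 + (1 / 2 - 1 / (p + 1)).

Lemma is_derive_potential (p x : R) : 1 < p -> 0 < x ->
  is_derive (potential p) x (Rpower x p - x).
Proof.
  intros Hp Hx. unfold potential, Rpower. derive_auto. field. lra.
Qed.

Lemma potential_1 (p : R) : 1 < p -> potential p 1 = 0.
Proof. intros Hp. unfold potential. rewrite Rpower_base_1. field. lra. Qed.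

(** [potential p] is the primitive of [x^p - x] that vanishes at 1; the inequality for the
    derivative is integrated from 1, to the right or to the left. *)
Lemma potential_ge (p c b x : R) : 1 < p -> 0 < b <= 1 -> b <= x ->
  (forall x, b <= x -> c * (x - 1) ^ 2 <= (Rpower x p - x) * (x - 1)) ->
  c / 2 * (x - 1) ^ 2 <= potential p x.
Proof.
  intros Hp Hb Hx Hc.
  set (f := fun x => potential p x - c / 2 * (x - 1) ^ 2).
  set (f' := fun x => Rpower x p - x - c * (x - 1)).
  assert (Hd : forall t, 0 < t -> is_derive f t (f' t)).
  { intros t Ht. pose proof (is_derive_potential p t Hp Ht) as H.
    unfold f, f'. derive_auto. field. }
  assert (Hs : forall t, b <= t -> 0 <= f' t * (t - 1)).
  { intros t Ht. specialize (Hc t Ht). unfold f'. nra. }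
  assert (H1 : f 1 = 0).
  { unfold f. rewrite potential_1 by exact Hp. ring. }
  enough (0 <= f x) by (unfold f in *; lra). rewrite <- H1.
  destruct (Rle_lt_dec 1 x).
  - apply (derive_nonneg_incr f f'); auto.
    + intros t Ht. apply Hd. lra.
    + intros t [[Ht|<-] _].
      * specialize (Hs t ltac:(lra)). apply Rmult_le_reg_r with (t - 1); lra.
      * unfold f'. rewrite Rpower_base_1. lra.
  - apply (derive_nonpos_decr f f'); auto; try lra.
    + intros t Ht. apply Hd. lra.
    + intros t [Ht [Ht'| ->]].
      * specialize (Hs t ltac:(lra)). apply Rmult_le_reg_r with (1 - t); lra.
      * unfold f'. rewrite Rpower_base_1. lra.
Qed.

Lemma potential_le (p c b B x : R) : 1 < p -> 0 < b <= 1 -> 1 <= B -> b <= x <= B ->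
  (forall x, b <= x <= B -> (Rpower x p - x) * (x - 1) <= c * (x - 1) ^ 2) ->
  potential p x <= c / 2 * (x - 1) ^ 2.
Proof.
  intros Hp Hb HB Hx Hc.
  set (f := fun x => potential p x - c / 2 * (x - 1) ^ 2).
  set (f' := fun x => Rpower x p - x - c * (x - 1)).
  assert (Hd : forall t, 0 < t -> is_derive f t (f' t)).
  { intros t Ht. pose proof (is_derive_potential p t Hp Ht) as H.
    unfold f, f'. derive_auto. field. }
  assert (Hs : forall t, b <= t <= B -> f' t * (t - 1) <= 0).
  { intros t Ht. specialize (Hc t Ht). unfold f'. nra. }
  assert (H1 : f 1 = 0).
  { unfold f. rewrite potential_1 by exact Hp. ring. }
  enough (f x <= 0) by (unfold f in *; lra). rewrite <- H1.
  destruct (Rle_lt_dec 1 x).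
  - apply (derive_nonpos_decr f f'); auto.
    + intros t Ht. apply Hd. lra.
    + intros t [[Ht|<-] Ht2].
      * specialize (Hs t ltac:(lra)). apply Rmult_le_reg_r with (t - 1); lra.
      * unfold f'. rewrite Rpower_base_1. lra.
  - apply (derive_nonneg_incr f f'); auto; try lra.
    + intros t Ht. apply Hd. lra.
    + intros t [Ht [Ht'| ->]].
      * specialize (Hs t ltac:(lra)). apply Rmult_le_reg_r with (1 - t); lra.
      * unfold f'. rewrite Rpower_base_1. lra.
Qed.

(* The energy is corrected by [- mu v h], with [h = y - y^p], so that its
   derivative also controls [h^2] and not only [v^2]. *)
Lemma relaxation (p k be m e0 : R) : emden_params p k be m -> 0 < e0 ->
  exists ka C, 0 < ka /\ 0 < C /\ forall y c a b, a <= b -> eps m b <= 1 ->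
    (forall t, a <= t <= b -> sol_at p k be m y c t) -> energy p k m y c a <= - e0 ->
    (y b - 1) ^ 2 + (c b + k * y b) ^ 2 <= C * (exp (- ka * (b - a)) + eps m b).
Proof.
  intros HP He0. assert (HP' := HP). destruct HP' as [Hp Hk Hkb Hkb1 Hm _ _].
  set (al := be - k). assert (Hal : 0 < al) by (unfold al; lra).
  set (B := amplitude p 1).
  assert (HB : 1 <= B) by (apply amplitude_ge_1; lra).
  (* As [eps <= 1], an energy at most [- e0] forces [y >= sqrt e0]; the minimum with 1 keeps the
     equilibrium between [b0] and [B]. *)
  set (b0 := Rmin 1 (sqrt e0)).
  assert (Hb0 : 0 < b0 <= 1).
  { split; [apply Rmin_glb_lt; [lra|now apply sqrt_lt_R0]|apply Rmin_l]. }
  set (Hb := 1 + p * Rpower B (p - 1)).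
  assert (HHb : 1 < Hb).
  { unfold Hb. pose proof (Rpower_pos B (p - 1)). nra. }
  set (c0 := b0 * (p - 1) / p).
  assert (Hc0 : 0 < c0) by (apply Rdiv_lt_0_compat; nra).
  assert (Hlow : forall x, b0 <= x -> c0 * (x - 1) ^ 2 <= (Rpower x p - x) * (x - 1)).
  { intros x Hx. now apply Rpower_sub_id_lower. }
  assert (Hup : forall x, b0 <= x <= B -> Rabs (x - Rpower x p) <= Hb * Rabs (x - 1)).
  { intros x Hx. pose proof (Rpower_lipschitz p B x 1 Hp ltac:(lra) ltac:(lra)) as HL.
    rewrite Rpower_base_1 in HL.
    replace (x - Rpower x p) with ((x - 1) - (Rpower x p - 1)) by ring.
    eapply Rle_trans; [apply Rabs_triang|]. rewrite Rabs_Ropp. unfold Hb. lra. }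
  (* The first bound on [mu] lets half of [al v^2] absorb the [v^2] terms that the correction
     produces; the other two keep [F] comparable to [v^2 + (y - 1)^2]. *)
  set (mu := Rmin (al / (2 * (Hb + al ^ 2 / 2))) (Rmin (1 / 2) (c0 / (4 * Hb ^ 2)))).
  assert (Hal2 : 0 <= al ^ 2) by apply pow2_ge_0.
  assert (HHb2 : 1 < Hb ^ 2) by nra.
  assert (Hmu0 : 0 < mu).
  { unfold mu. repeat apply Rmin_glb_lt; try lra; apply Rdiv_lt_0_compat; lra. }
  assert (Hmu1 : mu * (Hb + al ^ 2 / 2) <= al / 2).
  { apply Rle_trans with (al / (2 * (Hb + al ^ 2 / 2)) * (Hb + al ^ 2 / 2)).
    apply Rmult_le_compat_r; [lra|apply Rmin_l]. right; field; lra. }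
  assert (Hmu2 : mu <= 1 / 2) by (eapply Rle_trans; [apply Rmin_r|apply Rmin_l]).
  assert (Hmu3 : mu * Hb ^ 2 <= c0 / 4).
  { apply Rle_trans with (c0 / (4 * Hb ^ 2) * Hb ^ 2).
    apply Rmult_le_compat_r; [lra|eapply Rle_trans; [apply Rmin_r|apply Rmin_r]].
    right; field; lra. }
  set (Ce := 2 * B ^ 2 + mu * Hb * B ^ 2).
  set (C1 := 1 + Hb + Hb ^ 2).
  set (g := Rmin (al / 2) (mu * c0 ^ 2 / 2)).
  assert (Hg : 0 < g).
  { unfold g. apply Rmin_glb_lt; [lra|]. pose proof (pow_lt c0 2 Hc0). nra. }
  set (cl := Rmin (1 / 4) (c0 / 4)).
  assert (Hcl : 0 < cl) by (apply Rmin_glb_lt; lra).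
  set (ka := g / C1).
  assert (HC1 : 0 < C1) by (unfold C1; lra).
  assert (Hka : 0 < ka) by (apply Rdiv_lt_0_compat; lra).
  assert (HCe : 0 < Ce). { assert (0 < B ^ 2) by (apply pow_lt; lra).
    assert (0 < mu * Hb * B ^ 2) by (apply Rmult_lt_0_compat; nra). unfold Ce. lra. }
  set (Q := (C1 * (3 * B ^ 2)) + Ce / ka).
  assert (HCk : 0 < Ce / ka) by now apply Rdiv_lt_0_compat.
  assert (HQ : 0 < Q). { unfold Q. assert (0 < B ^ 2) by (apply pow_lt; lra).
    assert (0 < C1 * (3 * B ^ 2)) by (apply Rmult_lt_0_compat; lra). lra. }
  exists ka, (Q / cl). split; [exact Hka|]. split; [now apply Rdiv_lt_0_compat|].
  intros y c a b Hab Heb HS HE.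
  set (v := fun t => c t + k * y t). set (h := fun t => y t - Rpower (y t) p).
  assert (Hy : forall t, a <= t <= b ->
    b0 <= y t <= B /\ v t ^ 2 <= 2 * y t ^ 2 /\ 0 < eps m t <= eps m b).
  { intros t Ht. assert (St := HS t Ht). assert (Py := proj1 St).
    assert (HEt : energy p k m y c t <= - e0).
    { eapply Rle_trans; [|exact HE]. apply (energy_decr p k be m); auto; try lra.
      intros x Hx. apply HS. lra. }
    assert (Het : 0 < eps m t <= eps m b) by (split; [now apply eps_pos|apply eps_le; lra]).
    pose proof (pow2_ge_0 (y t)).
    split; [split|split; [|exact Het]].
    - apply Rle_trans with (sqrt e0); [apply Rmin_r|].
      apply Rsqr_incr_0_var; [|lra]. rewrite Rsqr_sqrt by lra. unfold Rsqr.
      apply (energy_lower p k be m) in HEt; auto. nra.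
    - apply (energy_upper p k be m y c t); auto; lra.
    - pose proof (energy_speed p k be m y c t HP Py ltac:(lra)). fold (v t) in *. nra. }
  set (F := fun t => v t ^ 2 / 2 + potential p (y t) - mu * (v t * h t)).
  set (F' := fun t => - al * v t ^ 2 + eps m t * y t * v t
     - mu * (- al * v t + h t + eps m t * y t) * h t
     - mu * v t ^ 2 * (1 - p * Rpower (y t) (p - 1))).
  assert (HF : forall t, a <= t <= b -> is_derive F t (F' t)).
  { intros t Ht. destruct (HS t Ht) as [Py [D1 D2]].
    pose proof (is_derive_potential p (y t) Hp Py) as D3.
    pose proof (is_derive_Rpower p (y t) Py) as D4.
    assert (D5 := is_derive_comp _ _ _ _ _ D3 D1).
    assert (D6 := is_derive_comp _ _ _ _ _ D4 D1).
    cbv beta in D5, D6. change scal with Rmult in D5, D6.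
    set (P := fun t => potential p (y t)) in *. set (R1 := fun t => Rpower (y t) p) in *.
    apply (is_derive_ext (fun t => (c t + k * y t) ^ 2 / 2 + P t
       - mu * ((c t + k * y t) * (y t - R1 t)))); [intros; reflexivity|].
    derive_auto. unfold R1, F', v, h, al.
    set (e := eps m t). set (r1 := Rpower (y t) p). set (r2 := Rpower (y t) (p - 1)).
    replace be with (/ k). 2:{ apply Rmult_eq_reg_l with k; [|lra]. rewrite Hkb1. field. lra. }
    field. lra. }
  assert (HFu : forall t, a <= t <= b -> F t <= C1 * (v t ^ 2 + (y t - 1) ^ 2)).
  { intros t Ht. destruct (Hy t Ht) as [B1 [B2 B3]].
    assert (G1 := potential_le p Hb b0 B (y t) Hp Hb0 HB B1).
    assert (G2 := Hup (y t) B1). fold (h t) in G2.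
    assert (G3 : potential p (y t) <= Hb / 2 * (y t - 1) ^ 2).
    { apply G1. intros x Hx. specialize (Hup x Hx).
      apply Rle_trans with (1 := Rle_abs _). rewrite Rabs_mult, Rabs_minus_sym.
      rewrite <- (pow2_abs (x - 1)). pose proof (Rabs_pos (x - 1)). nra. }
    assert (G4 : h t ^ 2 <= Hb ^ 2 * (y t - 1) ^ 2).
    { rewrite <- (pow2_abs (h t)), <- (pow2_abs (y t - 1)).
      pose proof (Rabs_pos (h t)). pose proof (Rabs_pos (y t - 1)). nra. }
    unfold F, C1. pose proof (pow2_ge_0 (v t + h t)). pose proof (pow2_ge_0 (v t)).
    pose proof (pow2_ge_0 (y t - 1)). pose proof (pow2_ge_0 (h t)).
    assert (- (v t * h t) <= (v t ^ 2 + h t ^ 2) / 2) by lra.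
    assert (mu * (- (v t * h t)) <= 1 / 2 * (v t ^ 2 + h t ^ 2)) by nra.
    assert (0 <= Hb * v t ^ 2) by nra. assert (0 <= Hb ^ 2 * v t ^ 2) by nra.
    assert (0 <= Hb * (y t - 1) ^ 2) by nra. assert (0 <= Hb ^ 2 * (y t - 1) ^ 2) by nra.
    lra. }
  assert (HFl : forall t, a <= t <= b -> cl * (v t ^ 2 + (y t - 1) ^ 2) <= F t).
  { intros t Ht. destruct (Hy t Ht) as [B1 [B2 B3]].
    assert (G3 := potential_ge p c0 b0 (y t) Hp Hb0 (proj1 B1) Hlow).
    assert (G2 := Hup (y t) B1). fold (h t) in G2.
    assert (G4 : h t ^ 2 <= Hb ^ 2 * (y t - 1) ^ 2).
    { rewrite <- (pow2_abs (h t)), <- (pow2_abs (y t - 1)).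
      pose proof (Rabs_pos (h t)). pose proof (Rabs_pos (y t - 1)). nra. }
    pose proof (pow2_ge_0 (v t - h t)). pose proof (pow2_ge_0 (v t)).
    pose proof (pow2_ge_0 (y t - 1)). pose proof (pow2_ge_0 (h t)).
    assert (mu * (v t * h t) <= mu * (v t ^ 2 / 2 + h t ^ 2 / 2)).
    { apply Rmult_le_compat_l; lra. }
    assert (mu * h t ^ 2 <= c0 / 4 * (y t - 1) ^ 2).
    { apply Rle_trans with (mu * (Hb ^ 2 * (y t - 1) ^ 2)); [apply Rmult_le_compat_l; lra|].
      rewrite <- Rmult_assoc. apply Rmult_le_compat_r; lra. }
    assert (mu * v t ^ 2 <= 1 / 2 * v t ^ 2) by (apply Rmult_le_compat_r; lra).
    assert (cl * v t ^ 2 <= 1 / 4 * v t ^ 2).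
    { apply Rmult_le_compat_r; [lra|apply Rmin_l]. }
    assert (cl * (y t - 1) ^ 2 <= c0 / 4 * (y t - 1) ^ 2).
    { apply Rmult_le_compat_r; [lra|apply Rmin_r]. }
    assert (0 <= c0 * (y t - 1) ^ 2) by (apply Rmult_le_pos; lra).
    unfold F. lra. }
  assert (HF' : forall t, a <= t <= b -> F' t <= - ka * F t + Ce * eps m b).
  { intros t Ht. destruct (Hy t Ht) as [B1 [B2 B3]].
    assert (G2 := Hup (y t) B1). fold (h t) in G2.
    assert (Hl := Hlow (y t) (proj1 B1)).
    assert (Yabs : Rabs (y t - 1) <= B) by (apply Rabs_le; lra).
    assert (Habs : Rabs (h t) <= Hb * B).
    { eapply Rle_trans; [exact G2|]. apply Rmult_le_compat_l; lra. }
    assert (Y2 : y t ^ 2 <= B ^ 2) by (apply pow_incr; lra).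
    assert (I0 : y t * v t <= 2 * B ^ 2).
    { pose proof (pow2_ge_0 (y t - v t)). pose proof (pow2_ge_0 (y t)). lra. }
    assert (I1 : eps m t * y t * v t <= 2 * B ^ 2 * eps m b).
    { apply Rle_trans with (eps m t * (2 * B ^ 2)).
      - rewrite Rmult_assoc. apply Rmult_le_compat_l; lra.
      - pose proof (pow2_ge_0 B). nra. }
    assert (I2 : - (y t * h t) <= Hb * B ^ 2).
    { apply Rle_trans with (1 := Rle_abs _). rewrite Rabs_Ropp, Rabs_mult.
      rewrite (Rabs_right (y t)) by lra. pose proof (Rabs_pos (h t)).
      replace (Hb * B ^ 2) with (B * (Hb * B)) by ring.
      apply Rmult_le_compat; lra. }
    assert (I3 : - (mu * (eps m t * y t) * h t) <= mu * Hb * B ^ 2 * eps m b).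
    { replace (- (mu * (eps m t * y t) * h t)) with (mu * eps m t * (- (y t * h t))) by ring.
      apply Rle_trans with (mu * eps m t * (Hb * B ^ 2)).
      - apply Rmult_le_compat_l; [nra|exact I2].
      - replace (mu * Hb * B ^ 2 * eps m b) with (mu * eps m b * (Hb * B ^ 2)) by ring.
        apply Rmult_le_compat_r; [pose proof (pow2_ge_0 B); nra|].
        apply Rmult_le_compat_l; lra. }
    assert (I4 : mu * v t ^ 2 * (p * Rpower (y t) (p - 1) - 1) <= mu * v t ^ 2 * Hb).
    { apply Rmult_le_compat_l; [pose proof (pow2_ge_0 (v t)); nra|].
      unfold Hb. assert (Rpower (y t) (p - 1) <= Rpower B (p - 1)) by (apply Rle_Rpower_l; lra).
      nra. }
    assert (I5 : mu * (al * v t * h t) <= mu * (al ^ 2 / 2 * v t ^ 2 + h t ^ 2 / 2)).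
    { apply Rmult_le_compat_l; [lra|]. pose proof (pow2_ge_0 (al * v t - h t)). lra. }
    assert (I6 : mu * (Hb + al ^ 2 / 2) * v t ^ 2 <= al / 2 * v t ^ 2).
    { apply Rmult_le_compat_r; [apply pow2_ge_0|exact Hmu1]. }
    assert (J1 : F' t <= - (al / 2) * v t ^ 2 - mu / 2 * h t ^ 2 + Ce * eps m b).
    { unfold F', Ce. lra. }
    assert (J2 : c0 ^ 2 * (y t - 1) ^ 2 <= h t ^ 2).
    { assert (c0 * Rabs (y t - 1) <= Rabs (h t)).
      { destruct (Req_dec (y t) 1) as [E|E].
        - rewrite E, Rminus_diag, Rabs_R0. pose proof (Rabs_pos (h t)). lra.
        - apply Rmult_le_reg_r with (Rabs (y t - 1)).
          + apply Rabs_pos_lt. lra.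
          + rewrite Rmult_assoc, <- Rabs_mult.
            replace (Rabs ((y t - 1) * (y t - 1))) with ((y t - 1) ^ 2).
            2:{ rewrite Rabs_right; [ring|]. pose proof (pow2_ge_0 (y t - 1)). lra. }
            apply Rle_trans with (1 := Hl). apply Rle_trans with (1 := Rle_abs _).
            rewrite Rabs_mult, (Rabs_minus_sym (Rpower (y t) p)). apply Rle_refl. }
      rewrite <- (pow2_abs (h t)), <- (pow2_abs (y t - 1)), <- Rpow_mult_distr.
      apply pow_incr. split; [|assumption].
      apply Rmult_le_pos; [lra|apply Rabs_pos]. }
    assert (J3 : g * (v t ^ 2 + (y t - 1) ^ 2) <= al / 2 * v t ^ 2 + mu / 2 * h t ^ 2).
    { pose proof (pow2_ge_0 (v t)). pose proof (pow2_ge_0 (y t - 1)).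
      assert (g * v t ^ 2 <= al / 2 * v t ^ 2) by (apply Rmult_le_compat_r; [lra|apply Rmin_l]).
      assert (g * (y t - 1) ^ 2 <= mu * c0 ^ 2 / 2 * (y t - 1) ^ 2)
        by (apply Rmult_le_compat_r; [lra|apply Rmin_r]).
      assert (mu / 2 * (c0 ^ 2 * (y t - 1) ^ 2) <= mu / 2 * h t ^ 2)
        by (apply Rmult_le_compat_l; lra).
      lra. }
    assert (J4 : ka * F t <= g * (v t ^ 2 + (y t - 1) ^ 2)).
    { apply Rle_trans with (ka * (C1 * (v t ^ 2 + (y t - 1) ^ 2))).
      - apply Rmult_le_compat_l; [lra|now apply HFu].
      - right. unfold ka. field. lra. }
    lra. }
  assert (HG := gronwall_source F F' ka (Ce * eps m b) a b Hka Hab HF HF').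
  set (ex := exp (- ka * (b - a))) in *. assert (Hex : 0 < ex) by apply exp_pos.
  apply Rmult_le_reg_l with cl; [exact Hcl|].
  replace (cl * (Q / cl * (ex + eps m b))) with (Q * (ex + eps m b)) by (field; lra).
  rewrite Rplus_comm. apply Rle_trans with (1 := HFl b ltac:(lra)).
  apply Rle_trans with (1 := HG).
  destruct (Hy a ltac:(lra)) as [B1 [B2 B3]].
  assert (Ha : F a <= C1 * (3 * B ^ 2)).
  { apply Rle_trans with (1 := HFu a ltac:(lra)). apply Rmult_le_compat_l; [lra|].
    assert (y a ^ 2 <= B ^ 2) by (apply pow_incr; lra).
    assert ((y a - 1) ^ 2 <= B ^ 2).
    { rewrite <- (pow2_abs (y a - 1)). apply pow_incr.
      split; [apply Rabs_pos|apply Rabs_le; lra]. }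
    lra. }
  replace (Ce * eps m b / ka) with (Ce / ka * eps m b) by (field; lra).
  assert (0 < Ce / ka * eps m b) by (apply Rmult_lt_0_compat; lra).
  unfold Q. assert (0 <= C1 * (3 * B ^ 2)) by (pose proof (pow2_ge_0 B); nra).
  assert ((F a - Ce / ka * eps m b) * ex <= C1 * (3 * B ^ 2) * ex)
    by (apply Rmult_le_compat_r; lra).
  assert (0 <= C1 * (3 * B ^ 2) * eps m b) by (apply Rmult_le_pos; lra).
  assert (0 <= Ce / ka * ex) by (apply Rmult_le_pos; lra).
  lra.
Qed.

(** * Passing between radial and Emden-Fowler variables *)

(** [A] is the amplitude for which [A s^(-k/m)] solves the radial equation without its linear term;
    [y = 1] stands for that solution. *)
Record emden_link (p k be m A n : R) : Prop := {
  el_params : emden_params p k be m;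
  el_n : 3 <= n;
  el_dim : m * (n - 2) = k + be;
  el_A : 0 < A;
  el_amp : Rpower A (p - 1) * m ^ 2 = 1 }.

Lemma emden_link_intro (N : nat) (p : R) :
  (3 <= N)%nat -> pS N < p -> lt_pJL N p ->
  emden_link p (mcst N p * theta p) (mcst N p * (INR N - 2 - theta p)) (mcst N p)
    (Acst N p) (INR N).
Proof.
  intros HN HS HJ.
  assert (Hn : 3 <= INR N) by (apply (le_INR 3) in HN; simpl in HN; lra).
  unfold pS in HS. unfold lt_pJL in HJ. set (n := INR N) in *.
  assert (Hp : 1 < p).
  { apply Rlt_trans with (2 := HS). apply Rmult_lt_reg_r with (n - 2); [lra|].
    replace ((n + 2) / (n - 2) * (n - 2)) with (n + 2) by (field; lra). lra. }
  assert (Hth : 0 < theta p) by (apply Rdiv_lt_0_compat; lra).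
  assert (Hth1 : theta p * (p - 1) = 2) by (unfold theta; field; lra).
  assert (Hpn : n + 2 < p * (n - 2)).
  { apply Rmult_lt_compat_r with (r := n - 2) in HS; [|lra].
    replace ((n + 2) / (n - 2) * (n - 2)) with (n + 2) in HS by (field; lra). lra. }
  assert (Hth2 : 2 * theta p < n - 2).
  { apply Rmult_lt_reg_r with (p - 1); [lra|]. nra. }
  unfold mcst, Acst. fold n. set (th := theta p) in *.
  set (D := th * (n - 2 - th)). assert (HD : 0 < D) by (unfold D; nra).
  set (m := Rpower D (- (1 / 2))). assert (Hm : 0 < m) by apply Rpower_pos.
  assert (Hm2 : m ^ 2 * D = 1).
  { unfold m. rewrite <- (Rpower_1 D HD) at 2.
    replace (Rpower D (- (1 / 2)) ^ 2) with (Rpower D (- (1 / 2)) * Rpower D (- (1 / 2))) by ring.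
    rewrite <- !Rpower_plus. replace (- (1 / 2) + - (1 / 2) + 1) with 0 by field.
    now apply Rpower_O. }
  constructor; [constructor| | | |].
  - exact Hp.
  - nra.
  - apply Rmult_lt_compat_l; lra.
  - rewrite <- Hm2. unfold D. ring.
  - exact Hm.
  - nra.
  (* As [th p = th + 2], the focus condition [(n - 2)^2 < 4 p D] expands to this inequality. One
     side of it, [n - 4 - 2 th < 2 sqrt (n - 1)], is [p < p_JL]; the other follows from
     [2 th < n - 2]. *)
  - assert (Hx : (n - 4 - 2 * th) ^ 2 < 4 * (n - 1)).
    { set (q := sqrt (n - 1)) in *.
      assert (Hq0 : 0 <= q) by apply sqrt_pos.
      assert (Hq : q * q = n - 1) by (apply sqrt_sqrt; lra).
      assert (Hlow : n - 4 - 2 * q < 2 * th).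
      { destruct (PeanoNat.Nat.le_gt_cases 11 N) as [H11|H11].
        - specialize (HJ H11). apply (le_INR 11) in H11. fold n in H11.
          replace (INR 11) with 11 in H11 by (simpl; lra).
          assert (Hd : 0 < n - 4 - 2 * q) by nra.
          apply Rmult_lt_reg_r with (p - 1); [lra|].
          replace (2 * th * (p - 1)) with 4 by lra.
          assert (Hpd : p - 1 < 4 / (n - 4 - 2 * q)) by lra.
          apply Rmult_lt_compat_r with (r := n - 4 - 2 * q) in Hpd; [|exact Hd].
          replace (4 / (n - 4 - 2 * q) * (n - 4 - 2 * q)) with 4 in Hpd by (field; lra). lra.
        (* Here [n - 4 - 2 q] is at most 0, with equality at [n = 10], and [th > 0] makes the
           inequality strict. *)
        - assert (n <= 10).
          { assert (N <= 10)%nat as H10 by lia. apply (le_INR N 10) in H10.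
            replace (INR 10) with 10 in H10 by (simpl; lra). exact H10. }
          assert (n - 4 <= 2 * q); [|lra].
          destruct (Rle_lt_dec n 4); nra. }
      destruct (Rle_lt_dec 0 (n - 4 - 2 * th)); nra. }
    replace ((m * (n - 2 - th) + m * th) ^ 2) with (m ^ 2 * (n - 2) ^ 2) by ring.
    assert (E1 : th * p = th + 2) by lra.
    assert (Hn4 : (n - 2) ^ 2 < 4 * p * D).
    { replace (4 * p * D) with (4 * (th * p) * (n - 2 - th)) by (unfold D; ring).
      rewrite E1. nra. }
    apply Rmult_lt_compat_l with (r := m ^ 2) in Hn4; [|now apply pow_lt].
    replace (m ^ 2 * (4 * p * D)) with (4 * p * (m ^ 2 * D)) in Hn4 by ring.
    rewrite Hm2 in Hn4. lra.
  - exact Hn.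
  - ring.
  - apply Rpower_pos.
  - rewrite Rpower_mult. replace (1 / (p - 1) * (p - 1)) with 1 by (field; lra).
    rewrite Rpower_1 by exact HD. lra.
Qed.

Definition emden_y (A k m : R) (u : R -> R) (t : R) : R := exp (k * t) * u (exp (m * t)) / A.
Definition emden_c (A k m : R) (u1 : R -> R) (t : R) : R :=
  m * exp (k * t) * exp (m * t) * u1 (exp (m * t)) / A.

Definition radial_at (p n : R) (u u1 : R -> R) (s : R) : Prop :=
  0 < u s /\ is_derive u s (u1 s) /\
  is_derive u1 s (- ((n - 1) / s) * u1 s + u s - Rpower (u s) p).

Lemma is_derive_emden_y (A k m : R) (u : R -> R) (t l : R) : 0 < A ->
  is_derive u (exp (m * t)) l ->
  is_derive (emden_y A k m u) t
    (m * exp (k * t) * exp (m * t) * l / A + k * emden_y A k m u t).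
Proof.
  intros HA H. unfold emden_y. derive_auto. field. lra.
Qed.

(** The exponents and [A] are chosen for this identity: [y^p] and [eps y] are [u^p] and [u] times
    the same factor [eps exp (k t) / A]. In particular [eps y < y^p] means [u > 1]. *)
Lemma Rpower_emden (p k be m A n t x : R) : emden_link p k be m A n -> 0 < x ->
  Rpower (exp (k * t) * x / A) p = m ^ 2 * exp (2 * m * t) * exp (k * t) * Rpower x p / A.
Proof.
  intros [[Hp Hk _ _ Hm Hsc _] _ _ HA Hamp] Hx.
  assert (Hinv : 0 < / A) by now apply Rinv_0_lt_compat.
  pose proof (exp_pos (k * t)) as He.
  unfold Rdiv. rewrite <- !Rpower_mult_distr by (try apply Rmult_lt_0_compat; lra).
  rewrite (Rpower_split (/ A)) by lra.
  replace (Rpower (/ A) (p - 1)) with (m ^ 2).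
  2:{ apply Rmult_eq_reg_l with (Rpower A (p - 1)).
      - rewrite Hamp, Rpower_mult_distr by lra. rewrite Rinv_r by lra.
        now rewrite Rpower_base_1.
      - pose proof (Rpower_pos A (p - 1)). lra. }
  replace (Rpower (exp (k * t)) p) with (exp (2 * m * t) * exp (k * t)).
  2:{ unfold Rpower. rewrite ln_exp, <- exp_plus. f_equal. rewrite <- Hsc. ring. }
  ring.
Qed.

Lemma sol_of_radial (p k be m A n : R) (u u1 : R -> R) (t : R) :
  emden_link p k be m A n -> radial_at p n u u1 (exp (m * t)) ->
  sol_at p k be m (emden_y A k m u) (emden_c A k m u1) t.
Proof.
  intros HL [Hu [H1 H2]]. assert (HL' := HL).
  destruct HL' as [[Hp Hk Hkb _ Hm Hsc _] Hn Hdim HA Hamp].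
  pose proof (exp_pos (k * t)) as Ek. pose proof (exp_pos (m * t)) as Em.
  split; [|split].
  - unfold emden_y. apply Rdiv_lt_0_compat; [nra|exact HA].
  - now apply is_derive_emden_y.
  - unfold emden_y at 2. rewrite (Rpower_emden p k be m A n) by auto.
    unfold emden_c, emden_y, eps.
    replace (exp (2 * m * t)) with (exp (m * t) * exp (m * t)).
    2:{ rewrite <- exp_plus. f_equal. ring. }
    replace be with (m * (n - 2) - k) by lra.
    derive_auto. field. lra.
Qed.

Lemma is_derive_ustar (p k be m A n : R) (y : R -> R) (s l : R) :
  emden_link p k be m A n -> 0 < s ->
  is_derive y (ln s / m) (l + k * y (ln s / m)) ->
  is_derive (fun s => A * Rpower s (- (k / m)) * y (ln s / m)) s
    (A * Rpower s (- (k / m)) * l / (m * s)).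
Proof.
  intros [[_ _ _ _ Hm _ _] _ _ _ _] Hs H. unfold Rpower, Rdiv in *. derive_auto.
  field. lra.
Qed.

(** The passage back serves the singular solution: its oscillation for large [s] is studied in
    radial variables, where the coefficients have a limit while [eps] blows up. *)
Lemma radial_of_sol (p k be m A n : R) (y c : R -> R) (s : R) :
  emden_link p k be m A n -> 0 < s -> sol_at p k be m y c (ln s / m) ->
  radial_at p n (fun s => A * Rpower s (- (k / m)) * y (ln s / m))
    (fun s => A * Rpower s (- (k / m)) * c (ln s / m) / (m * s)) s.
Proof.
  intros HL Hs [Hy [H1 H2]]. assert (HL' := HL).
  destruct HL' as [[Hp Hk Hkb _ Hm Hsc _] Hn Hdim HA Hamp].
  pose proof (Rpower_pos s (- (k / m))) as Ek.
  assert (Hu : 0 < A * Rpower s (- (k / m)) * y (ln s / m)).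
  { apply Rmult_lt_0_compat; [nra|exact Hy]. }
  split; [exact Hu|split].
  - now apply (is_derive_ustar p k be m A n).
  - set (x := A * Rpower s (- (k / m)) * y (ln s / m)) in *.
    assert (Es : exp (2 * m * (ln s / m)) = s * s).
    { replace (2 * m * (ln s / m)) with (ln s + ln s) by (field; lra).
      rewrite exp_plus, exp_ln by exact Hs. reflexivity. }
    assert (Ekk : exp (k * (ln s / m)) * Rpower s (- (k / m)) = 1).
    { unfold Rpower. rewrite <- exp_plus. rewrite <- exp_0. f_equal. field. lra. }
    assert (Ep : Rpower (y (ln s / m)) p = m ^ 2 * (s * s) * exp (k * (ln s / m)) * Rpower x p / A).
    { rewrite <- Es, <- (Rpower_emden p k be m A n) by auto. f_equal.
      unfold x. replace (exp (k * (ln s / m)) * (A * Rpower s (- (k / m)) * y (ln s / m)) / A)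
        with (exp (k * (ln s / m)) * Rpower s (- (k / m)) * y (ln s / m)) by (field; lra).
      rewrite Ekk. ring. }
    rewrite Ep in H2. unfold eps in H2. rewrite Es in H2.
    set (P := Rpower x p) in *. set (e := exp (k * (ln s / m))) in *.
    assert (Er : Rpower s (- (k / m)) = / e).
    { apply Rmult_eq_reg_l with e. rewrite Ekk, Rinv_r. reflexivity.
      unfold e. pose proof (exp_pos (k * (ln s / m))). lra.
      unfold e. pose proof (exp_pos (k * (ln s / m))). lra. }
    assert (He : 0 < e) by apply exp_pos.
    replace (- ((n - 1) / s) * (A * Rpower s (- (k / m)) * c (ln s / m) / (m * s)) + x - P)
      with (A * / e / m * (- (k / m) - 1) * c (ln s / m) / (s * s)
        + A * / e / (m * s) * ((- be * c (ln s / m) + m ^ 2 * (s * s) * y (ln s / m)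
            - m ^ 2 * (s * s) * e * P / A) * (/ s / m))).
    2:{ unfold x. rewrite Er. replace be with (m * (n - 2) - k) by lra. field.
        repeat split; lra. }
    rewrite <- Er. clear Er Ekk Ep.
    assert (Hd : is_derive (fun s => Rpower s (- (k / m))) s (- (k / m) * (Rpower s (- (k / m)) * / s))).
    { unfold Rpower. derive_auto. ring. }
    set (r := fun s => Rpower s (- (k / m))) in *.
    apply (is_derive_ext (fun s => A * r s * c (ln s * / m) / (m * s))); [intros; reflexivity|].
    unfold Rdiv in H2.
    derive_auto; [nra|]. unfold r. unfold Rdiv. field. lra.
Qed.

(** * Regular solutions *)

(** The equation is recorded only where [u > 0], where [powr] is [Rpower]; positivity on the
    half-line is proved later, from the energy. *)
Record radial_sol (p n ga : R) (u u1 : R -> R) : Prop := {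
  rs_deriv : forall s, 0 < s -> is_derive u s (u1 s);
  rs_eq : forall s, 0 < s -> 0 < u s ->
    is_derive u1 s (- ((n - 1) / s) * u1 s + u s - Rpower (u s) p);
  rs_init : forall e, 0 < e -> exists d, 0 < d /\
    forall s, 0 < s < d -> Rabs (u s - ga) < e /\ Rabs (u1 s) < e }.

Lemma radial_sol_intro (N : nat) (p ga : R) (u : R -> R) :
  is_radial_sol N p ga u -> radial_sol p (INR N) ga u (Derive u).
Proof.
  intros (u' & u'' & H1 & H2 & H3 & _ & H4).
  assert (E : forall s, 0 < s -> Derive u s = u' s).
  { intros s Hs. apply is_derive_unique, is_derive_Reals. now apply H1. }
  constructor.
  - intros s Hs. rewrite E by exact Hs. apply is_derive_Reals. now apply H1.
  - intros s Hs Hu. specialize (H3 s Hs). unfold fN, powr in H3.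
    destruct (Rlt_dec 0 (u s)) as [_|]; [|lra].
    apply (is_derive_ext_loc u').
    + exists (mkposreal s Hs). intros x Hx. symmetry. apply E.
      apply Rabs_def2 in Hx. simpl in Hx. unfold minus, plus, opp in Hx. simpl in Hx. lra.
    + rewrite E by exact Hs.
      replace (- ((INR N - 1) / s) * u' s + u s - Rpower (u s) p) with (u'' s) by lra.
      apply is_derive_Reals. now apply H2.
  - intros e He. destruct (H4 e He) as [d [Hd H]]. exists d. split; [exact Hd|].
    intros s Hs. rewrite E by apply Hs. now apply H.
Qed.

(** Monotonicity started from the singular endpoint 0, where only an asymptotic upper bound on [f]
    is available. *)
Lemma decr_from_limit (f df : R -> R) (S L : R) : 0 < S ->
  (forall s, 0 < s <= S -> is_derive f s (df s)) -> (forall s, 0 < s <= S -> df s <= 0) ->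
  (forall e, 0 < e -> exists d, 0 < d /\ forall s, 0 < s < d -> f s < L + e) -> f S <= L.
Proof.
  intros HS Hd Hn Hl. destruct (Rle_lt_dec (f S) L) as [|Hlt]; [assumption|exfalso].
  destruct (Hl (f S - L) ltac:(lra)) as [d [Hd0 H]].
  set (s := Rmin S (d / 2)).
  assert (Hs : 0 < s) by (apply Rmin_glb_lt; lra).
  pose proof (Rmin_l S (d / 2)) as M1. pose proof (Rmin_r S (d / 2)) as M2. fold s in M1, M2.
  specialize (H s ltac:(lra)).
  assert (f S <= f s); [|lra].
  apply (derive_nonpos_decr f df); auto; intros t Ht; [apply Hd|apply Hn]; lra.
Qed.

Lemma Rpower_ge_1 (x q : R) : 1 <= x -> 0 <= q -> 1 <= Rpower x q.
Proof.
  intros Hx Hq. apply Rle_trans with (Rpower 1 q).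
  - rewrite Rpower_base_1. lra.
  - apply Rle_Rpower_l; lra.
Qed.

Lemma Rpower_gt_1 (x q : R) : 1 < x -> 0 < q -> 1 < Rpower x q.
Proof.
  intros Hx Hq. apply Rle_lt_trans with (Rpower 1 q).
  - rewrite Rpower_base_1. lra.
  - apply Rlt_Rpower_l; lra.
Qed.

Lemma potential_incr (p x y : R) : 1 < p -> 1 <= x -> x < y -> potential p x < potential p y.
Proof.
  intros Hp Hx Hxy.
  set (w := (x + y) / 2).
  assert (H1 : potential p x <= potential p w).
  { apply (derive_nonneg_incr _ (fun z => Rpower z p - z)); unfold w; try lra.
    - intros t Ht. apply is_derive_potential; lra.
    - intros t Ht. rewrite Rpower_split by lra.
      assert (1 <= Rpower t (p - 1)); [|nra].
      apply Rpower_ge_1; lra. }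
  assert (H2 : potential p w < potential p y); [|lra].
  apply (derive_pos_incr _ (fun z => Rpower z p - z)); unfold w; try lra.
  - intros t Ht. apply is_derive_potential; lra.
  - intros t Ht. rewrite Rpower_split by lra.
    assert (1 < Rpower t (p - 1)); [|nra].
    apply Rpower_gt_1; lra.
Qed.

Section FromOrigin.
Context {p n ga : R} {u u1 : R -> R}.
Hypotheses (Hp : 1 < p) (Hn : 3 <= n) (Hga : 1 < ga) (Hrs : radial_sol p n ga u u1).

(** [u'^2 / 2 + potential] decreases, the term [(n - 1) / s] being a friction, and starts from
    [potential p ga]; as the potential increases beyond 1 and [ga > 1], the level [ga] cannot be
    exceeded. *)
Lemma radial_le_init (S : R) : 0 < S -> (forall s, 0 < s <= S -> 0 < u s) -> u S <= ga.
Proof.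
  intros HS Hpos.
  assert (HF : u1 S ^ 2 / 2 + potential p (u S) <= potential p ga).
  { apply (decr_from_limit (fun s => u1 s ^ 2 / 2 + potential p (u s))
      (fun s => - ((n - 1) / s) * u1 s ^ 2) S); auto.
    - intros s Hs. pose proof (rs_deriv _ _ _ _ _ Hrs s (proj1 Hs)) as D1.
      pose proof (rs_eq _ _ _ _ _ Hrs s (proj1 Hs) (Hpos s Hs)) as D2.
      pose proof (is_derive_potential p (u s) Hp (Hpos s Hs)) as D3.
      assert (D4 := is_derive_comp _ _ _ _ _ D3 D1).
      cbv beta in D4. change scal with Rmult in D4.
      set (P := fun s => potential p (u s)) in *.
      apply (is_derive_ext (fun s => u1 s ^ 2 / 2 + P s)); [intros; reflexivity|].
      derive_auto. field. lra.
    - intros s Hs. assert (0 <= (n - 1) / s).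
      { apply Rmult_le_pos; [lra|]. left. apply Rinv_0_lt_compat. lra. }
      pose proof (pow2_ge_0 (u1 s)). nra.
    - intros e He.
      destruct (continuity_pt_eps (potential p) ga) with (e := e / 2) as [d1 [Hd1 H1]]; [|lra|].
      { eapply is_derive_continuity_pt, is_derive_potential; lra. }
      destruct (rs_init _ _ _ _ _ Hrs (Rmin d1 (Rmin 1 e))) as [d [Hd H]].
      { repeat apply Rmin_glb_lt; lra. }
      exists d. split; [exact Hd|]. intros s Hs. destruct (H s Hs) as [I1 I2].
      specialize (H1 (u s)).
      pose proof (Rmin_l d1 (Rmin 1 e)). pose proof (Rmin_r d1 (Rmin 1 e)).
      pose proof (Rmin_l 1 e). pose proof (Rmin_r 1 e).
      specialize (H1 ltac:(lra)). apply Rabs_def2 in H1.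
      assert (u1 s ^ 2 < e).
      { rewrite <- (pow2_abs (u1 s)). pose proof (Rabs_pos (u1 s)). nra. }
      lra. }
  destruct (Rle_lt_dec (u S) ga) as [|Hl]; [assumption|exfalso].
  pose proof (potential_incr p ga (u S) Hp ltac:(lra) Hl).
  pose proof (pow2_ge_0 (u1 S)). lra.
Qed.

(** The combination [s u' + (n - 2) u] has derivative [s (u - u^p)], free of the singular term.
    Since [u <= ga], this is at most [s ga^p] in size, and integrating twice from 0 gives both
    bounds. *)
Lemma radial_near_origin (S : R) : 0 < S -> (forall s, 0 < s <= S -> 0 < u s) ->
  ga - Rpower ga p * S ^ 2 / 4 <= u S /\
  Rabs (S * u1 S) <= n * Rpower ga p * S ^ 2 / 4.
Proof.
  intros HS Hpos. set (P := Rpower ga p).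
  assert (Hle : forall s, 0 < s <= S -> u s <= ga).
  { intros s Hs. apply radial_le_init; [lra|]. intros r Hr. apply Hpos. lra. }
  assert (HgP : ga <= P).
  { unfold P. rewrite Rpower_split by lra.
    assert (1 <= Rpower ga (p - 1)); [|nra].
    apply Rpower_ge_1; lra. }
  assert (HP : forall s, 0 < s <= S -> - P <= u s - Rpower (u s) p <= P).
  { intros s Hs. assert (Rpower (u s) p <= P).
    { apply Rle_Rpower_l; [lra|]. split; [now apply Hpos|now apply Hle]. }
    pose proof (Rpower_pos (u s) p). pose proof (Hpos s Hs). pose proof (Hle s Hs). lra. }
  set (f := fun s => s * u1 s + (n - 2) * u s).
  set (df := fun s => s * (u s - Rpower (u s) p)).
  assert (Hf : forall s, 0 < s <= S -> is_derive f s (df s)).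
  { intros s Hs. pose proof (rs_deriv _ _ _ _ _ Hrs s (proj1 Hs)) as D1.
    pose proof (rs_eq _ _ _ _ _ Hrs s (proj1 Hs) (Hpos s Hs)) as D2.
    unfold f. derive_auto. unfold df. field. lra. }
  assert (Hlim : forall e, 0 < e -> exists d, 0 < d /\
    forall s, 0 < s < d -> Rabs (f s - (n - 2) * ga) < e).
  { intros e He. destruct (rs_init _ _ _ _ _ Hrs (e / n)) as [d [Hd H]].
    { apply Rdiv_lt_0_compat; lra. }
    exists (Rmin d 1). split; [apply Rmin_glb_lt; lra|]. intros s Hs.
    pose proof (Rmin_l d 1). pose proof (Rmin_r d 1).
    destruct (H s ltac:(lra)) as [I1 I2]. unfold f.
    replace (s * u1 s + (n - 2) * u s - (n - 2) * ga)
      with (s * u1 s + (n - 2) * (u s - ga)) by ring.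
    eapply Rle_lt_trans; [apply Rabs_triang|]. rewrite !Rabs_mult.
    rewrite (Rabs_right s), (Rabs_right (n - 2)) by lra.
    replace e with (n * (e / n)) by (field; lra).
    set (q := e / n) in *. assert (0 < q) by (unfold q; apply Rdiv_lt_0_compat; lra).
    pose proof (Rabs_pos (u1 s)). nra. }
  assert (Hup : forall s, 0 < s <= S -> f s <= (n - 2) * ga + P * s ^ 2 / 2).
  { intros T HT.
    enough (f T - P * T ^ 2 / 2 <= (n - 2) * ga) by lra.
    apply (decr_from_limit (fun s => f s - P * s ^ 2 / 2) (fun s => df s - P * s) T); try lra.
    - intros s Hs. pose proof (Hf s ltac:(lra)) as D. clearbody f. derive_auto. field.
    - intros s Hs. pose proof (HP s ltac:(lra)). unfold df. nra.
    - intros e He. destruct (Hlim e He) as [d [Hd H]]. exists d. split; [exact Hd|].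
      intros s Hs. specialize (H s Hs). apply Rabs_def2 in H.
      assert (0 < P) by lra. pose proof (pow2_ge_0 s). nra. }
  assert (Hlo : forall s, 0 < s <= S -> (n - 2) * ga - P * s ^ 2 / 2 <= f s).
  { intros T HT.
    enough (- f T - P * T ^ 2 / 2 <= - ((n - 2) * ga)) by lra.
    apply (decr_from_limit (fun s => - f s - P * s ^ 2 / 2) (fun s => - df s - P * s) T); try lra.
    - intros s Hs. pose proof (Hf s ltac:(lra)) as D. clearbody f. derive_auto. field.
    - intros s Hs. pose proof (HP s ltac:(lra)). unfold df. nra.
    - intros e He. destruct (Hlim e He) as [d [Hd H]]. exists d. split; [exact Hd|].
      intros s Hs. specialize (H s Hs). apply Rabs_def2 in H.
      assert (0 < P) by lra. pose proof (pow2_ge_0 s). nra. }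
  assert (Hu : ga - P * S ^ 2 / 4 <= u S).
  { enough (- u S - P * S ^ 2 / 4 <= - ga) by lra.
    apply (decr_from_limit (fun s => - u s - P * s ^ 2 / 4) (fun s => - u1 s - P * s / 2) S); try lra.
    - intros s Hs. pose proof (rs_deriv _ _ _ _ _ Hrs s (proj1 Hs)) as D. derive_auto. field.
    - intros s Hs. specialize (Hlo s Hs). unfold f in Hlo. pose proof (Hle s Hs).
      assert (- (P * s / 2) * s <= u1 s * s) by nra.
      enough (- (P * s / 2) <= u1 s) by lra. apply Rmult_le_reg_r with s; lra.
    - intros e He. destruct (rs_init _ _ _ _ _ Hrs e He) as [d [Hd H]].
      exists d. split; [exact Hd|].
      intros s Hs. destruct (H s Hs) as [I1 _]. apply Rabs_def2 in I1.
      assert (0 < P) by lra. pose proof (pow2_ge_0 s). nra. }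
  split; [exact Hu|].
  specialize (Hup S ltac:(lra)). specialize (Hlo S ltac:(lra)). unfold f in Hup, Hlo.
  pose proof (Hle S ltac:(lra)).
  assert (0 <= P * S ^ 2) by (pose proof (pow2_ge_0 S); nra).
  apply Rabs_le. split; nra.
Qed.

(** Bootstrap: as long as [u] is positive, the preceding estimate gives [u >= 3 ga / 4] in this
    range of radii, which excludes a first zero. *)
Lemma radial_positive_near_origin (S : R) : 0 < S -> Rpower ga p * S ^ 2 <= ga ->
  forall s, 0 < s <= S -> 0 < u s /\ 3 / 4 * ga <= u s.
Proof.
  intros HS HP.
  assert (HPs : forall s, 0 < s <= S -> Rpower ga p * s ^ 2 <= ga).
  { intros s Hs. eapply Rle_trans; [|exact HP]. apply Rmult_le_compat_l.
    left; apply Rpower_pos. apply pow_incr. lra. }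
  destruct (rs_init _ _ _ _ _ Hrs ga ltac:(lra)) as [d [Hd Hnear]].
  assert (Hpos : forall s, 0 < s <= S -> 0 < u s).
  { intros s Hs.
    set (a := Rmin s (d / 2)). pose proof (Rmin_l s (d / 2)). pose proof (Rmin_r s (d / 2)).
    assert (Ha : 0 < a) by (apply Rmin_glb_lt; lra).
    assert (Hinit : forall r, 0 < r <= a -> 0 < u r).
    { intros r Hr. destruct (Hnear r) as [I _]. unfold a in *; lra. apply Rabs_def2 in I. lra. }
    destruct (Rlt_le_dec 0 (u s)) as [|Hle]; [assumption|exfalso].
    destruct (first_zero u a s) as [T [HT [HT0 HTp]]]; auto.
    - intros t Ht. eapply is_derive_continuity_pt, (rs_deriv _ _ _ _ _ Hrs). lra.
    - apply Hinit. lra.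
    - assert (3 / 4 * ga <= u T); [|lra].
      apply (limit_le u a); [lra| |].
      + eapply is_derive_continuity_pt, (rs_deriv _ _ _ _ _ Hrs). lra.
      + intros t Ht. destruct (radial_near_origin t) as [I _]; [lra| |].
        * intros r Hr. destruct (Rle_lt_dec r a); [apply Hinit; lra|apply HTp; lra].
        * specialize (HPs t). unfold a in *. lra. }
  intros s Hs. split; [now apply Hpos|].
  destruct (radial_near_origin s) as [I _]; [lra| |].
  - intros r Hr. apply Hpos. lra.
  - specialize (HPs s Hs). lra.
Qed.

End FromOrigin.

(** [x = exp (k t) ga / A] would be [y] if [u] were still equal to [ga]. For small [x], [y] is close
    to [x] and [c] is negligible, so the energy is close to [- (1 - k^2) x^2 / 2]; half of this
    survives the errors. *)
Lemma initial_energy (p k be m A n : R) : emden_link p k be m A n ->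
  exists x0, 0 < x0 /\ forall ga u u1 t, 1 < ga -> radial_sol p n ga u u1 ->
    exp (k * t) * ga / A <= x0 ->
    (forall s, 0 < s <= exp (m * t) -> 0 < u s /\ 3 / 4 * ga <= u s) /\
    energy p k m (emden_y A k m u) (emden_c A k m u1) t
      <= - ((exp (k * t) * ga / A) ^ 2 * ((1 - k ^ 2) / 4)).
Proof.
  intros HL. assert (HL' := HL).
  destruct HL' as [[Hp Hk Hkb Hkb1 Hm Hsc _] Hn Hdim HA Hamp].
  assert (Hk1 : k ^ 2 < 1) by nra.
  (* [M] collects the coefficients of [d] once the bounds on [y] and [c] are inserted in the energy,
     with [d^2 <= d]. *)
  set (M := k * m * n / 4 + m ^ 2 * n ^ 2 / 32 + 1 / 4 + m ^ 2).
  assert (HM : 0 < M).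
  { unfold M. assert (0 < k * m * n) by (repeat apply Rmult_lt_0_compat; lra).
    pose proof (pow2_ge_0 m). pose proof (pow2_ge_0 n). nra. }
  set (d0 := Rmin 1 ((1 - k ^ 2) / (4 * M))).
  assert (Hd0 : 0 < d0) by (apply Rmin_glb_lt; [lra|apply Rdiv_lt_0_compat; lra]).
  assert (Hd1 : d0 <= 1) by apply Rmin_l.
  assert (Hd2 : d0 * M <= (1 - k ^ 2) / 4).
  { apply Rle_trans with ((1 - k ^ 2) / (4 * M) * M).
    apply Rmult_le_compat_r; [lra|apply Rmin_r]. right; field; lra. }
  assert (Hm2 : 0 < m ^ 2) by now apply pow_lt.
  exists (Rpower (m ^ 2 * d0) (1 / (p - 1))). split; [apply Rpower_pos|].
  intros ga u u1 t Hga Hrs Hx. set (x := exp (k * t) * ga / A) in *.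
  pose proof (exp_pos (k * t)) as Ek. pose proof (exp_pos (m * t)) as Em.
  assert (Hx0 : 0 < x) by (apply Rdiv_lt_0_compat; nra).
  (* [d] equals [ga^(p-1) s^2] with [s = exp (m t)]: the squared radius in the natural scale of the
     solution of height [ga]. *)
  set (d := Rpower x (p - 1) / m ^ 2).
  assert (Hdpos : 0 < d) by (apply Rdiv_lt_0_compat; [apply Rpower_pos|exact Hm2]).
  assert (Hxd : Rpower x (p - 1) = m ^ 2 * d) by (unfold d; field; lra).
  assert (Hdd : d <= d0).
  { apply Rmult_le_reg_l with (m ^ 2); [exact Hm2|]. rewrite <- Hxd.
    apply Rle_trans with (Rpower (Rpower (m ^ 2 * d0) (1 / (p - 1))) (p - 1)).
    - apply Rle_Rpower_l; lra.
    - rewrite Rpower_mult. replace (1 / (p - 1) * (p - 1)) with 1 by (field; lra).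
      rewrite Rpower_1 by nra. lra. }
  assert (HPs : Rpower ga p * exp (m * t) ^ 2 = d * ga).
  { assert (Hxp := Rpower_emden p k be m A n t ga HL ltac:(lra)). fold x in Hxp.
    rewrite (Rpower_split x p Hx0), Hxd in Hxp.
    assert (m ^ 2 * exp (k * t) / A * (d * ga) = m ^ 2 * exp (k * t) / A * (Rpower ga p * exp (2 * m * t))).
    { unfold x in Hxp at 1.
      transitivity (exp (k * t) * ga / A * (m ^ 2 * d)); [field; lra|].
      rewrite Hxp. field. lra. }
    apply Rmult_eq_reg_l in H.
    - rewrite H. f_equal. replace (exp (m * t) ^ 2) with (exp (m * t) * exp (m * t)) by ring.
      rewrite <- exp_plus. f_equal. ring.
    - apply Rgt_not_eq. apply Rdiv_lt_0_compat; nra. }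
  assert (Hpos := radial_positive_near_origin Hp Hn Hga Hrs (exp (m * t)) Em).
  specialize (Hpos ltac:(nra)). split; [exact Hpos|].
  destruct (radial_near_origin Hp Hn Hga Hrs (exp (m * t)) Em) as [B1 B2].
  { intros s Hs. now apply Hpos. }
  assert (B3 : u (exp (m * t)) <= ga).
  { apply (radial_le_init Hp Hn Hga Hrs); auto. intros s Hs. now apply Hpos. }
  destruct (Hpos (exp (m * t)) ltac:(lra)) as [B4 _].
  replace (n * Rpower ga p * exp (m * t) ^ 2 / 4) with (n * d * ga / 4) in B2.
  2:{ replace (n * Rpower ga p * exp (m * t) ^ 2) with (n * (Rpower ga p * exp (m * t) ^ 2)) by ring.
      rewrite HPs. field. }
  rewrite HPs in B1.
  assert (Y1 : (1 - d / 4) * x <= emden_y A k m u t <= x).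
  { unfold emden_y, x. assert (0 < exp (k * t) / A) by (apply Rdiv_lt_0_compat; lra).
    split.
    - replace (exp (k * t) * u (exp (m * t)) / A) with (exp (k * t) / A * u (exp (m * t))) by (field; lra).
      replace ((1 - d / 4) * (exp (k * t) * ga / A)) with (exp (k * t) / A * (ga - d * ga / 4)) by (field; lra).
      apply Rmult_le_compat_l; lra.
    - replace (exp (k * t) * u (exp (m * t)) / A) with (exp (k * t) / A * u (exp (m * t))) by (field; lra).
      replace (exp (k * t) * ga / A) with (exp (k * t) / A * ga) by (field; lra).
      apply Rmult_le_compat_l; lra. }
  assert (Y2 : Rabs (emden_c A k m u1 t) <= m * n * d / 4 * x).
  { unfold emden_c, x.
    replace (m * exp (k * t) * exp (m * t) * u1 (exp (m * t)) / A)
      with (m * exp (k * t) / A * (exp (m * t) * u1 (exp (m * t)))) by (field; lra).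
    assert (0 < m * exp (k * t) / A) by (apply Rdiv_lt_0_compat; nra).
    rewrite Rabs_mult, (Rabs_right (m * exp (k * t) / A)) by lra.
    replace (m * n * d / 4 * (exp (k * t) * ga / A))
      with (m * exp (k * t) / A * (n * d * ga / 4)) by (field; lra).
    apply Rmult_le_compat_l; lra. }
  unfold energy. set (y := emden_y A k m u t) in *. set (c := emden_c A k m u1 t) in *.
  assert (Hy : 0 < y).
  { apply Rlt_le_trans with (2 := proj1 Y1). nra. }
  assert (Hpow : y * Rpower y p / (p + 1) <= x ^ 2 * (m ^ 2 * d)).
  { assert (Rpower y p <= Rpower x p) by (apply Rle_Rpower_l; lra).
    pose proof (Rpower_pos y p).
    replace (x ^ 2 * (m ^ 2 * d)) with (x * Rpower x p).
    2:{ rewrite (Rpower_split x p) by exact Hx0. rewrite Hxd. ring. }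
    apply Rle_trans with (y * Rpower y p * 1).
    - apply Rmult_le_compat_l; [nra|].
      rewrite <- Rinv_1. apply Rinv_le_contravar; lra.
    - nra. }
  assert (Hv : (c + k * y) ^ 2 <= ((k + m * n * d / 4) * x) ^ 2).
  { rewrite <- (pow2_abs (c + k * y)). apply pow_incr. split; [apply Rabs_pos|].
    eapply Rle_trans; [apply Rabs_triang|]. rewrite (Rabs_right (k * y)) by nra. nra. }
  assert (Hyl : ((1 - d / 4) * x) ^ 2 <= y ^ 2).
  { apply pow_incr. split; [nra|lra]. }
  assert (Hey : 0 <= eps m t * y ^ 2).
  { pose proof (eps_pos m t Hm). pose proof (pow2_ge_0 y). nra. }
  assert (Hbr : (k + m * n * d / 4) ^ 2 / 2 - (1 - d / 4) ^ 2 / 2 + m ^ 2 * d <= - ((1 - k ^ 2) / 4)).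
  { assert (d * M <= (1 - k ^ 2) / 4) by nra.
    assert (m ^ 2 * n ^ 2 * (d * d) <= m ^ 2 * n ^ 2 * d).
    { apply Rmult_le_compat_l; [pose proof (pow2_ge_0 (m * n)); nra|]. nra. }
    unfold M in *. nra. }
  assert (0 <= x ^ 2) by apply pow2_ge_0.
  assert (x ^ 2 * ((k + m * n * d / 4) ^ 2 / 2 - (1 - d / 4) ^ 2 / 2 + m ^ 2 * d)
     <= x ^ 2 * - ((1 - k ^ 2) / 4)) by (apply Rmult_le_compat_l; lra).
  rewrite !Rpow_mult_distr in Hv, Hyl. nra.
Qed.

(** The reference time [ln (x0 A / ga) / k] is the one where [exp (k t) ga / A = x0]. Up to it
    [u >= 3 ga / 4]; after it the energy stays below [- e0], which keeps [y] positive. That [x0] and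
    [e0] precede [ga] is the point. *)
Lemma radial_global (p k be m A n : R) : emden_link p k be m A n ->
  exists x0 e0, 0 < x0 /\ 0 < e0 /\
  forall ga u u1, 1 < ga -> radial_sol p n ga u u1 ->
    (forall s, 0 < s -> 0 < u s <= ga) /\
    (forall t, sol_at p k be m (emden_y A k m u) (emden_c A k m u1) t) /\
    (forall t, energy p k m (emden_y A k m u) (emden_c A k m u1) t < 0) /\
    energy p k m (emden_y A k m u) (emden_c A k m u1) (ln (x0 * A / ga) / k) <= - e0 /\
    (forall s, 0 < s <= exp (m * (ln (x0 * A / ga) / k)) -> 3 / 4 * ga <= u s).
Proof.
  intros HL. assert (HL' := HL).
  destruct HL' as [[Hp Hk Hkb Hkb1 Hm Hsc _] Hn Hdim HA Hamp].
  assert (HP := el_params _ _ _ _ _ _ HL).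
  assert (Hk1 : k ^ 2 < 1) by nra.
  destruct (initial_energy p k be m A n HL) as [x0 [Hx0 HI]].
  assert (He0 : 0 < x0 ^ 2 * ((1 - k ^ 2) / 4)).
  { apply Rmult_lt_0_compat; [now apply pow_lt|lra]. }
  exists x0, (x0 ^ 2 * ((1 - k ^ 2) / 4)). split; [exact Hx0|]. split; [exact He0|].
  intros ga u u1 Hga Hrs. set (tk := ln (x0 * A / ga) / k).
  assert (Htk : exp (k * tk) * ga / A = x0).
  { unfold tk. replace (k * (ln (x0 * A / ga) / k)) with (ln (x0 * A / ga)) by (field; lra).
    rewrite exp_ln by (apply Rdiv_lt_0_compat; nra). field. lra. }
  set (y := emden_y A k m u). set (c := emden_c A k m u1).
  destruct (HI ga u u1 tk Hga Hrs ltac:(lra)) as [I1 I2]. rewrite Htk in I2. fold y c in I2.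
  assert (Hyu : forall t, 0 < y t <-> 0 < u (exp (m * t))).
  { intros t. unfold y, emden_y. pose proof (exp_pos (k * t)).
    replace (exp (k * t) * u (exp (m * t)) / A) with (exp (k * t) / A * u (exp (m * t))) by (field; lra).
    assert (0 < exp (k * t) / A) by (apply Rdiv_lt_0_compat; lra).
    split; intros; [|now apply Rmult_lt_0_compat].
    apply Rmult_lt_reg_l with (exp (k * t) / A); lra. }
  assert (Hsol : forall t, 0 < y t -> sol_at p k be m y c t).
  { intros t Ht. apply (sol_of_radial p k be m A n); auto. apply Hyu in Ht.
    pose proof (exp_pos (m * t)).
    split; [exact Ht|split]; [now apply (rs_deriv _ _ _ _ _ Hrs)|now apply (rs_eq _ _ _ _ _ Hrs)]. }
  assert (Hy : forall t, 0 < y t).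
  { intros t. destruct (Rle_lt_dec tk t) as [Ht|Ht].
    - apply (sol_positive p k be m y c tk (x0 ^ 2 * ((1 - k ^ 2) / 4))); auto.
      + intros r _. eapply is_derive_continuity_pt, is_derive_emden_y; [exact HA|].
        apply (rs_deriv _ _ _ _ _ Hrs), exp_pos.
      + apply Hyu, I1. pose proof (exp_pos (m * tk)). lra.
    - apply Hyu, I1. split; [apply exp_pos|]. left. apply exp_increasing. nra. }
  assert (Hu : forall s, 0 < s -> 0 < u s).
  { intros s Hs. specialize (Hy (ln s / m)). apply Hyu in Hy.
    replace (m * (ln s / m)) with (ln s) in Hy by (field; lra).
    now rewrite exp_ln in Hy. }
  split; [|split; [|split; [|split]]].
  - intros s Hs. split; [now apply Hu|].
    apply (radial_le_init Hp Hn Hga Hrs); auto. intros r Hr. apply Hu. lra.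
  - intros t. apply Hsol, Hy.
  - intros t. destruct (Rle_lt_dec tk t) as [Ht|Ht].
    + apply Rle_lt_trans with (energy p k m y c tk); [|lra].
      apply (energy_decr p k be m); auto.
    + destruct (HI ga u u1 t Hga Hrs) as [_ I3].
      * rewrite <- Htk. apply Rmult_le_compat_r; [left; now apply Rinv_0_lt_compat|].
        apply Rmult_le_compat_r; [lra|]. left. apply exp_increasing. nra.
      * fold y c in I3. apply Rle_lt_trans with (1 := I3).
        assert (0 < exp (k * t) * ga / A).
        { apply Rdiv_lt_0_compat; [|lra]. pose proof (exp_pos (k * t)). nra. }
        assert (0 < (exp (k * t) * ga / A) ^ 2) by now apply pow_lt. nra.
  - exact I2.
  - intros s Hs. now apply I1.
Qed.

(* Multiplying by [w'] makes the singular coefficient [(n-1)/s] dissipative, so the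
   estimate starts from [s = 0]. *)
Lemma radial_continuous_dependence (p n G : R) : 1 < p -> 3 <= n -> 0 < G ->
  exists K, 0 < K /\ forall ga u u1 ga' v v1,
    radial_sol p n ga u u1 -> radial_sol p n ga' v v1 ->
    (forall s, 0 < s -> 0 < u s <= G) -> (forall s, 0 < s -> 0 < v s <= G) ->
    forall S, 0 < S ->
      (u S - v S) ^ 2 + (u1 S - v1 S) ^ 2 <= (ga - ga') ^ 2 * exp (K * S).
Proof.
  intros Hp Hn HG. set (L := p * Rpower G (p - 1)).
  assert (HL : 0 < L). { unfold L. pose proof (Rpower_pos G (p - 1)). nra. }
  exists (2 + L). split; [lra|]. intros ga u u1 ga' v v1 HU HV HuG HvG S HS.
  set (F := fun s => (u s - v s) ^ 2 + (u1 s - v1 s) ^ 2).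
  set (F' := fun s => 2 * (u s - v s) * (u1 s - v1 s) + 2 * (u1 s - v1 s) *
    (- ((n - 1) / s) * (u1 s - v1 s) + (u s - v s) - (Rpower (u s) p - Rpower (v s) p))).
  assert (HF : forall s, 0 < s -> is_derive F s (F' s)).
  { intros s Hs. pose proof (rs_deriv _ _ _ _ _ HU s Hs) as D1.
    pose proof (rs_eq _ _ _ _ _ HU s Hs (proj1 (HuG s Hs))) as D2.
    pose proof (rs_deriv _ _ _ _ _ HV s Hs) as D3.
    pose proof (rs_eq _ _ _ _ _ HV s Hs (proj1 (HvG s Hs))) as D4.
    unfold F. derive_auto. unfold F'. field. lra. }
  assert (HF' : forall s, 0 < s -> F' s <= (2 + L) * F s).
  { intros s Hs.
    pose proof (Rpower_lipschitz p G (u s) (v s) Hp (HuG s Hs) (HvG s Hs)) as HR. fold L in HR.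
    unfold F', F. set (w := u s - v s) in *. set (w1 := u1 s - v1 s).
    set (r := Rpower (u s) p - Rpower (v s) p) in *.
    assert (Hns : 0 <= (n - 1) / s).
    { apply Rmult_le_pos; [lra|]. left. now apply Rinv_0_lt_compat. }
    pose proof (pow2_ge_0 w1).
    assert (0 <= (n - 1) / s * w1 ^ 2) by now apply Rmult_le_pos.
    assert (2 * w * w1 <= w ^ 2 + w1 ^ 2) by (pose proof (pow2_ge_0 (w - w1)); lra).
    assert (- (2 * w1 * r) <= L * (w ^ 2 + w1 ^ 2)).
    { apply Rle_trans with (1 := Rle_abs _). rewrite Rabs_Ropp, !Rabs_mult, (Rabs_right 2) by lra.
      rewrite <- (pow2_abs w), <- (pow2_abs w1).
      pose proof (Rabs_pos w). pose proof (Rabs_pos w1).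
      pose proof (pow2_ge_0 (Rabs w - Rabs w1)).
      apply Rle_trans with (2 * Rabs w1 * (L * Rabs w)); nra. }
    lra. }
  assert (HFS : F S * exp (- (2 + L) * S) <= (ga - ga') ^ 2).
  { apply (decr_from_limit (fun s => F s * exp (- (2 + L) * s))
      (fun s => (F' s - (2 + L) * F s) * exp (- (2 + L) * s)) S); auto.
    - intros s Hs. pose proof (HF s (proj1 Hs)) as D. clearbody F F'. derive_auto. ring.
    - intros s Hs. specialize (HF' s (proj1 Hs)). pose proof (exp_pos (- (2 + L) * s)). nra.
    - intros e He.
      destruct (continuity_pt_eps (fun x => x ^ 2) (ga - ga')) with (e := e / 2) as [d1 [Hd1 H1]]; [|lra|].
      { apply (is_derive_continuity_pt _ _ (2 * (ga - ga'))). derive_auto. ring. }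
      set (e' := Rmin (d1 / 2) (Rmin (1 / 2) (e / 4))).
      assert (He' : 0 < e') by (repeat apply Rmin_glb_lt; lra).
      assert (e' <= d1 / 2) by apply Rmin_l.
      assert (e' <= 1 / 2) by (eapply Rle_trans; [apply Rmin_r|apply Rmin_l]).
      assert (e' <= e / 4) by (eapply Rle_trans; [apply Rmin_r|apply Rmin_r]).
      destruct (rs_init _ _ _ _ _ HU e' He') as [d [Hd Hu0]].
      destruct (rs_init _ _ _ _ _ HV e' He') as [d' [Hd' Hv0]].
      exists (Rmin d d'). split; [now apply Rmin_glb_lt|]. intros s Hs.
      pose proof (Rmin_l d d'). pose proof (Rmin_r d d').
      destruct (Hu0 s ltac:(lra)) as [A1 A2]. destruct (Hv0 s ltac:(lra)) as [A3 A4].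
      apply Rabs_def2 in A1, A2, A3, A4.
      specialize (H1 (u s - v s)).
      assert (Rabs (u s - v s - (ga - ga')) < d1) as Hlt by (apply Rabs_def1; lra).
      apply H1 in Hlt. apply Rabs_def2 in Hlt.
      assert ((u1 s - v1 s) ^ 2 < e / 2).
      { rewrite <- pow2_abs. assert (Rabs (u1 s - v1 s) < 2 * e') by (apply Rabs_def1; lra).
        pose proof (Rabs_pos (u1 s - v1 s)). nra. }
      assert (exp (- (2 + L) * s) <= 1).
      { rewrite <- exp_0. left. apply exp_increasing. nra. }
      assert (0 <= F s).
      { unfold F. pose proof (pow2_ge_0 (u s - v s)). pose proof (pow2_ge_0 (u1 s - v1 s)). lra. }
      apply Rle_lt_trans with (F s); [nra|]. unfold F. lra. }
  fold (F S). replace (F S) with (F S * exp (- (2 + L) * S) * exp ((2 + L) * S)).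
  - apply Rmult_le_compat_r; [left; apply exp_pos|exact HFS].
  - rewrite Rmult_assoc, <- exp_plus.
    replace (- (2 + L) * S + (2 + L) * S) with 0 by ring. rewrite exp_0. ring.
Qed.

(** * The singular solution near minus infinity *)

Lemma ystar_sol (N : nat) (p k be A n : R) (y : R -> R) :
  emden_link p k be (mcst N p) A n -> alpha N p = be - k -> is_ystar N p y ->
  exists c, (forall t, sol_at p k be (mcst N p) y c t) /\
    (forall e, 0 < e -> exists T, forall t, t <= T ->
       Rabs (y t - 1) < e /\ Rabs (c t + k * y t) < e) /\
    (exists T e1, 0 < e1 /\ forall t, T <= t -> energy p k (mcst N p) y c t <= - e1) /\
    (forall t, energy p k (mcst N p) y c t < 0).
Proof.
  intros HL Hal [(y' & y'' & H1 & H2 & H3) Hlim]. rewrite Hal in H3.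
  set (m := mcst N p) in *. assert (HP := el_params _ _ _ _ _ _ HL).
  assert (HP' := HP). destruct HP' as [Hp Hk Hkb Hkb1 Hm Hsc _].
  set (c := fun t => y' t - k * y t).
  assert (D1 : forall t, is_derive y t (y' t)) by (intros t; apply is_derive_Reals, H1).
  assert (D2 : forall t, is_derive y' t (y'' t)) by (intros t; apply is_derive_Reals, H2).
  assert (Hsol : forall t, 0 < y t -> sol_at p k be m y c t).
  { intros t Ht. split; [exact Ht|split].
    - replace (c t + k * y t) with (y' t) by (unfold c; ring). apply D1.
    - specialize (H3 t). unfold powr in H3. destruct (Rlt_dec 0 (y t)); [|lra].
      specialize (D1 t). specialize (D2 t).
      unfold c, eps. derive_auto.
      replace (y'' t) with (- (be - k) * y' t + y t - Rpower (y t) p + m ^ 2 * exp (2 * m * t) * y t) by lra.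
      replace (y t - Rpower (y t) p) with (k * be * y t - Rpower (y t) p) by (rewrite Hkb1; ring).
      transitivity (- be * y' t + be * k * y t - Rpower (y t) p + m ^ 2 * exp (2 * m * t) * y t); [|ring].
      replace (- (be - k) * y' t + y t) with (- (be - k) * y' t + k * be * y t) by (rewrite Hkb1; ring).
      ring. }
  assert (Hcv : forall t, c t + k * y t = y' t) by (intros; unfold c; ring).
  assert (Hconv : forall e, 0 < e -> exists T, forall t, t <= T ->
       Rabs (y t - 1) < e /\ Rabs (c t + k * y t) < e).
  { intros e He. set (al := be - k) in *. assert (Hal0 : 0 < al) by (unfold al; lra).
    set (et := Rmin (1 / 2) (e / (4 + 2 * al))).
    assert (Het : 0 < et) by (apply Rmin_glb_lt; [lra|apply Rdiv_lt_0_compat; lra]).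
    assert (Het1 : et <= 1 / 2) by apply Rmin_l.
    assert (Het2 : (4 + 2 * al) * et <= e).
    { apply Rle_trans with ((4 + 2 * al) * (e / (4 + 2 * al))).
      apply Rmult_le_compat_l; [lra|apply Rmin_r]. right; field; lra. }
    destruct (continuity_pt_eps (fun x => x - Rpower x p) 1) with (e := et / 2) as [d [Hd Hc]]; [|lra|].
    { pose proof (is_derive_Rpower p 1 ltac:(lra)) as D.
      apply (is_derive_continuity_pt _ _ (1 - p * Rpower 1 (p - 1))).
      set (R1 := fun x => Rpower x p) in *.
      apply (is_derive_ext (fun x => x - R1 x)); [intros; reflexivity|]. derive_auto. ring. }
    destruct (Hlim (Rmin d et)) as [T1 HT1]; [now apply Rmin_glb_lt|].
    destruct (eps_small m (et / 4) Hm ltac:(lra)) as [T2 HT2].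
    set (T := Rmin (T1 - 1) T2).
    assert (T <= T1 - 1) by apply Rmin_l. assert (T <= T2) by apply Rmin_r.
    assert (Hy : forall t, t <= T -> Rabs (y t - 1) < et).
    { intros t Ht. specialize (HT1 t ltac:(lra)). pose proof (Rmin_r d et). lra. }
    set (g := fun t => y t - Rpower (y t) p + eps m t * y t).
    assert (Hg : forall t, t <= T -> Rabs (g t) <= et).
    { intros t Ht. specialize (HT1 t ltac:(lra)). specialize (HT2 t ltac:(lra)).
      specialize (Hc (y t)). pose proof (Rmin_l d et). specialize (Hc ltac:(lra)).
      rewrite Rpower_base_1 in Hc. specialize (Hy t Ht). apply Rabs_def2 in Hc, Hy.
      pose proof (eps_pos m t Hm). unfold g. apply Rabs_le. nra. }
    (* Only [y -> 1] is given; [y' -> 0] must be extracted from the equation. [h] has a small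
       derivative, so it is almost constant on [[t, t + 1]]. Somewhere in that interval [y'] equals
       [y (t + 1) - y t], which is small, and [h] carries this back to [t]. *)
    set (h := fun t => y' t + al * y t).
    assert (Dh : forall t, t <= T -> is_derive h t (g t)).
    { intros t Ht. specialize (H3 t). specialize (Hy t Ht). apply Rabs_def2 in Hy.
      unfold powr in H3. destruct (Rlt_dec 0 (y t)); [|lra].
      specialize (D1 t). specialize (D2 t). unfold h. derive_auto. unfold g, eps. lra. }
    exists (T - 1). intros t Ht.
    assert (Hyt := Hy t ltac:(lra)). split.
    - assert (et <= (4 + 2 * al) * et) by nra. lra.
    - rewrite Hcv.
      destruct (mean_value y y' t (t + 1) ltac:(lra)) as [x [Hx Ex]]; [intros; apply D1|].
      assert (Hy1 := Hy (t + 1) ltac:(lra)). assert (Hyx := Hy x ltac:(lra)).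
      assert (Hhx : Rabs (h x - h t) <= et).
      { destruct (proj1 Hx) as [Hlt|Heq].
        - destruct (mean_value h g t x Hlt) as [z [Hz Ez]]; [intros; apply Dh; lra|].
          rewrite Ez, Rabs_mult, (Rabs_right (x - t)) by lra.
          specialize (Hg z ltac:(lra)). pose proof (Rabs_pos (g z)). nra.
        - rewrite <- Heq, Rminus_diag, Rabs_R0. lra. }
      unfold h in Hhx. apply Rabs_le_between in Hhx. apply Rabs_def2 in Hyt, Hy1, Hyx.
      assert (- (2 * al * et) < al * (y x - y t) < 2 * al * et) by nra.
      apply Rabs_def1; nra. }
  assert (Hneg : exists T e1, 0 < e1 /\ forall t, t <= T ->
      0 < y t /\ energy p k m y c t <= - e1).
  (* The energy tends to [1 / (p + 1) - 1 / 2 = - 2 e1] at minus infinity; half of this is kept. *)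
  { set (e1 := (1 / 2 - 1 / (p + 1)) / 2).
    assert (He1 : 0 < e1).
    { unfold e1. replace (1 / 2 - 1 / (p + 1)) with ((p - 1) / (2 * (p + 1))) by (field; lra).
      assert (0 < (p - 1) / (2 * (p + 1))) by (apply Rdiv_lt_0_compat; lra). lra. }
    destruct (continuity_pt_eps (potential p) 1) with (e := e1 / 2) as [d [Hd Hc]]; [|lra|].
    { eapply is_derive_continuity_pt, is_derive_potential; lra. }
    set (d1 := Rmin d (Rmin (1 / 2) e1)).
    assert (0 < d1) by (repeat apply Rmin_glb_lt; lra).
    assert (d1 <= d) by apply Rmin_l.
    assert (d1 <= 1 / 2) by (eapply Rle_trans; [apply Rmin_r|apply Rmin_l]).
    assert (d1 <= e1) by (eapply Rle_trans; [apply Rmin_r|apply Rmin_r]).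
    destruct (Hconv d1 ltac:(lra)) as [T HT]. exists T, e1. split; [exact He1|].
    intros t Ht. destruct (HT t Ht) as [I1 I2]. specialize (Hc (y t) ltac:(lra)).
    rewrite potential_1 in Hc by exact Hp. apply Rabs_def2 in Hc.
    assert (Hv : (c t + k * y t) ^ 2 <= 1 / 2 * e1).
    { rewrite <- pow2_abs. pose proof (Rabs_pos (c t + k * y t)). nra. }
    apply Rabs_def2 in I1. split; [lra|].
    unfold energy. unfold potential in Hc. pose proof (eps_pos m t Hm).
    assert (0 <= eps m t * y t ^ 2) by (pose proof (pow2_ge_0 (y t)); nra).
    assert (1 / 2 - 1 / (p + 1) = 2 * e1) by (unfold e1; field; lra). lra. }
  destruct Hneg as (T & e1 & He1 & Hneg).
  assert (Hpos : forall t, 0 < y t).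
  { intros t. destruct (Rle_lt_dec T t) as [Ht|Ht]; [|apply Hneg; lra].
    apply (sol_positive p k be m y c T e1); auto.
    - intros r _. eapply is_derive_continuity_pt, D1.
    - apply Hneg; lra.
    - apply Hneg; lra. }
  assert (Hle : forall t, T <= t -> energy p k m y c t <= - e1).
  { intros t Ht. eapply Rle_trans; [|apply (Hneg T); lra].
    apply (energy_decr p k be m); auto. }
  exists c. split; [auto|]. split; [exact Hconv|]. split.
  - exists T, e1. auto.
  - intros t. destruct (Rle_lt_dec T t) as [Ht|Ht].
    + specialize (Hle t Ht). lra.
    + destruct (Hneg t ltac:(lra)). lra.
Qed.

(** * Winding of the difference *)

Lemma derive_eq_unique (f g df : R -> R) (a b : R) : a <= b ->
  (forall t, a <= t <= b -> is_derive f t (df t)) ->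
  (forall t, a <= t <= b -> is_derive g t (df t)) -> f a = g a -> f b = g b.
Proof.
  intros Hab Hf Hg Ha.
  assert (Hd : forall t, a <= t <= b -> is_derive (fun t => f t - g t) t 0).
  { intros t Ht. specialize (Hf t Ht). specialize (Hg t Ht). derive_auto. ring. }
  pose proof (derive_nonpos_decr (fun t => f t - g t) (fun _ => 0) a b Hab Hd ltac:(intros; lra)).
  pose proof (derive_nonneg_incr (fun t => f t - g t) (fun _ => 0) a b Hab Hd ltac:(intros; lra)).
  simpl in *. lra.
Qed.

Lemma derive_neg_left (f : R -> R) (T l a : R) : is_derive f T l -> l < 0 -> a < T ->
  exists t, a <= t < T /\ f T < f t.
Proof.
  intros Hd Hl Ha. apply is_derive_Reals in Hd.
  destruct (Hd (- l / 2) ltac:(lra)) as [d Hd'].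
  set (h := Rmin (T - a) (d / 2)). pose proof (cond_pos d) as Hd0.
  assert (Hh : 0 < h) by (apply Rmin_glb_lt; lra).
  pose proof (Rmin_l (T - a) (d / 2)). pose proof (Rmin_r (T - a) (d / 2)). fold h in H, H0.
  exists (T - h). split; [lra|].
  assert (Habs : Rabs (- h) < d) by (rewrite Rabs_Ropp, Rabs_right; lra).
  specialize (Hd' (- h) ltac:(lra) Habs). replace (T + - h) with (T - h) in Hd' by ring.
  apply Rabs_def2 in Hd'. destruct Hd' as [Hd1 _].
  assert (E : (f (T - h) - f T) / - h * (- h) = f (T - h) - f T) by (field; lra).
  set (q := (f (T - h) - f T) / - h) in *. nra.
Qed.

Lemma continuous_angular_speed (z w z1 w1 : R -> R) (t : R) :
  continuity_pt z t -> continuity_pt w t -> continuity_pt z1 t -> continuity_pt w1 t ->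
  0 < z t ^ 2 + w t ^ 2 ->
  continuity_pt (fun t => (z t * w1 t - w t * z1 t) / (z t ^ 2 + w t ^ 2)) t.
Proof.
  intros Cz Cw Cz1 Cw1 Hp.
  apply (continuity_pt_ext ((z * w1 - w * z1) / (z * z + w * w))%F).
  { intros x. unfold div_fct, minus_fct, mult_fct, plus_fct. f_equal. ring. }
  apply continuity_pt_div.
  - apply continuity_pt_minus; apply continuity_pt_mult; assumption.
  - apply continuity_pt_plus; apply continuity_pt_mult; assumption.
  - unfold plus_fct, mult_fct. nra.
Qed.

Lemma is_derive_angle (om : R -> R) (f0 a t : R) : (forall t, continuity_pt om t) ->
  is_derive (fun t => f0 + RInt om a t) t (om t).
Proof.
  intros Hc.
  assert (H : is_derive (fun t => RInt om a t) t (om t)).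
  { apply (is_derive_RInt om (fun t => RInt om a t) a t).
    - apply filter_forall. intros b. apply (@RInt_correct R_CompleteNormedModule).
      apply (ex_RInt_continuous (V := R_CompleteNormedModule)).
      intros x _. apply continuity_pt_filterlim, Hc.
    - apply continuity_pt_filterlim, Hc. }
  set (I := fun t => RInt om a t) in *.
  apply (is_derive_ext (fun t => f0 + I t)); [intros; reflexivity|]. derive_auto. ring.
Qed.

(** The angle is obtained by integrating the angular speed rather than by choosing arguments of
    [(z, w)]. [X] and [Y] are the coordinates in the frame turned by [phi]; divided by the radius
    they have zero derivative and keep their initial values 1 and 0. *)
Lemma polar_lift (z w z1 w1 phi : R -> R) (a b : R) : a <= b ->
  (forall t, is_derive z t (z1 t)) -> (forall t, is_derive w t (w1 t)) ->
  (forall t, 0 < z t ^ 2 + w t ^ 2) ->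
  (forall t, is_derive phi t ((z t * w1 t - w t * z1 t) / (z t ^ 2 + w t ^ 2))) ->
  z a = sqrt (z a ^ 2 + w a ^ 2) * cos (phi a) ->
  w a = sqrt (z a ^ 2 + w a ^ 2) * sin (phi a) ->
  z b = sqrt (z b ^ 2 + w b ^ 2) * cos (phi b) /\
  w b = sqrt (z b ^ 2 + w b ^ 2) * sin (phi b).
Proof.
  intros Hab Hz Hw Hp Hphi Hca Hsa.
  set (rho := fun t => sqrt (z t ^ 2 + w t ^ 2)) in *.
  fold (rho a) in Hca, Hsa. fold (rho b).
  assert (Hr : forall t, 0 < rho t) by (intros t; apply sqrt_lt_R0, Hp).
  assert (Hr2 : forall t, rho t * rho t = z t ^ 2 + w t ^ 2).
  { intros t. apply sqrt_sqrt. specialize (Hp t). lra. }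
  assert (Dr : forall t, is_derive rho t ((z t * z1 t + w t * w1 t) / rho t)).
  { intros t. specialize (Hz t). specialize (Hw t). specialize (Hp t). unfold rho.
    derive_auto.
    replace (z t * (z t * 1) + w t * (w t * 1)) with (z t ^ 2 + w t ^ 2) by ring.
    pose proof (sqrt_lt_R0 _ Hp). field. lra. }
  set (X := fun t => z t * cos (phi t) + w t * sin (phi t)).
  set (Y := fun t => - z t * sin (phi t) + w t * cos (phi t)).
  assert (SC : forall t, sin (phi t) * sin (phi t) + cos (phi t) * cos (phi t) = 1).
  { intros t. pose proof (sin2_cos2 (phi t)) as E. unfold Rsqr in E. exact E. }
  assert (Hzero : forall t, is_derive (fun t => X t / rho t) t 0 /\ is_derive (fun t => Y t / rho t) t 0).
  { intros t. pose proof (Hz t) as D1. pose proof (Hw t) as D2. pose proof (Dr t) as D3.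
    pose proof (Hphi t) as D4. pose proof (Hr t) as Pr. pose proof (Hp t) as Pp.
    pose proof (Hr2 t) as E. unfold X, Y. clearbody rho.
    assert (Hn : z t ^ 2 + w t ^ 2 <> 0) by lra. rewrite <- E in D4.
    split; derive_auto; set (C := cos (phi t)); set (S := sin (phi t)); field_simplify; try lra.
    - replace (rho t ^ 3) with (rho t * (z t ^ 2 + w t ^ 2)) by (rewrite <- E; ring).
      replace (rho t ^ 2) with (z t ^ 2 + w t ^ 2) by (rewrite <- E; ring).
      unfold Rdiv. apply Rmult_eq_0_compat_r. ring.
    - replace (rho t ^ 3) with (rho t * (z t ^ 2 + w t ^ 2)) by (rewrite <- E; ring).
      replace (rho t ^ 2) with (z t ^ 2 + w t ^ 2) by (rewrite <- E; ring).
      unfold Rdiv. apply Rmult_eq_0_compat_r. ring. }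
  assert (HX : X b / rho b = 1).
  { apply (derive_eq_unique (fun t => X t / rho t) (fun _ => 1) (fun _ => 0) a b Hab).
    - intros; apply Hzero.
    - intros. auto_derive; auto.
    - unfold X. rewrite Hca at 1. rewrite Hsa at 1. specialize (Hr a). specialize (SC a).
      transitivity (sin (phi a) * sin (phi a) + cos (phi a) * cos (phi a)); [field; lra|exact SC]. }
  assert (HY : Y b / rho b = 0).
  { apply (derive_eq_unique (fun t => Y t / rho t) (fun _ => 0) (fun _ => 0) a b Hab).
    - intros; apply Hzero.
    - intros. auto_derive; auto.
    - unfold Y. rewrite Hca at 1. rewrite Hsa at 1. specialize (Hr a). field. lra. }
  pose proof (Hr b) as Pb. specialize (SC b).
  assert (X b = rho b). { replace (X b) with (X b / rho b * rho b) by (field; lra). rewrite HX. ring. }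
  assert (Y b = 0). { replace (Y b) with (Y b / rho b * rho b) by (field; lra). rewrite HY. ring. }
  unfold X in H. unfold Y in H0.
  set (C := cos (phi b)) in *. set (S := sin (phi b)) in *. split.
  - transitivity (z b * (S * S + C * C)); [rewrite SC; ring|]. rewrite <- H.
    transitivity ((z b * C + w b * S) * C - (- z b * S + w b * C) * S); [ring|rewrite H0; ring].
  - transitivity (w b * (S * S + C * C)); [rewrite SC; ring|]. rewrite <- H.
    transitivity ((z b * C + w b * S) * S + (- z b * S + w b * C) * C); [ring|rewrite H0; ring].
Qed.

Lemma polar_left_half_plane (z w : R) : z < 0 ->
  z = sqrt (z ^ 2 + w ^ 2) * cos (atan (w / z) + PI) /\
  w = sqrt (z ^ 2 + w ^ 2) * sin (atan (w / z) + PI).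
Proof.
  intros Hz. rewrite neg_cos, neg_sin, cos_atan, sin_atan.
  set (q := sqrt (1 + Rsqr (w / z))).
  assert (Hs : 0 < 1 + Rsqr (w / z)) by (pose proof (Rle_0_sqr (w / z)); lra).
  assert (Hq : 0 < q) by now apply sqrt_lt_R0.
  assert (E : sqrt (z ^ 2 + w ^ 2) = - z * q).
  { apply sqrt_lem_1; [nra|nra|]. unfold q.
    replace (- z * sqrt (1 + Rsqr (w / z)) * (- z * sqrt (1 + Rsqr (w / z))))
      with (z * z * (sqrt (1 + Rsqr (w / z)) * sqrt (1 + Rsqr (w / z)))) by ring.
    rewrite sqrt_sqrt by lra. unfold Rsqr. field. lra. }
  rewrite E. split; field; lra.
Qed.

Lemma cos_gt_small (x e : R) : 0 <= e <= PI -> Rabs x < PI -> cos e < cos x -> Rabs x < e.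
Proof.
  intros He Hx Hc. destruct (Rlt_le_dec (Rabs x) e) as [|Hle]; [assumption|exfalso].
  assert (cos (Rabs x) <= cos e).
  { pose proof (Rabs_pos x). apply cos_decr_1; lra. }
  enough (cos (Rabs x) = cos x) by lra.
  unfold Rabs. destruct (Rcase_abs x); [apply cos_neg|reflexivity].
Qed.

(* The polar angle of [(z g t, w g t)] is normalised to lie in [(PI/2, 3PI/2)] for [t]
   near minus infinity, where [z < 0]. Since it decreases whenever it crosses the axis
   [z = 0], it can only be driven down, and for large [g] it makes arbitrarily many turns
   before time [t1]; it depends continuously on [g]. *)
Section Winding.
Context {z w z1 w1 : R -> R -> R} {G0 t1 : R}.
Hypotheses
  (Hz : forall g t, G0 < g -> is_derive (z g) t (z1 g t))
  (Hw : forall g t, G0 < g -> is_derive (w g) t (w1 g t))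
  (Cz1 : forall g t, G0 < g -> continuity_pt (z1 g) t)
  (Cw1 : forall g t, G0 < g -> continuity_pt (w1 g) t)
  (Hpos : forall g t, G0 < g -> 0 < z g t ^ 2 + w g t ^ 2)
  (Hcross : forall g t, G0 < g -> z g t = 0 -> z1 g t = w g t)
  (Hbase : forall G, exists tb, forall g t, G0 < g <= G -> t <= tb -> z g t < 0)
  (Hcont : forall g0 a b s, G0 < g0 -> 0 < s -> exists d, 0 < d /\
     forall g t, G0 < g -> Rabs (g - g0) < d -> a <= t <= b ->
       (z g t - z g0 t) ^ 2 + (w g t - w g0 t) ^ 2 <= s ^ 2 * (z g0 t ^ 2 + w g0 t ^ 2))
  (Hrot : exists ka t0, 0 < ka /\ t0 <= t1 /\ forall L, exists G, forall g, G0 < g -> G <= g ->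
     exists a, a <= t0 - L /\ forall t, a <= t <= t0 ->
       z g t * w1 g t - w g t * z1 g t <= - ka * (z g t ^ 2 + w g t ^ 2)).

Let om g t := (z g t * w1 g t - w g t * z1 g t) / (z g t ^ 2 + w g t ^ 2).
Let rho g t := sqrt (z g t ^ 2 + w g t ^ 2).
Let base g t := atan (w g t / z g t) + PI.
Let phi tb g t := base g tb + RInt (om g) tb t.

Lemma phi_derive (tb g t : R) : G0 < g -> is_derive (phi tb g) t (om g t).
Proof.
  intros Hg. apply is_derive_angle. intros x. apply continuous_angular_speed; auto.
  - eapply is_derive_continuity_pt. now apply Hz.
  - eapply is_derive_continuity_pt. now apply Hw.
Qed.

Lemma phi_start (tb g : R) : phi tb g tb = base g tb.
Proof. unfold phi. rewrite RInt_point. unfold zero. simpl. ring. Qed.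

Lemma phi_polar (tb g t : R) : G0 < g -> z g tb < 0 -> tb <= t ->
  z g t = rho g t * cos (phi tb g t) /\ w g t = rho g t * sin (phi tb g t).
Proof.
  intros Hg Hneg Ht.
  destruct (polar_left_half_plane (z g tb) (w g tb) Hneg) as [E1 E2].
  apply (polar_lift (z g) (w g) (z1 g) (w1 g) (phi tb g) tb t); auto.
  - intros x. now apply phi_derive.
  - now rewrite phi_start.
  - now rewrite phi_start.
Qed.

(** Where [z = 0], [Hcross] makes the angular speed exactly [- 1], so the angle cannot arrive from
    below at a value whose cosine vanishes. *)
Lemma phi_barrier (tb g a b c : R) : G0 < g -> z g tb < 0 -> tb <= a -> a <= b ->
  cos c = 0 -> phi tb g a < c -> phi tb g b < c.
Proof.
  intros Hg Hneg Hta Hab Hc Ha.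
  destruct (Rlt_le_dec (phi tb g b) c) as [|Hle]; [assumption|exfalso].
  destruct (first_zero (fun t => c - phi tb g t) a b) as [T [HT [HT0 HTp]]]; auto; try lra.
  - intros t Ht. apply continuity_pt_minus; [apply continuity_pt_const; now intros ? ?|].
    eapply is_derive_continuity_pt. now apply phi_derive.
  - assert (HE : phi tb g T = c) by lra.
    destruct (phi_polar tb g T Hg Hneg ltac:(lra)) as [E _].
    rewrite HE, Hc, Rmult_0_r in E.
    assert (Hom : om g T = -1).
    { unfold om. rewrite (Hcross g T Hg E), E. specialize (Hpos g T Hg). rewrite E in Hpos.
      field. nra. }
    destruct (derive_neg_left (phi tb g) T (om g T) a) as [t [Ht Hlt]]; try lra.
    + now apply phi_derive.
    + specialize (HTp t Ht). lra.
Qed.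

(** While [z < 0] the explicit angle [base] has the same derivative as [phi], so starting earlier
    changes nothing. This is required because a starting time that suits all parameters up to [G]
    may recede as [G] grows. *)
Lemma phi_base_indep (tb tb' g t : R) : G0 < g -> tb' <= tb -> tb <= t ->
  (forall r, r <= tb -> z g r < 0) -> phi tb' g t = phi tb g t.
Proof.
  intros Hg Htb Ht Hneg.
  assert (E : phi tb' g tb = phi tb g tb).
  { rewrite phi_start.
    apply (derive_eq_unique (phi tb' g) (base g) (om g) tb' tb Htb).
    - intros x _. now apply phi_derive.
    - intros x Hx. specialize (Hneg x ltac:(lra)). pose proof (Hz g x Hg) as D1.
      pose proof (Hw g x Hg) as D2. unfold base. derive_auto. unfold om.
      specialize (Hpos g x Hg). field. repeat split; nra.
    - apply phi_start. }
  apply (derive_eq_unique (phi tb' g) (phi tb g) (om g) tb t Ht); auto;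
    intros x _; now apply phi_derive.
Qed.

Lemma base_bound (g t : R) : PI / 2 < base g t < 3 * (PI / 2).
Proof. unfold base. pose proof (atan_bound (w g t / z g t)). lra. Qed.

(** At [tb] the two angles differ by less than [PI], both vectors lying in the left half plane.
    Relative closeness of the vectors keeps the cosine of the difference above [cos et] up to [t1],
    so by continuity in time the difference stays within [et] of 0 and cannot jump by full turns. *)
Lemma phi_continuous (tb G g0 : R) : tb <= t1 -> G0 < g0 < G ->
  (forall g, G0 < g <= G -> z g tb < 0) -> continuity_pt (fun g => phi tb g t1) g0.
Proof.
  intros Htb Hg0 Hneg e He.
  set (et := Rmin e (PI / 2)). pose proof PI_RGT_0 as HPI.
  assert (Het : 0 < et) by (apply Rmin_glb_lt; lra).
  assert (Het1 : et <= e) by apply Rmin_l. assert (Het2 : et <= PI / 2) by apply Rmin_r.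
  set (ck := cos et).
  assert (Hck : 0 <= ck < 1).
  { unfold ck. split; [apply cos_ge_0; lra|]. rewrite <- cos_0. apply cos_decreasing_1; lra. }
  (* If the cosine were at most [ck], the two vectors would be at distance at least
     [sqrt (1 - ck^2)] times the length of the reference one, which exceeds [s] times that
     length. *)
  set (s := sqrt ((1 - ck ^ 2) / 2)).
  assert (Hs2 : s * s = (1 - ck ^ 2) / 2) by (apply sqrt_sqrt; nra).
  assert (Hs : 0 < s) by (apply sqrt_lt_R0; nra).
  destruct (Hcont g0 tb t1 s (proj1 Hg0) Hs) as [d [Hd Hcl]].
  exists (Rmin d (Rmin (g0 - G0) (G - g0))).
  split; [repeat apply Rmin_glb_lt; lra|].
  intros g [_ Hg]. change (Rabs (g - g0) < Rmin d (Rmin (g0 - G0) (G - g0))) in Hg.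
  change (Rabs (phi tb g t1 - phi tb g0 t1) < e).
  pose proof (Rmin_l d (Rmin (g0 - G0) (G - g0))).
  pose proof (Rmin_r d (Rmin (g0 - G0) (G - g0))).
  pose proof (Rmin_l (g0 - G0) (G - g0)). pose proof (Rmin_r (g0 - G0) (G - g0)).
  assert (Hgd : Rabs (g - g0) < d) by lra.
  assert (Hgm : Rabs (g - g0) < Rmin (g0 - G0) (G - g0)) by lra.
  apply Rabs_def2 in Hgm. assert (HgG : G0 < g <= G) by lra.
  set (psi := fun t => phi tb g t - phi tb g0 t).
  assert (Hpsi : forall t, tb <= t <= t1 -> cos et < cos (psi t)).
  { intros t Ht. fold ck. destruct (Rlt_le_dec ck (cos (psi t))) as [|Hle]; [assumption|exfalso].
    specialize (Hcl g t ltac:(lra) Hgd Ht).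
    destruct (phi_polar tb g t ltac:(lra) (Hneg g HgG) ltac:(lra)) as [E1 E2].
    destruct (phi_polar tb g0 t ltac:(lra) (Hneg g0 ltac:(lra)) ltac:(lra)) as [E3 E4].
    assert (Ec : z g t * z g0 t + w g t * w g0 t = rho g t * rho g0 t * cos (psi t)).
    { unfold psi. rewrite cos_minus. rewrite E1, E2, E3, E4 at 1. ring. }
    assert (R1 : rho g t * rho g t = z g t ^ 2 + w g t ^ 2).
    { apply sqrt_sqrt. pose proof (Hpos g t ltac:(lra)). lra. }
    assert (R2 : rho g0 t * rho g0 t = z g0 t ^ 2 + w g0 t ^ 2).
    { apply sqrt_sqrt. pose proof (Hpos g0 t ltac:(lra)). lra. }
    assert (P1 : 0 < rho g t) by (apply sqrt_lt_R0, Hpos; lra).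
    assert (P2 : 0 < rho g0 t) by (apply sqrt_lt_R0, Hpos; lra).
    set (r := rho g t) in *. set (r0 := rho g0 t) in *.
    assert (Hi : r * r + r0 * r0 - 2 * (r * r0 * cos (psi t)) <= s * s * (r0 * r0)).
    { rewrite R1, R2, <- Ec. replace (s * s) with (s ^ 2) by ring. lra. }
    assert (r * r0 * cos (psi t) <= r * r0 * ck) by (apply Rmult_le_compat_l; [nra|exact Hle]).
    rewrite Hs2 in Hi. assert (0 < r0 * r0) by nra.
    assert (0 < (1 - ck ^ 2) / 2 * (r0 * r0)) by (apply Rmult_lt_0_compat; [nra|assumption]).
    pose proof (pow2_ge_0 (r - ck * r0)). nra. }
  assert (Cpsi : forall t, continuity_pt psi t).
  { intros t. apply continuity_pt_minus;
      eapply is_derive_continuity_pt, phi_derive; lra. }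
  assert (Hstart : Rabs (psi tb) < et).
  { apply cos_gt_small; [lra| |apply Hpsi; lra].
    unfold psi. rewrite !phi_start. pose proof (base_bound g tb). pose proof (base_bound g0 tb).
    apply Rabs_def1; lra. }
  apply Rlt_le_trans with et; [|exact Het1]. apply Rabs_def2 in Hstart. fold (psi t1).
  apply Rabs_def1.
  - destruct (Rlt_le_dec (psi t1) et) as [|Hle]; [assumption|exfalso].
    destruct (first_zero (fun t => et - psi t) tb t1 Htb) as [T [HT [HT0 _]]]; try lra.
    + intros t _. apply continuity_pt_minus; [apply continuity_pt_const; now intros ? ?|apply Cpsi].
    + specialize (Hpsi T ltac:(lra)). replace (psi T) with et in Hpsi by lra. lra.
  - destruct (Rlt_le_dec (- et) (psi t1)) as [|Hle]; [assumption|exfalso].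
    destruct (first_zero (fun t => et + psi t) tb t1 Htb) as [T [HT [HT0 _]]]; try lra.
    + intros t _. apply continuity_pt_plus; [apply continuity_pt_const; now intros ? ?|apply Cpsi].
    + specialize (Hpsi T ltac:(lra)). replace (psi T) with (- et) in Hpsi by lra.
      rewrite cos_neg in Hpsi. lra.
Qed.

Lemma winding_attains (f0 M : R) : exists g r, M < g /\ G0 < g /\ 0 < r /\
  z g t1 = r * cos f0 /\ w g t1 = r * sin f0.
Proof.
  pose proof PI_RGT_0 as HPI.
  set (g1 := Rmax M G0 + 1).
  assert (Hg1 : M < g1 /\ G0 < g1).
  { unfold g1. pose proof (Rmax_l M G0). pose proof (Rmax_r M G0). lra. }
  destruct (Hbase g1) as [tb1 Htb1].
  set (tc := Rmin tb1 t1).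
  assert (Htc : tc <= tb1 /\ tc <= t1) by (split; [apply Rmin_l|apply Rmin_r]).
  destruct (INR_unbounded ((f0 - phi tc g1 t1) / (2 * PI))) as [j Hj].
  assert (Hj' : f0 - 2 * INR j * PI < phi tc g1 t1).
  { apply Rmult_lt_compat_r with (r := 2 * PI) in Hj; [|lra].
    replace ((f0 - phi tc g1 t1) / (2 * PI) * (2 * PI)) with (f0 - phi tc g1 t1) in Hj
      by (field; lra). lra. }
  (* The angle matters modulo full turns, so the target may be lowered below the angle of [g1]; [K]
     turns will then bring the angle of some [g2] below the target. *)
  set (tgt := f0 - 2 * INR j * PI) in *.
  destruct (INR_unbounded ((3 * (PI / 2) - tgt) / (2 * PI))) as [K HK].
  assert (HK' : 3 * (PI / 2) - 2 * INR K * PI < tgt).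
  { apply Rmult_lt_compat_r with (r := 2 * PI) in HK; [|lra].
    replace ((3 * (PI / 2) - tgt) / (2 * PI) * (2 * PI)) with (3 * (PI / 2) - tgt) in HK
      by (field; lra). lra. }
  destruct Hrot as (ka & t0 & Hka & Ht0 & HL).
  destruct (HL (2 * INR K * PI / ka)) as [G HG].
  assert (HLpos : 0 <= 2 * INR K * PI / ka).
  { apply Rmult_le_pos; [|left; now apply Rinv_0_lt_compat]. pose proof (pos_INR K). nra. }
  set (g2 := Rmax G g1 + 1).
  assert (Hg2 : G < g2 /\ g1 < g2).
  { unfold g2. pose proof (Rmax_l G g1). pose proof (Rmax_r G g1). lra. }
  destruct (HG g2 ltac:(lra) ltac:(lra)) as [a [Ha Hra]].
  (* Continuity in [g] requires one starting time for all parameters between [g1] and [g2]; the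
     margin 1 makes [g2] interior. *)
  destruct (Hbase (g2 + 1)) as [tb2 Htb2].
  set (tb := Rmin tb2 (Rmin tc a)).
  assert (Htb : tb <= tb2 /\ tb <= tc /\ tb <= a).
  { unfold tb. repeat split; [apply Rmin_l|eapply Rle_trans; [apply Rmin_r|apply Rmin_l]
      |eapply Rle_trans; [apply Rmin_r|apply Rmin_r]]. }
  assert (Hneg : forall g, G0 < g <= g2 + 1 -> z g tb < 0) by (intros; apply Htb2; lra).
  assert (HA : tgt < phi tb g1 t1).
  { rewrite (phi_base_indep tc tb g1 t1); auto; try lra.
    intros r Hr. apply Htb1; lra. }
  assert (HB : phi tb g2 t1 < tgt).
  { apply Rlt_trans with (2 := HK').
    assert (N2 : z g2 tb < 0) by (apply Hneg; lra).
    (* The barrier acts twice: below [3 PI / 2] up to [a], and below [3 PI / 2 - 2 K PI] from [t0]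
       on. Between [a] and [t0] the angle falls by at least [2 K PI]. *)
    apply (phi_barrier tb g2 t0 t1); auto; try lra.
    - rewrite <- (cos_period _ K).
      replace (3 * (PI / 2) - 2 * INR K * PI + 2 * INR K * PI) with (3 * (PI / 2)) by ring.
      apply cos_3PI2.
    - assert (H1 : phi tb g2 a < 3 * (PI / 2)).
      { apply (phi_barrier tb g2 tb a); auto; try lra; [apply cos_3PI2|].
        rewrite phi_start. apply base_bound. }
      assert (H2 : phi tb g2 t0 + ka * t0 <= phi tb g2 a + ka * a).
      { apply (derive_nonpos_decr (fun t => phi tb g2 t + ka * t) (fun t => om g2 t + ka)); try lra.
        - intros t Ht. pose proof (phi_derive tb g2 t ltac:(lra)) as D. derive_auto. ring.
        - intros t Ht. specialize (Hra t Ht). pose proof (Hpos g2 t ltac:(lra)) as P.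
          unfold om. enough ((z g2 t * w1 g2 t - w g2 t * z1 g2 t) / (z g2 t ^ 2 + w g2 t ^ 2) <= - ka) by lra.
          apply Rmult_le_reg_r with (z g2 t ^ 2 + w g2 t ^ 2); [exact P|].
          replace ((z g2 t * w1 g2 t - w g2 t * z1 g2 t) / (z g2 t ^ 2 + w g2 t ^ 2) * (z g2 t ^ 2 + w g2 t ^ 2))
            with (z g2 t * w1 g2 t - w g2 t * z1 g2 t) by (field; lra). exact Hra. }
      assert (H3 : 2 * INR K * PI <= ka * (t0 - a)).
      { apply Rle_trans with (ka * (2 * INR K * PI / ka)); [right; field; lra|].
        apply Rmult_le_compat_l; lra. }
      lra. }
  destruct (intermediate_value (fun g => phi tb g t1 - tgt) g1 g2) as [g [Hg Hg0]]; try lra.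
  - intros g Hg. apply continuity_pt_minus; [|apply continuity_pt_const; now intros ? ?].
    apply (phi_continuous tb (g2 + 1) g); auto; lra.
  - nra.
  - exists g, (rho g t1). split; [lra|]. split; [lra|].
    split; [apply sqrt_lt_R0, Hpos; lra|].
    destruct (phi_polar tb g t1 ltac:(lra) (Hneg g ltac:(lra)) ltac:(lra)) as [E1 E2].
    replace (phi tb g t1) with tgt in E1, E2 by lra.
    rewrite <- (cos_period tgt j) in E1. rewrite <- (sin_period tgt j) in E2.
    replace (tgt + 2 * INR j * PI) with f0 in E1, E2 by (unfold tgt; ring). auto.
Qed.

End Winding.

(** * Oscillation of the singular solution *)

(* Otherwise [rho = u' / (u - 1)] satisfies a Riccati inequality
   [rho' <= - (g/2) (1 + rho^2)] for large [s], and [atan rho] is unbounded. *)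
Lemma radial_hits_one (p n b S : R) (u u1 : R -> R) : 1 < p -> 3 <= n -> 0 < b <= 1 -> 0 < S ->
  (forall s, S <= s -> radial_at p n u u1 s /\ b <= u s) -> exists s, S <= s /\ u s = 1.
Proof.
  intros Hp Hn Hb HS Hu. apply NNPP. intros Hno.
  assert (Hne : forall s, S <= s -> u s - 1 <> 0).
  { intros s Hs E. apply Hno. exists s. split; lra. }
  set (c0 := b * (p - 1) / p).
  assert (Hc0 : 0 < c0) by (apply Rdiv_lt_0_compat; nra).
  set (g := Rmin 1 c0). assert (Hg : 0 < g) by (apply Rmin_glb_lt; lra).
  assert (Hg1 : g <= 1) by apply Rmin_l. assert (Hg2 : g <= c0) by apply Rmin_r.
  (* From [S1] on the friction coefficient is at most [g], so that it cancels at most half of the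
     rotation. *)
  set (S1 := Rmax S ((n - 1) / g)).
  assert (HS1 : S <= S1) by apply Rmax_l. assert (HS2 : (n - 1) / g <= S1) by apply Rmax_r.
  (* Over this length [g s / 2] gains [PI + 1], more than an arctangent can lose. *)
  set (S2 := S1 + 2 * (PI + 1) / g). pose proof PI_RGT_0 as HPI.
  assert (HS3 : S1 < S2).
  { unfold S2. assert (0 < 2 * (PI + 1) / g) by (apply Rdiv_lt_0_compat; lra). lra. }
  assert (H : atan (u1 S2 / (u S2 - 1)) + g / 2 * S2 <= atan (u1 S1 / (u S1 - 1)) + g / 2 * S1).
  { apply (derive_nonpos_decr (fun s => atan (u1 s / (u s - 1)) + g / 2 * s)
     (fun s => ((- ((n - 1) / s) * u1 s + u s - Rpower (u s) p) * (u s - 1) - u1 s ^ 2)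
        / ((u s - 1) ^ 2 + u1 s ^ 2) + g / 2)); [lra| |].
    - intros s Hs. destruct (Hu s ltac:(lra)) as [[_ [D1 D2]] _].
      specialize (Hne s ltac:(lra)). derive_auto.
      assert (0 < (u s - 1) ^ 2) by (apply pow2_gt_0; exact Hne).
      pose proof (pow2_ge_0 (u1 s)). field. repeat split; try lra.
    - intros s Hs. destruct (Hu s ltac:(lra)) as [_ Hbs].
      specialize (Hne s ltac:(lra)). pose proof (Rpower_sub_id_lower p b (u s) Hp Hb Hbs) as Hl.
      fold c0 in Hl.
      assert (0 < (u s - 1) ^ 2) by (apply pow2_gt_0; exact Hne).
      assert (Hns : 0 <= (n - 1) / s <= g).
      { split; [apply Rmult_le_pos; [lra|left; apply Rinv_0_lt_compat; lra]|].
        apply Rmult_le_reg_r with s; [lra|].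
        replace ((n - 1) / s * s) with (n - 1) by (field; lra).
        apply Rle_trans with (g * ((n - 1) / g)); [right; field; lra|].
        apply Rmult_le_compat_l; lra. }
      set (w := u s - 1) in *. set (v := u1 s) in *. set (q := (n - 1) / s) in *.
      assert (Hw : 0 < w ^ 2 + v ^ 2) by (pose proof (pow2_ge_0 v); lra).
      replace (((- q * v + u s - Rpower (u s) p) * w - v ^ 2) / (w ^ 2 + v ^ 2) + g / 2)
        with (((- q * v + u s - Rpower (u s) p) * w - v ^ 2 + g / 2 * (w ^ 2 + v ^ 2)) / (w ^ 2 + v ^ 2))
        by (field; lra).
      apply Rmult_le_reg_r with (w ^ 2 + v ^ 2); [exact Hw|].
      unfold Rdiv. rewrite Rmult_assoc, Rinv_l, Rmult_1_r, Rmult_0_l by lra.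
      assert (- q * v * w <= q / 2 * (w ^ 2 + v ^ 2)).
      { pose proof (pow2_ge_0 (v + w)). nra. }
      assert (q / 2 * (w ^ 2 + v ^ 2) <= g / 2 * (w ^ 2 + v ^ 2)) by nra.
      assert (g * w ^ 2 <= c0 * w ^ 2) by nra.
      assert (g * v ^ 2 <= v ^ 2) by (pose proof (pow2_ge_0 v); nra).
      nra. }
  assert (E : g / 2 * S2 = g / 2 * S1 + PI + 1) by (unfold S2; field; lra).
  pose proof (atan_bound (u1 S2 / (u S2 - 1))). pose proof (atan_bound (u1 S1 / (u S1 - 1))).
  lra.
Qed.

(* A decreasing solution that becomes small decays exponentially, [u' <= - u / 2]. *)
Lemma radial_no_slow_decay (p n S C q : R) (u u1 : R -> R) : 1 < p -> 3 <= n -> 0 < S ->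
  0 < C -> 0 < q ->
  (forall s, S <= s -> radial_at p n u u1 s /\ u1 s < 0 /\ C <= u s * Rpower s q) ->
  Rpower (u S) (p - 1) <= 3 / 4 -> False.
Proof.
  intros Hp Hn HS HC Hq Hu HuS.
  assert (Hle : forall s, S <= s -> u s <= u S).
  { intros s Hs. apply (derive_nonpos_decr u u1); auto.
    - intros t Ht. apply Hu. lra.
    - intros t Ht. left. apply Hu. lra. }
  assert (Hv : forall s, S <= s -> u1 s + u s / 2 <= 0).
  (* Since [u^(p-1) <= 3 / 4] and [u' < 0], a positive value of [u' + u / 2] would grow at rate
     [1 / 2] and exceed [u S], although this quantity is less than [u / 2]. *)
  { intros s1 Hs1. destruct (Rle_lt_dec (u1 s1 + u s1 / 2) 0) as [|Hlt]; [assumption|exfalso].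
    set (v1 := u1 s1 + u s1 / 2) in *.
    set (s2 := s1 + 2 * (u S / v1)).
    destruct (Hu S ltac:(lra)) as [[HuS0 _] _].
    assert (Hq1 : 0 < u S / v1) by now apply Rdiv_lt_0_compat.
    assert (H : - (u1 s2 + u s2 / 2) <= - v1 * exp (1 / 2 * (s2 - s1))).
    { apply (gronwall (fun s => - (u1 s + u s / 2))
        (fun s => - (- ((n - 1) / s) * u1 s + u s - Rpower (u s) p + u1 s / 2))).
      - unfold s2. lra.
      - intros s Hs. destruct (Hu s ltac:(lra)) as [[_ [D1 D2]] _]. derive_auto. field. lra.
      - intros s Hs. destruct (Hu s ltac:(lra)) as [[P _] [N _]].
        rewrite (Rpower_split (u s) p P).
        assert (Rpower (u s) (p - 1) <= 3 / 4).
        { eapply Rle_trans; [|exact HuS]. apply Rle_Rpower_l; [lra|].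
          split; [exact P|]. apply Hle. lra. }
        assert (0 <= (n - 1) / s).
        { apply Rmult_le_pos; [lra|]. left. apply Rinv_0_lt_compat. lra. }
        assert (u s * Rpower (u s) (p - 1) <= u s * (3 / 4)) by (apply Rmult_le_compat_l; lra).
        nra. }
    replace (1 / 2 * (s2 - s1)) with (u S / v1) in H by (unfold s2; field; lra).
    pose proof (exp_ineq1_le (u S / v1)).
    assert (v1 * (1 + u S / v1) <= v1 * exp (u S / v1)) by (apply Rmult_le_compat_l; lra).
    replace (v1 * (1 + u S / v1)) with (v1 + u S) in * by (field; lra).
    assert (S <= s2) by (unfold s2; lra).
    destruct (Hu s2 ltac:(lra)) as [_ [N _]]. specialize (Hle s2 ltac:(lra)). lra. }
  set (S1 := Rmax S (4 * q)).
  assert (HS1 : S <= S1) by apply Rmax_l. assert (HS2 : 4 * q <= S1) by apply Rmax_r.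
  (* The logarithm of [u s^q]: bounded below by assumption, yet of derivative at most [- 1 / 4]
     beyond [S1]. *)
  set (X := fun s => ln (u s) + q * ln s).
  assert (HX : forall s, S <= s -> ln C <= X s).
  { intros s Hs. destruct (Hu s Hs) as [[P _] [_ L]]. unfold X.
    replace (q * ln s) with (ln (Rpower s q)) by (unfold Rpower; now rewrite ln_exp).
    rewrite <- ln_mult by (try apply Rpower_pos; lra). apply ln_le; lra. }
  set (S2 := S1 + 4 * (Rabs (X S1 - ln C) + 1)).
  pose proof (Rabs_pos (X S1 - ln C)). pose proof (Rle_abs (X S1 - ln C)).
  assert (H1 : X S2 + S2 / 4 <= X S1 + S1 / 4).
  { apply (derive_nonpos_decr (fun s => X s + s / 4) (fun s => u1 s / u s + q / s + 1 / 4)).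
    - unfold S2. lra.
    - intros s Hs. destruct (Hu s ltac:(lra)) as [[P [D1 _]] _]. unfold X. derive_auto. field. lra.
    - intros s Hs. destruct (Hu s ltac:(lra)) as [[P _] _]. specialize (Hv s ltac:(lra)).
      assert (u1 s / u s <= - (1 / 2)).
      { apply Rmult_le_reg_r with (u s); [lra|].
        replace (u1 s / u s * u s) with (u1 s) by (field; lra). lra. }
      assert (q / s <= 1 / 4).
      { apply Rmult_le_reg_r with s; [lra|].
        replace (q / s * s) with q by (field; lra). lra. }
      lra. }
  assert (HXS2 := HX S2 ltac:(unfold S2; lra)).
  assert (S2 / 4 = S1 / 4 + Rabs (X S1 - ln C) + 1) by (unfold S2; field). lra.
Qed.

(** Without critical points far out, [u] is monotone there. If it stays away from 0 it takes the
    value 1 twice, and the mean value theorem yields a critical point; otherwise it decreases to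
    small values, and its exponential decay contradicts the power lower bound. *)
Lemma radial_crit_unbounded (p n C q : R) (u u1 : R -> R) : 1 < p -> 3 <= n ->
  0 < C -> 0 < q -> (forall s, 0 < s -> radial_at p n u u1 s) ->
  (exists S0, forall s, S0 <= s -> C <= u s * Rpower s q) ->
  forall S, exists s, S < s /\ 0 < s /\ u1 s = 0.
Proof.
  intros Hp Hn HC Hq Hu [S0 Hlow] S'. apply NNPP. intros Hno.
  set (S := Rmax 1 (Rmax S0 S')).
  assert (HS1 : 1 <= S) by apply Rmax_l.
  assert (HS0 : S0 <= S) by (unfold S; eapply Rle_trans; [apply Rmax_l|apply Rmax_r]).
  assert (HSS : S' <= S) by (unfold S; eapply Rle_trans; [apply Rmax_r|apply Rmax_r]).
  assert (Hne : forall s, S < s -> u1 s <> 0).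
  { intros s Hs E. apply Hno. exists s. repeat split; lra. }
  assert (Hcont : forall s, 0 < s -> continuity_pt u1 s).
  { intros s Hs. eapply is_derive_continuity_pt. apply Hu. exact Hs. }
  assert (Hfar : forall b S1, S < S1 -> 0 < b <= 1 -> (forall s, S1 <= s -> b <= u s) -> False).
  { intros b S1 HS Hb Hbu.
    destruct (radial_hits_one p n b S1 u u1) as [s1 [Hs1 E1]]; auto; try lra.
    { intros s Hs. split; [apply Hu; lra|now apply Hbu]. }
    destruct (radial_hits_one p n b (s1 + 1) u u1) as [s2 [Hs2 E2]]; auto; try lra.
    { intros s Hs. split; [apply Hu; lra|apply Hbu; lra]. }
    destruct (mean_value u u1 s1 s2 ltac:(lra)) as [x [Hx Ex]].
    { intros t Ht. apply Hu. lra. }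
    apply (Hne x); [lra|]. apply Rmult_eq_reg_r with (s2 - s1); lra. }
  destruct (classic (exists s0, S < s0 /\ 0 < u1 s0)) as [[s0 [Hs0 Hp0]]|Hnp].
  - apply (Hfar (Rmin 1 (u s0)) s0 Hs0).
    + split; [apply Rmin_glb_lt; [lra|apply Hu; lra]|apply Rmin_l].
    + intros s Hs. apply Rle_trans with (u s0); [apply Rmin_r|].
      apply (derive_nonneg_incr u u1); auto.
      * intros t Ht. apply Hu. lra.
      * intros t Ht. destruct (Rle_lt_dec 0 (u1 t)) as [|Hl]; [assumption|exfalso].
        destruct (intermediate_value u1 s0 t) as [x [Hx Ex]]; try lra.
        { intros r Hr. apply Hcont. lra. }
        { nra. }
        apply (Hne x); lra.
  - assert (Hneg : forall s, S < s -> u1 s < 0).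
    { intros s Hs. destruct (Rtotal_order (u1 s) 0) as [|[E|Hg]]; [assumption| |].
      - exfalso. now apply (Hne s).
      - exfalso. apply Hnp. exists s. split; lra. }
    set (b0 := Rpower (3 / 4) (1 / (p - 1))).
    assert (Hb0 : 0 < b0 <= 1).
    { split; [apply Rpower_pos|]. apply Rle_trans with (Rpower 1 (1 / (p - 1))); [|rewrite Rpower_base_1; lra].
      apply Rle_Rpower_l; [|lra]. left. apply Rdiv_lt_0_compat; lra. }
    destruct (classic (exists s1, S < s1 /\ u s1 < b0)) as [[s1 [Hs1 Hub]]|Hnb].
    + apply (radial_no_slow_decay p n s1 C q u u1); auto; try lra.
      * intros s Hs. split; [apply Hu; lra|]. split; [apply Hneg; lra|apply Hlow; lra].
      * apply Rle_trans with (Rpower b0 (p - 1)).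
        -- apply Rle_Rpower_l; [lra|]. split; [apply Hu; lra|lra].
        -- unfold b0. rewrite Rpower_mult. replace (1 / (p - 1) * (p - 1)) with 1 by (field; lra).
           rewrite Rpower_1; lra.
    + apply (Hfar b0 (S + 1)); auto; try lra. intros s Hs.
      destruct (Rle_lt_dec b0 (u s)) as [|Hl]; [assumption|exfalso].
      apply Hnb. exists s. split; lra.
Qed.

(** As [eps = m^2 s^2], an energy at most [- e1] bounds [y s] from below for [s >= 1]. This is the
    power lower bound on the radial solution, with exponent [k / m + 1]. *)
Lemma singular_zeros_unbounded (p k be m A n T0 e1 : R) (y c : R -> R) :
  emden_link p k be m A n -> (forall t, sol_at p k be m y c t) -> 0 < e1 ->
  (forall t, T0 <= t -> energy p k m y c t <= - e1) ->
  forall T, exists t, T < t /\ c t = 0.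
Proof.
  intros HL Hsol He1 HE T. assert (HL' := HL).
  destruct HL' as [[Hp Hk Hkb Hkb1 Hm Hsc _] Hn Hdim HA Hamp].
  assert (HP := el_params _ _ _ _ _ _ HL).
  set (C := A * sqrt (2 * e1 / (1 + m ^ 2))).
  assert (Hm2 : 0 < m ^ 2) by now apply pow_lt.
  assert (Hq0 : 0 < 2 * e1 / (1 + m ^ 2)) by (apply Rdiv_lt_0_compat; lra).
  assert (HC : 0 < C) by (apply Rmult_lt_0_compat; [lra|now apply sqrt_lt_R0]).
  assert (Hkm : 0 < k / m) by now apply Rdiv_lt_0_compat.
  destruct (radial_crit_unbounded p n C (k / m + 1)
    (fun s => A * Rpower s (- (k / m)) * y (ln s / m))
    (fun s => A * Rpower s (- (k / m)) * c (ln s / m) / (m * s))) with (S := exp (m * T))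
    as (s & Hs & Hs0 & Es); auto; try lra.
  - intros s Hs. apply (radial_of_sol p k be m A n); auto.
  - exists (Rmax 1 (exp (m * T0))). intros s Hs.
    pose proof (Rmax_l 1 (exp (m * T0))). pose proof (Rmax_r 1 (exp (m * T0))).
    assert (HT : T0 <= ln s / m).
    { apply Rmult_le_reg_r with m; [exact Hm|].
      replace (ln s / m * m) with (ln s) by (field; lra).
      rewrite <- (ln_exp (T0 * m)). apply ln_le; [apply exp_pos|]. rewrite (Rmult_comm T0). lra. }
    destruct (Hsol (ln s / m)) as [Py _].
    pose proof (energy_lower p k be m y c (ln s / m) e1 HP Py (HE _ HT)) as HEl.
    unfold eps in HEl.
    replace (2 * m * (ln s / m)) with (ln s + ln s) in HEl by (field; lra).
    rewrite exp_plus, exp_ln in HEl by lra.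
    set (yy := y (ln s / m)) in *.
    replace (A * Rpower s (- (k / m)) * yy * Rpower s (k / m + 1))
      with (A * (yy * s)).
    2:{ transitivity (A * yy * (Rpower s (- (k / m)) * Rpower s (k / m + 1))); [|ring].
        rewrite <- Rpower_plus. replace (- (k / m) + (k / m + 1)) with 1 by ring.
        rewrite Rpower_1 by lra. ring. }
    unfold C. apply Rmult_le_compat_l; [lra|].
    apply Rsqr_incr_0_var; [|nra]. rewrite Rsqr_sqrt by lra. unfold Rsqr.
    apply Rmult_le_reg_r with (1 + m ^ 2); [lra|].
    replace (2 * e1 / (1 + m ^ 2) * (1 + m ^ 2)) with (2 * e1) by (field; lra).
    apply Rle_trans with (1 := HEl).
    assert (0 <= yy ^ 2) by apply pow2_ge_0. assert (1 <= s * s) by nra. nra.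
  - exists (ln s / m). split.
    + apply Rmult_lt_reg_r with m; [exact Hm|].
      replace (ln s / m * m) with (ln s) by (field; lra).
      rewrite <- (ln_exp (T * m)). apply ln_increasing; [apply exp_pos|].
      rewrite (Rmult_comm T). exact Hs.
    + pose proof (Rpower_pos s (- (k / m))) as PR.
      apply Rmult_eq_reg_l with (A * Rpower s (- (k / m)) / (m * s)).
      * rewrite Rmult_0_r, <- Es. field. lra.
      * apply Rgt_not_eq. apply Rdiv_lt_0_compat; nra.
Qed.

(* A degenerate critical point would make [u] the constant solution 1, that is
   [y = exp (k t) / A], which tends to 0 at minus infinity. *)
Lemma singular_zero_nondegenerate (p k be m A n : R) (y c : R -> R) (t : R) :
  emden_link p k be m A n -> (forall t, sol_at p k be m y c t) ->
  (forall t, energy p k m y c t < 0) ->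
  (forall e, 0 < e -> exists T, forall t, t <= T -> Rabs (y t - 1) < e) ->
  c t = 0 -> - be * c t + eps m t * y t - Rpower (y t) p <> 0.
Proof.
  intros HL Hsol HE Hlim Hc Hdeg. assert (HL' := HL).
  destruct HL' as [[Hp Hk Hkb Hkb1 Hm Hsc _] Hn Hdim HA Hamp].
  assert (HP := el_params _ _ _ _ _ _ HL).
  set (y1 := emden_y A k m (fun _ => 1)). set (c1 := emden_c A k m (fun _ => 0)).
  assert (S1 : forall t, sol_at p k be m y1 c1 t).
  { intros r. apply (sol_of_radial p k be m A n); auto.
    split; [lra|split]; auto_derive; auto. rewrite Rpower_base_1. ring. }
  assert (Ec1 : forall r, c1 r = 0) by (intros r; unfold c1, emden_c; field; lra).
  destruct (Hsol t) as [Py _]. destruct (S1 t) as [Py1 _].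
  assert (Hy1 : Rpower (y1 t) p = eps m t * y1 t).
  { unfold y1, emden_y. rewrite (Rpower_emden p k be m A n) by (auto; lra).
    rewrite Rpower_base_1. unfold eps. field. lra. }
  (* [c = c' = 0] at [t] means [y^(p-1) = eps], a relation that [y1], the image of the constant 1,
     satisfies at all times. *)
  assert (Hq : Rpower (y t) (p - 1) = Rpower (y1 t) (p - 1)).
  { rewrite (Rpower_split (y t) p Py), Hc in Hdeg. rewrite (Rpower_split (y1 t) p Py1) in Hy1.
    transitivity (eps m t).
    - apply Rmult_eq_reg_l with (y t); lra.
    - apply Rmult_eq_reg_l with (y1 t); lra. }
  assert (Ey : y t = y1 t).
  { assert (Hroot : forall x, 0 < x -> x = Rpower (Rpower x (p - 1)) (1 / (p - 1))).
    { intros x Hx. rewrite Rpower_mult.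
      replace ((p - 1) * (1 / (p - 1))) with 1 by (field; lra). now rewrite Rpower_1. }
    rewrite (Hroot _ Py), (Hroot _ Py1). now rewrite Hq. }
  set (B := Rmax (amplitude p (eps m t)) (exp (k * t) / A)).
  destruct (dist2_growth p k be m B t HP) as [K [_ HG]].
  destruct (Hlim (1 / 2) ltac:(lra)) as [T HT].
  (* At [a], [y > 1 / 2] while [y1 <= 1 / 2], although backward uniqueness makes them equal. *)
  set (a := Rmin t (Rmin T (ln (A / 2) / k))).
  assert (Hat : a <= t) by apply Rmin_l.
  assert (HaT : a <= T) by (unfold a; eapply Rle_trans; [apply Rmin_r|apply Rmin_l]).
  assert (HaA : a <= ln (A / 2) / k) by (unfold a; eapply Rle_trans; [apply Rmin_r|apply Rmin_r]).
  destruct (HG y c y1 c1 a t) as [_ H]; [lra| | |].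
  - intros r Hr. split; [apply Hsol|]. apply Rle_trans with (amplitude p (eps m t)); [|apply Rmax_l].
    apply (energy_upper p k be m y c r); auto; [apply Hsol|apply eps_le; lra].
  - intros r Hr. split; [apply S1|]. apply Rle_trans with (exp (k * t) / A); [|apply Rmax_r].
    unfold y1, emden_y. rewrite Rmult_1_r. apply Rmult_le_compat_r.
    + left; now apply Rinv_0_lt_compat.
    + destruct (proj2 Hr) as [Hlt| ->]; [|lra]. left. apply exp_increasing. nra.
  - unfold dist2 in H. rewrite Hc, Ey, !Ec1 in H.
    replace ((y1 t - y1 t) ^ 2 + (0 - 0) ^ 2) with 0 in H by ring. rewrite Rmult_0_l in H.
    assert (Ea : y a = y1 a).
    { pose proof (pow2_ge_0 (y a - y1 a)). pose proof (pow2_ge_0 (c a - 0)). nra. }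
    specialize (HT a HaT). apply Rabs_def2 in HT.
    assert (y1 a <= 1 / 2); [|lra].
    unfold y1, emden_y. rewrite Rmult_1_r.
    apply Rmult_le_reg_r with A; [exact HA|].
    replace (exp (k * a) / A * A) with (exp (k * a)) by (field; lra).
    replace (1 / 2 * A) with (exp (k * (ln (A / 2) / k))).
    + destruct HaA as [Hlt| ->]; [|lra]. left. apply exp_increasing. nra.
    + replace (k * (ln (A / 2) / k)) with (ln (A / 2)) by (field; lra).
      rewrite exp_ln by lra. field.
Qed.

(** * Perturbation of the n-th zero *)

(** Closeness in the C1 sense: [d] and [d0] stand for the derivatives of [c] and [c0]. *)
Definition close (c d c0 d0 : R -> R) (e a b : R) : Prop :=
  forall t, a <= t <= b -> Rabs (c t - c0 t) < e /\ Rabs (d t - d0 t) < e.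

Lemma close_sub (c d c0 d0 : R -> R) (e e' a a' b b' : R) :
  close c d c0 d0 e a b -> e <= e' -> a <= a' -> b' <= b -> close c d c0 d0 e' a' b'.
Proof. intros H He Ha Hb t Ht. destruct (H t ltac:(lra)). split; lra. Qed.

(** On [[a, a']] the function [c0] is bounded away from 0, and from [a'] to [b] its slope is. A C1
    perturbation therefore has no zero on the first interval and is increasing on the second;
    monotonicity also reads the side of its zero from its sign at [tau]. *)
Lemma increasing_zero_perturb (c0 d0 : R -> R) (a tau h : R) :
  (forall t, is_derive c0 t (d0 t)) -> continuity_pt d0 tau -> a < tau -> 0 < h ->
  (forall t, a <= t < tau -> c0 t <> 0) -> c0 tau = 0 -> 0 < d0 tau ->
  exists b e, tau < b <= tau + h /\ 0 < e /\ forall c d, (forall t, is_derive c t (d t)) ->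
    close c d c0 d0 e a b ->
    exists t, a < t < b /\ c t = 0 /\ (forall x, a <= x <= b -> c x = 0 -> x = t) /\
      (0 < c tau -> t < tau) /\ (c tau < 0 -> tau < t).
Proof.
  intros D0 Cd Hat Hh Hne H0 Hd.
  assert (C0 : forall t, continuity_pt c0 t) by (intros t; eapply is_derive_continuity_pt, D0).
  assert (Hneg : forall t, a <= t < tau -> c0 t < 0).
  { intros t Ht. destruct (Rle_lt_dec 0 (c0 t)) as [Hge|]; [exfalso|assumption].
    assert (D : is_derive (fun t => - c0 t) tau (- d0 tau)).
    { pose proof (D0 tau). derive_auto. ring. }
    destruct (derive_neg_left _ tau _ t D ltac:(lra) ltac:(lra)) as [r [Hr Hlt]].
    destruct (intermediate_value c0 t r) as [x [Hx Ex]]; auto; try lra; [nra|].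
    apply (Hne x); lra. }
  destruct (continuity_pt_eps d0 tau Cd (d0 tau / 2) ltac:(lra)) as [r [Hr Hcd]].
  set (q := d0 tau / 2) in *.
  set (eta := Rmin h (r / 2)). assert (Heta : 0 < eta) by (apply Rmin_glb_lt; lra).
  assert (eta <= h) by apply Rmin_l. assert (eta <= r / 2) by apply Rmin_r.
  assert (Hq : forall t, tau - eta <= t <= tau + eta -> q < d0 t).
  { intros t Ht. assert (Habs : Rabs (t - tau) < r) by (apply Rabs_def1; lra).
    specialize (Hcd t Habs). apply Rabs_def2 in Hcd. unfold q in *. lra. }
  assert (Hend : q * eta < c0 (tau + eta)).
  { destruct (mean_value c0 d0 tau (tau + eta)) as [x [Hx Ex]]; [lra|intros; apply D0|].
    specialize (Hq x ltac:(lra)). nra. }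
  set (a' := Rmax a (tau - eta)).
  assert (Ha1 : a <= a') by apply Rmax_l. assert (Ha2 : tau - eta <= a') by apply Rmax_r.
  assert (Ha3 : a' < tau) by (apply Rmax_lub_lt; lra).
  destruct (continuity_ab_maj c0 a a' Ha1 ltac:(intros; apply C0)) as [Mx [HM1 HM2]].
  assert (HMneg : c0 Mx < 0) by (apply Hneg; lra).
  set (e := Rmin (- c0 Mx) (Rmin q (q * eta))).
  assert (Hqe : 0 < q * eta) by (apply Rmult_lt_0_compat; unfold q; lra).
  assert (He1 : e <= - c0 Mx) by apply Rmin_l.
  assert (He2 : e <= q) by (eapply Rle_trans; [apply Rmin_r|apply Rmin_l]).
  assert (He3 : e <= q * eta) by (eapply Rle_trans; [apply Rmin_r|apply Rmin_r]).
  exists (tau + eta), e. split; [lra|]. split.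
  { repeat apply Rmin_glb_lt; unfold q in *; lra. }
  intros c d Dc Hcl.
  assert (N1 : forall t, a <= t <= a' -> c t < 0).
  { intros t Ht. destruct (Hcl t ltac:(lra)) as [I _]. apply Rabs_def2 in I.
    specialize (HM1 t Ht). lra. }
  assert (N2 : forall t, a' <= t <= tau + eta -> 0 < d t).
  { intros t Ht. destruct (Hcl t ltac:(lra)) as [_ I]. apply Rabs_def2 in I.
    specialize (Hq t ltac:(lra)). lra. }
  assert (N3 : 0 < c (tau + eta)).
  { destruct (Hcl (tau + eta) ltac:(lra)) as [I _]. apply Rabs_def2 in I. lra. }
  assert (Hmono : forall x x', a' <= x -> x < x' -> x' <= tau + eta -> c x < c x').
  { intros x x' Hx Hxx Hx'. apply (derive_pos_incr c d); auto. intros t Ht. apply N2. lra. }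
  destruct (intermediate_value c a' (tau + eta)) as [t [Ht Et]]; [lra| | |].
  { intros x _. eapply is_derive_continuity_pt, Dc. }
  { specialize (N1 a' ltac:(lra)). nra. }
  assert (Ht' : a' < t < tau + eta).
  { split.
    - destruct (proj1 Ht) as [|E]; [assumption|]. specialize (N1 a' ltac:(lra)). rewrite E in N1. lra.
    - destruct (proj2 Ht) as [|E]; [assumption|]. rewrite <- E in N3. lra. }
  exists t. split; [lra|]. split; [exact Et|]. split; [|split].
  - intros x Hx Ex. destruct (Rle_lt_dec x a') as [Hl|Hl].
    + specialize (N1 x ltac:(lra)). lra.
    + destruct (Rtotal_order x t) as [Hlt|[|Hgt]]; [|assumption|].
      * pose proof (Hmono x t). lra.
      * pose proof (Hmono t x). lra.
  - intros Hc. destruct (Rlt_le_dec t tau) as [|[Hlt|E]]; [assumption| |rewrite E in Hc; lra].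
    pose proof (Hmono tau t). lra.
  - intros Hc. destruct (Rlt_le_dec tau t) as [|[Hlt|E]]; [assumption| |rewrite <- E in Hc; lra].
    pose proof (Hmono t tau). lra.
Qed.

Lemma simple_zero_perturb (c0 d0 : R -> R) (a tau h : R) :
  (forall t, is_derive c0 t (d0 t)) -> continuity_pt d0 tau -> a < tau -> 0 < h ->
  (forall t, a <= t < tau -> c0 t <> 0) -> c0 tau = 0 -> d0 tau <> 0 ->
  exists b e, tau < b <= tau + h /\ 0 < e /\ forall c d, (forall t, is_derive c t (d t)) ->
    close c d c0 d0 e a b ->
    exists t, a < t < b /\ c t = 0 /\ (forall x, a <= x <= b -> c x = 0 -> x = t) /\
      (0 < d0 tau * c tau -> t < tau) /\ (d0 tau * c tau < 0 -> tau < t).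
Proof.
  intros D0 Cd Hat Hh Hne H0 Hd. destruct (Rdichotomy _ _ Hd) as [Hn|Hp].
  - destruct (increasing_zero_perturb (fun t => - c0 t) (fun t => - d0 t) a tau h)
      as (b & e & Hb & He & H); auto; try lra.
    + intros t. pose proof (D0 t). derive_auto. ring.
    + now apply continuity_pt_opp.
    + intros t Ht E. apply (Hne t Ht). lra.
    + exists b, e. split; [exact Hb|]. split; [exact He|]. intros c d Dc Hcl.
      destruct (H (fun t => - c t) (fun t => - d t)) as (t & Ht & Et & Hu & H1 & H2).
      * intros t. pose proof (Dc t). derive_auto. ring.
      * intros t Ht. destruct (Hcl t Ht) as [I1 I2]. rewrite <- Rabs_Ropp in I1, I2.
        split; [replace (- c t - - c0 t) with (- (c t - c0 t)) by ring
               |replace (- d t - - d0 t) with (- (d t - d0 t)) by ring]; assumption.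
      * exists t. split; [exact Ht|]. split; [lra|]. split; [|split].
        -- intros x Hx Ex. apply Hu; lra.
        -- intros Hc. apply H1. nra.
        -- intros Hc. apply H2. nra.
  - destruct (increasing_zero_perturb c0 d0 a tau h) as (b & e & Hb & He & H); auto.
    exists b, e. split; [exact Hb|]. split; [exact He|]. intros c d Dc Hcl.
    destruct (H c d Dc Hcl) as (t & Ht & Et & Hu & H1 & H2).
    exists t. split; [exact Ht|]. split; [exact Et|]. split; [exact Hu|].
    split; intros Hc; [apply H1|apply H2]; nra.
Qed.

Lemma next_zero (c d : R -> R) (a : R) : (forall t, is_derive c t (d t)) -> c a <> 0 ->
  (exists t, a < t /\ c t = 0) ->
  exists tau, a < tau /\ c tau = 0 /\ forall t, a <= t < tau -> c t <> 0.
Proof.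
  intros Dc Ha [t [Ht Et]].
  assert (Cc : forall t, continuity_pt c t) by (intros x; eapply is_derive_continuity_pt, Dc).
  destruct (Rdichotomy _ _ Ha) as [Hn|Hp].
  - destruct (first_zero (fun t => - c t) a t) as [T [HT [HT0 HTp]]]; try lra.
    + intros x _. now apply continuity_pt_opp.
    + exists T. split; [lra|]. split; [lra|]. intros x Hx. specialize (HTp x Hx). lra.
  - destruct (first_zero c a t) as [T [HT [HT0 HTp]]]; try lra.
    + intros x _. apply Cc.
    + exists T. split; [lra|]. split; [lra|]. intros x Hx. specialize (HTp x Hx). lra.
Qed.

Definition zeros_upto (c : R -> R) (n : nat) (a : R) : Prop :=
  exists l, NoDup l /\ length l = n /\ forall x, In x l <-> (x <= a /\ c x = 0).

(** Zeros are counted from minus infinity, the image of the origin, so that [s = exp (m t)] turns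
    this into [is_nth_crit]. *)
Definition nth_zero (c : R -> R) (n : nat) (t : R) : Prop :=
  c t = 0 /\ exists l, NoDup l /\ length l = (n - 1)%nat /\
    forall x, In x l <-> (x < t /\ c x = 0).

Section ZeroPerturbation.
Context {c0 d0 : R -> R} {t0 : R}.
Hypotheses
  (D0 : forall t, is_derive c0 t (d0 t))
  (Cd0 : forall t, continuity_pt d0 t)
  (Hsimple : forall t, c0 t = 0 -> d0 t <> 0)
  (Hstart : forall t, t <= t0 -> c0 t <> 0)
  (Hunb : forall T, exists t, T < t /\ c0 t = 0).

(** Induction adding one simple zero at a time. Requiring [c0 a <> 0] at the end point lets the next
    step look for its first zero from there. *)
Lemma zeros_upto_stable (n : nat) :
  exists a e, t0 <= a /\ 0 < e /\ c0 a <> 0 /\ forall c d, (forall t, is_derive c t (d t)) ->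
    (forall t, t <= t0 -> c t <> 0) -> close c d c0 d0 e t0 a -> zeros_upto c n a.
Proof.
  induction n as [|n IH].
  - exists t0, 1. split; [lra|]. split; [lra|]. split; [apply Hstart; lra|].
    intros c d _ Hc _. exists nil. split; [constructor|]. split; [reflexivity|].
    intros x. split; [intros []|]. intros [Hx E]. exact (Hc x Hx E).
  - destruct IH as (a & e & Ha & He & Hca & IH).
    destruct (next_zero c0 d0 a D0 Hca (Hunb a)) as (tau & Htau & E & Hne).
    destruct (simple_zero_perturb c0 d0 a tau 1) as (b & e' & Hb & He' & H); auto; try lra.
    exists b, (Rmin e e'). split; [lra|]. split; [now apply Rmin_glb_lt|]. split.
    (* Uniqueness of the zero, applied to [c0] as its own perturbation, shows that [b] is not a
       zero. *)
    { destruct (H c0 d0 D0) as (t & Ht & Et & Hu & _).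
      { intros x _. rewrite !Rminus_diag, Rabs_R0. lra. }
      intros Eb. specialize (Hu b ltac:(lra) Eb). lra. }
    intros c d Dc Hc Hcl.
    destruct (IH c d Dc Hc) as (l & Hl1 & Hl2 & Hl3).
    { apply (close_sub _ _ _ _ _ _ _ _ _ _ Hcl); [apply Rmin_l|lra|lra]. }
    destruct (H c d Dc) as (t & Ht & Et & Hu & _).
    { apply (close_sub _ _ _ _ _ _ _ _ _ _ Hcl); [apply Rmin_r|lra|lra]. }
    exists (t :: l). split; [|split].
    + constructor; [|exact Hl1]. intros Hin. apply Hl3 in Hin. lra.
    + simpl. now rewrite Hl2.
    + intros x. simpl. rewrite Hl3. split.
      * intros [<-|[Hx Ex]]; split; auto; lra.
      * intros [Hx Ex]. destruct (Rle_lt_dec x a); [right; auto|left].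
        symmetry. apply Hu; [lra|exact Ex].
Qed.

Lemma nth_zero_stable (n : nat) : (1 <= n)%nat ->
  exists tau b e, t0 <= tau <= b /\ 0 < e /\ nth_zero c0 n tau /\ d0 tau <> 0 /\
    forall c d, (forall t, is_derive c t (d t)) ->
      (forall t, t <= t0 -> c t <> 0) -> close c d c0 d0 e t0 b ->
      exists t, nth_zero c n t /\ (0 < d0 tau * c tau -> t < tau) /\
        (d0 tau * c tau < 0 -> tau < t).
Proof.
  intros Hn.
  destruct (zeros_upto_stable (n - 1)) as (a & e & Ha & He & Hca & IH).
  destruct (next_zero c0 d0 a D0 Hca (Hunb a)) as (tau & Htau & E & Hne).
  destruct (simple_zero_perturb c0 d0 a tau 1) as (b & e' & Hb & He' & H); auto; try lra.
  assert (Hgen : forall c d, (forall t, is_derive c t (d t)) ->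
      (forall t, t <= t0 -> c t <> 0) -> close c d c0 d0 (Rmin e e') t0 b ->
      exists t, nth_zero c n t /\ (forall x, a <= x <= b -> c x = 0 -> x = t) /\
        (0 < d0 tau * c tau -> t < tau) /\ (d0 tau * c tau < 0 -> tau < t)).
  { intros c d Dc Hc Hcl.
    destruct (IH c d Dc Hc) as (l & Hl1 & Hl2 & Hl3).
    { apply (close_sub _ _ _ _ _ _ _ _ _ _ Hcl); [apply Rmin_l|lra|lra]. }
    destruct (H c d Dc) as (t & Ht & Et & Hu & H1 & H2).
    { apply (close_sub _ _ _ _ _ _ _ _ _ _ Hcl); [apply Rmin_r|lra|lra]. }
    exists t. split; [|auto]. split; [exact Et|]. exists l. split; [exact Hl1|].
    split; [exact Hl2|]. intros x. rewrite Hl3. split.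
    - intros [Hx Ex]. split; [lra|exact Ex].
    - intros [Hx Ex]. split; [|exact Ex]. destruct (Rle_lt_dec x a) as [|Hlt]; [assumption|].
      specialize (Hu x ltac:(lra) Ex). lra. }
  exists tau, b, (Rmin e e'). split; [lra|]. split; [now apply Rmin_glb_lt|]. split; [|split].
  - destruct (Hgen c0 d0 D0 Hstart) as (t & Ht & Hu & _).
    { intros x _. rewrite !Rminus_diag, Rabs_R0. split; now apply Rmin_glb_lt. }
    rewrite (Hu tau ltac:(lra) E). exact Ht.
  - now apply Hsimple.
  - intros c d Dc Hc Hcl. destruct (Hgen c d Dc Hc Hcl) as (t & Ht & _ & H1 & H2). now exists t.
Qed.

End ZeroPerturbation.

(** [u'] is a positive multiple of [c], and the exponential change of variable preserves order. The
    multiplier [g] is left free to cover both regular and singular solutions. *)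
Lemma nth_crit_of_nth_zero (m : R) (u g c : R -> R) (n : nat) (t : R) : 0 < m ->
  (forall s, 0 < s -> 0 < g s /\ is_derive u s (g s * c (ln s / m))) ->
  nth_zero c n t -> is_nth_crit u n (exp (m * t)).
Proof.
  intros Hm Hu [Et (l & Hl1 & Hl2 & Hl3)].
  assert (Hln : forall x, ln (exp (m * x)) / m = x) by (intros x; rewrite ln_exp; field; lra).
  assert (Hcrit : forall s, 0 < s -> (derivable_pt_lim u s 0 <-> c (ln s / m) = 0)).
  { intros s Hs. destruct (Hu s Hs) as [Hg Hd]. split.
    - intros H. apply is_derive_Reals in H. apply is_derive_unique in H. apply is_derive_unique in Hd.
      rewrite Hd in H. nra.
    - intros E. apply is_derive_Reals. rewrite E, Rmult_0_r in Hd. exact Hd. }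
  assert (Hord : forall x x', x < x' <-> exp (m * x) < exp (m * x')).
  { intros x x'. split; intros Hx.
    - apply exp_increasing. nra.
    - apply exp_lt_inv in Hx. nra. }
  split; [apply exp_pos|]. split.
  { apply Hcrit; [apply exp_pos|]. now rewrite Hln. }
  exists (map (fun x => exp (m * x)) l). split; [|split].
  - apply NoDup_map_NoDup_ForallPairs; [|exact Hl1].
    intros x x' _ _ E. apply exp_inv in E. apply Rmult_eq_reg_l with m; lra.
  - now rewrite length_map.
  - intros s. rewrite in_map_iff. split.
    + intros [x [<- Hin]]. apply Hl3 in Hin. destruct Hin as [Hx Ex].
      split; [split; [apply exp_pos|now apply (proj1 (Hord x t))]|].
      apply Hcrit; [apply exp_pos|]. now rewrite Hln.
    + intros [[Hs Hlt] Hd]. exists (ln s / m).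
      assert (E : exp (m * (ln s / m)) = s).
      { replace (m * (ln s / m)) with (ln s) by (field; lra). now apply exp_ln. }
      split; [exact E|]. apply Hl3. split; [|now apply Hcrit].
      apply (proj2 (Hord _ _)). now rewrite E.
Qed.

(** * The branch of regular solutions *)

Definition slope (p be m : R) (y c : R -> R) (t : R) : R :=
  - be * c t + eps m t * y t - Rpower (y t) p.

Lemma decaying_exp_below (K ka e : R) : 0 < K -> 0 < ka -> 0 < e ->
  exists L, 0 <= L /\ forall x, L <= x -> K * exp (- ka * x) <= e.
Proof.
  intros HK Hka He.
  assert (Hq : 0 < K / (ka * e)) by (apply Rdiv_lt_0_compat; nra).
  exists (K / (ka * e)). split; [lra|].
  intros x Hx. pose proof (exp_ineq1_le (ka * x)) as H.
  replace (- ka * x) with (- (ka * x)) by ring. rewrite exp_Ropp.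
  pose proof (exp_pos (ka * x)).
  apply Rmult_le_reg_r with (exp (ka * x)); [assumption|].
  replace (K * / exp (ka * x) * exp (ka * x)) with K by (field; lra).
  apply Rle_trans with (e * (ka * x)); [|nra].
  apply Rle_trans with (e * (ka * (K / (ka * e)))); [right; field; lra|].
  apply Rmult_le_compat_l; [lra|]. apply Rmult_le_compat_l; lra.
Qed.

(* [exp (be t) c] decreases as long as [y^(p-1) > eps], i.e. [u > 1], and vanishes at minus
   infinity. *)
Lemma sol_decreasing_start (p k be m T M : R) (y c : R -> R) : 0 < be ->
  (forall t, t <= T -> sol_at p k be m y c t) ->
  (forall t, t <= T -> eps m t * y t < Rpower (y t) p) ->
  0 < M -> (forall t, t <= T -> Rabs (c t) <= M) -> forall t, t <= T -> c t < 0.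
Proof.
  intros Hbe Hsol Heps HM Hb t Ht.
  destruct (Rlt_le_dec (c t) 0) as [|Hc]; [assumption|exfalso].
  set (f := fun t => exp (be * t) * c t).
  set (f' := fun t => exp (be * t) * (eps m t * y t - Rpower (y t) p)).
  assert (Df : forall r, r <= T -> is_derive f r (f' r)).
  { intros r Hr. destruct (Hsol r Hr) as [_ [_ D]]. unfold f. derive_auto. unfold f'. ring. }
  assert (Hf' : forall r, r <= T -> f' r < 0).
  { intros r Hr. specialize (Heps r Hr). unfold f'. pose proof (exp_pos (be * r)). nra. }
  assert (Hf : forall r r', r < r' -> r' <= T -> f r' < f r).
  { intros r r' Hr Hr'. destruct (mean_value f f' r r' Hr) as [x [Hx Ex]].
    - intros x Hx. apply Df. lra.
    - specialize (Hf' x ltac:(lra)). nra. }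
  assert (H0 : 0 <= f t) by (unfold f; pose proof (exp_pos (be * t)); nra).
  set (q := f (t - 1)). assert (Hq : 0 < q) by (unfold q; specialize (Hf (t - 1) t); lra).
  set (r := Rmin (t - 2) (ln (q / M) / be)).
  assert (Hr1 : r <= t - 2) by apply Rmin_l. assert (Hr2 : r <= ln (q / M) / be) by apply Rmin_r.
  assert (Hfr : q < f r) by (apply Hf; lra).
  specialize (Hb r ltac:(lra)). apply Rabs_le_between in Hb.
  assert (exp (be * r) * M <= q); [|unfold f in Hfr; pose proof (exp_pos (be * r)); nra].
  replace q with (exp (be * (ln (q / M) / be)) * M).
  - apply Rmult_le_compat_r; [lra|]. destruct Hr2 as [Hlt| ->]; [|lra].
    left. apply exp_increasing. nra.
  - replace (be * (ln (q / M) / be)) with (ln (q / M)) by (field; lra).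
    rewrite exp_ln by now apply Rdiv_lt_0_compat. field. lra.
Qed.

Section Branch.
Context {p k be m A n : R} {U : R -> R -> R} {y c : R -> R}.
Hypotheses (HL : emden_link p k be m A n)
  (HU : forall g, 1 < g -> radial_sol p n g (U g) (Derive (U g)))
  (Hsol : forall t, sol_at p k be m y c t)
  (Hlim : forall e, 0 < e -> exists T, forall t, t <= T ->
     Rabs (y t - 1) < e /\ Rabs (c t + k * y t) < e)
  (HE : forall t, energy p k m y c t < 0).

Let yy g := emden_y A k m (U g).
Let cc g := emden_c A k m (Derive (U g)).

Lemma branch_global (g : R) : 1 < g ->
  (forall s, 0 < s -> 0 < U g s <= g) /\ (forall t, sol_at p k be m (yy g) (cc g) t) /\
  (forall t, energy p k m (yy g) (cc g) t < 0).
Proof.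
  intros Hg. destruct (radial_global p k be m A n HL) as (x0 & e0 & _ & _ & H).
  destruct (H g (U g) (Derive (U g)) Hg (HU g Hg)) as (H1 & H2 & H3 & _). auto.
Qed.

(** All constants precede [g]. The window from [ln (x0 A / g) / k + T1] to [tz] lengthens without
    bound as [g] grows, so the contraction at [tz] becomes arbitrarily strong and the total turning
    arbitrarily large. The sign of [c] up to [tz] shows that no zero is hidden near minus
    infinity. *)
Lemma branch_trapped :
  exists tz x0 T1 C ka, 0 < x0 /\ 0 < C /\ 0 < ka /\
  (forall t, t <= tz -> c t < 0 /\ 1 / 2 < y t) /\
  forall g, 2 <= g ->
    (forall t, t <= tz -> cc g t < 0) /\
    (ln (x0 * A / g) / k + T1 <= tz ->
      dist2 (yy g) (cc g) y c tz <= C * exp (- ka * (tz - (ln (x0 * A / g) / k + T1)))) /\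
    (forall t, ln (x0 * A / g) / k + T1 <= t <= tz ->
      (yy g t - y t) * (slope p be m (yy g) (cc g) t - slope p be m y c t)
        - (cc g t - c t) * (cc g t - c t + k * (yy g t - y t))
      <= - ka * dist2 (yy g) (cc g) y c t).
Proof.
  assert (HL' := HL). destruct HL' as [[Hp Hk Hkb Hkb1 Hm Hsc Hfo] Hn Hdim HA Hamp].
  assert (HP := el_params _ _ _ _ _ _ HL).
  destruct (radial_global p k be m A n HL) as (x0 & e0 & Hx0 & He0 & HG).
  destruct (focus_rotation p k be m HP) as (dr & kr & Hdr & Hkr & Hrot).
  destruct (focus_contraction p k be m HP) as (dc & kc & Cc & Hdc & Hkc & HCc & Hcon).
  destruct (relaxation p k be m e0 HP He0) as (ks & Cs & Hks & HCs & Hrel).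
  set (d := Rmin dr dc). assert (Hd : 0 < d < 1).
  { unfold d. split; [apply Rmin_glb_lt; lra|]. pose proof (Rmin_l dr dc). lra. }
  assert (Hd1 : d <= dr) by apply Rmin_l. assert (Hd2 : d <= dc) by apply Rmin_r.
  set (q0 := Rpower (sqrt e0) (p - 1)). assert (Hq0 : 0 < q0) by apply Rpower_pos.
  assert (Hd22 : 0 < d ^ 2) by (apply pow_lt; lra).
  assert (Hq1 : 0 < d ^ 2 / (2 * Cs)) by (apply Rdiv_lt_0_compat; lra).
  (* Three thresholds for [eps]: [d] for the two focus estimates, [q0] for [y^(p-1) > eps], and the
     last one for half of the relaxation error. *)
  destruct (eps_small m (Rmin d (Rmin q0 (d ^ 2 / (2 * Cs))))) as [Ta HTa]; [exact Hm| |].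
  { repeat apply Rmin_glb_lt; lra. }
  (* The tolerance [k / 4] on [c + k y] gives [c < 0], because [k y > k / 2]. *)
  destruct (Hlim (Rmin d (Rmin (1 / 2) (k / 4)))) as [Tb HTb].
  { repeat apply Rmin_glb_lt; lra. }
  set (tz := Rmin Ta Tb). assert (tz <= Ta) by apply Rmin_l. assert (tz <= Tb) by apply Rmin_r.
  assert (Heps : forall t, t <= tz -> 0 < eps m t /\ eps m t < d /\ eps m t < q0 /\
     Cs * eps m t <= d ^ 2 / 2).
  { intros t Ht. specialize (HTa t ltac:(lra)). split; [now apply eps_pos|].
    pose proof (Rmin_l d (Rmin q0 (d ^ 2 / (2 * Cs)))).
    pose proof (Rmin_r d (Rmin q0 (d ^ 2 / (2 * Cs)))).
    pose proof (Rmin_l q0 (d ^ 2 / (2 * Cs))). pose proof (Rmin_r q0 (d ^ 2 / (2 * Cs))).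
    split; [lra|]. split; [lra|].
    replace (d ^ 2 / 2) with (Cs * (d ^ 2 / (2 * Cs))) by (field; lra).
    apply Rmult_le_compat_l; lra. }
  assert (Hys : forall t, t <= tz -> Rabs (y t - 1) <= d /\ c t < 0 /\ 1 / 2 < y t).
  { intros t Ht. destruct (HTb t ltac:(lra)) as [I1 I2].
    pose proof (Rmin_l d (Rmin (1 / 2) (k / 4))). pose proof (Rmin_r d (Rmin (1 / 2) (k / 4))).
    pose proof (Rmin_l (1 / 2) (k / 4)). pose proof (Rmin_r (1 / 2) (k / 4)).
    split; [lra|]. apply Rabs_def2 in I1, I2. split; [|lra].
    assert (1 / 2 * k < k * y t) by nra. lra. }
  destruct (decaying_exp_below Cs ks (d ^ 2 / 2) HCs Hks ltac:(lra)) as [T1 [HT10 HT1]].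
  (* Bound for the squared distance on entering the neighbourhood: both [y] components lie between 0
     and 2, and both [c + k y] are at most 3 in absolute value. *)
  set (Q := 4 + (2 * (3 + 2 * k)) ^ 2).
  assert (HQ : 0 < Q). { unfold Q. pose proof (pow2_ge_0 (2 * (3 + 2 * k))). lra. }
  exists tz, x0, T1, (Cc * Q), (Rmin kr kc).
  split; [exact Hx0|]. split; [nra|]. split; [apply Rmin_glb_lt; lra|]. split.
  { intros t Ht. now apply Hys. }
  intros g Hg.
  destruct (HG g (U g) (Derive (U g)) ltac:(lra) (HU g ltac:(lra))) as (U1 & U2 & U3 & U4 & U5).
  fold (yy g) in U2, U3, U4. fold (cc g) in U2, U3, U4.
  set (tk := ln (x0 * A / g) / k) in *.
  assert (Htrap : forall t, tk + T1 <= t <= tz -> Rabs (yy g t - 1) <= d).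
  { intros t Ht. destruct (Heps t ltac:(lra)) as (E1 & E2 & E3 & E4).
    pose proof (Hrel (yy g) (cc g) tk t ltac:(lra) ltac:(lra) ltac:(intros; apply U2) U4) as HR.
    specialize (HT1 (t - tk) ltac:(lra)).
    apply Rsqr_incr_0_var; [|lra]. unfold Rsqr.
    pose proof (pow2_ge_0 (cc g t + k * yy g t)).
    replace (Rabs (yy g t - 1) * Rabs (yy g t - 1)) with ((yy g t - 1) ^ 2).
    2:{ rewrite <- (pow2_abs (yy g t - 1)). ring. }
    nra. }
  split; [|split].
  - apply (sol_decreasing_start p k be m tz ((1 + k) * (2 * amplitude p 1)) (yy g)); auto; try lra.
    + intros t Ht. destruct (Heps t Ht) as (E1 & E2 & E3 & E4). destruct (U2 t) as [Py _].
      (* Up to the reference time, [u >= 3 g / 4 > 1]; afterwards the energy gives [y >= sqrt e0],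
         hence [y^(p-1) >= q0 > eps]. *)
      destruct (Rle_lt_dec t tk) as [Htk|Htk].
      * assert (HUt : 3 / 4 * g <= U g (exp (m * t))).
        { apply U5. split; [apply exp_pos|]. destruct Htk as [Hlt| ->]; [|lra].
          left. apply exp_increasing. nra. }
        unfold yy, emden_y. rewrite (Rpower_emden p k be m A n) by (auto; lra).
        rewrite (Rpower_split (U g (exp (m * t)))) by lra. unfold eps.
        assert (Hone : 1 < Rpower (U g (exp (m * t))) (p - 1)) by (apply Rpower_gt_1; lra).
        set (x := U g (exp (m * t))) in *.
        replace (m ^ 2 * exp (2 * m * t) * exp (k * t) * (x * Rpower x (p - 1)) / A)
          with (m ^ 2 * exp (2 * m * t) * (exp (k * t) * x / A) * Rpower x (p - 1)) by (field; lra).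
        rewrite <- (Rmult_1_r (m ^ 2 * exp (2 * m * t) * (exp (k * t) * x / A))) at 1.
        apply Rmult_lt_compat_l; [|exact Hone].
        apply Rmult_lt_0_compat; [exact E1|exact Py].
      * assert (HEt : energy p k m (yy g) (cc g) t <= - e0).
        { eapply Rle_trans; [|exact U4]. apply (energy_decr p k be m); auto. lra. }
        apply (energy_lower p k be m) in HEt; auto.
        assert (Hs : sqrt e0 <= yy g t).
        { apply Rsqr_incr_0_var; [|lra]. rewrite Rsqr_sqrt by lra. unfold Rsqr.
          pose proof (pow2_ge_0 (yy g t)). nra. }
        assert (q0 <= Rpower (yy g t) (p - 1)).
        { apply Rle_Rpower_l; [lra|]. split; [now apply sqrt_lt_R0|exact Hs]. }
        rewrite (Rpower_split (yy g t)) by exact Py. rewrite Rmult_comm.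
        apply Rmult_lt_compat_l; lra.
    + pose proof (amplitude_ge_1 p 1 Hp ltac:(lra)). nra.
    + intros t Ht. destruct (Heps t Ht) as (E1 & E2 & E3 & E4). destruct (U2 t) as [Py _].
      assert (HB : yy g t <= amplitude p 1) by (apply (energy_upper p k be m _ (cc g) t); auto; lra).
      pose proof (energy_speed p k be m _ _ t HP Py (U3 t)) as Hsp.
      set (v := cc g t + k * yy g t) in *.
      assert (Hv : Rabs v <= 2 * yy g t).
      { apply Rsqr_incr_0_var; [|lra]. rewrite <- Rsqr_abs. unfold Rsqr.
        pose proof (pow2_ge_0 (yy g t)). nra. }
      replace (cc g t) with (v - k * yy g t) by (unfold v; ring).
      apply Rabs_le_between in Hv. apply Rabs_le. nra.
  - intros Ht.
    assert (HC := Hcon (yy g) (cc g) y c (tk + T1) tz Ht).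
    destruct (Heps tz ltac:(lra)) as (E1 & E2 & _).
    eapply Rle_trans; [apply HC|]; [lra| | |].
    + intros t Htt. split; [apply U2|]. specialize (Htrap t Htt). lra.
    + intros t Htt. split; [apply Hsol|]. destruct (Hys t ltac:(lra)) as [I _]. lra.
    + assert (Hdist : dist2 (yy g) (cc g) y c (tk + T1) <= Q).
      { destruct (Hys (tk + T1) Ht) as [I1 [_ _]]. specialize (Htrap (tk + T1) ltac:(lra)).
        destruct (Heps (tk + T1) Ht) as (F1 & F2 & _).
        pose proof (energy_speed p k be m _ _ _ HP (proj1 (U2 (tk + T1))) (U3 (tk + T1))) as S1.
        pose proof (energy_speed p k be m _ _ _ HP (proj1 (Hsol (tk + T1))) (HE (tk + T1))) as S2.
        destruct (U2 (tk + T1)) as [P1 _]. destruct (Hsol (tk + T1)) as [P2 _].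
        apply Rabs_le_between in I1, Htrap.
        unfold dist2, Q. set (a1 := yy g (tk + T1)) in *. set (a2 := y (tk + T1)) in *.
        set (b1 := cc g (tk + T1)) in *. set (b2 := c (tk + T1)) in *.
        assert (A1 : a1 ^ 2 <= 4) by nra. assert (A2 : a2 ^ 2 <= 4) by nra.
        assert (B1 : Rabs (b1 + k * a1) <= 3).
        { apply Rsqr_incr_0_var; [|lra]. rewrite <- Rsqr_abs. unfold Rsqr.
          pose proof (pow2_ge_0 a1). nra. }
        assert (B2 : Rabs (b2 + k * a2) <= 3).
        { apply Rsqr_incr_0_var; [|lra]. rewrite <- Rsqr_abs. unfold Rsqr.
          pose proof (pow2_ge_0 a2). nra. }
        apply Rabs_le_between in B1, B2.
        apply Rplus_le_compat.
        - rewrite <- pow2_abs. assert (Rabs (a1 - a2) <= 2) by (apply Rabs_le; lra).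
          pose proof (Rabs_pos (a1 - a2)). nra.
        - rewrite <- (pow2_abs (b1 - b2)). apply pow_incr. split; [apply Rabs_pos|].
          apply Rabs_le. nra. }
      assert (Hmin : exp (- kc * (tz - (tk + T1))) <= exp (- Rmin kr kc * (tz - (tk + T1)))).
      { pose proof (Rmin_r kr kc) as Hr.
        assert (- kc * (tz - (tk + T1)) <= - Rmin kr kc * (tz - (tk + T1))) by nra.
        destruct H1 as [H1|H1]; [left; now apply exp_increasing|rewrite H1; lra]. }
      pose proof (exp_pos (- kc * (tz - (tk + T1)))).
      assert (0 <= dist2 (yy g) (cc g) y c (tk + T1)).
      { unfold dist2. pose proof (pow2_ge_0 (yy g (tk + T1) - y (tk + T1))).
        pose proof (pow2_ge_0 (cc g (tk + T1) - c (tk + T1))). lra. }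
      apply Rmult_le_compat; [nra|lra| |exact Hmin]. apply Rmult_le_compat_l; lra.
  - intros t Ht. specialize (Htrap t Ht). destruct (Hys t ltac:(lra)) as [I1 _].
    destruct (Heps t ltac:(lra)) as (E1 & E2 & _).
    pose proof (Hrot (yy g t) (y t) (cc g t - c t) (eps m t) ltac:(lra) ltac:(lra) ltac:(lra)) as HR.
    unfold slope, dist2. pose proof (Rmin_l kr kc).
    pose proof (pow2_ge_0 (yy g t - y t)). pose proof (pow2_ge_0 (cc g t - c t)).
    assert (Rmin kr kc * ((yy g t - y t) ^ 2 + (cc g t - c t) ^ 2)
      <= kr * ((yy g t - y t) ^ 2 + (cc g t - c t) ^ 2)) by (apply Rmult_le_compat_r; lra).
    nra.
Qed.

Lemma scaling_time_small (x0 T : R) : 0 < x0 -> exists G, forall g, 2 <= g -> G <= g ->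
  ln (x0 * A / g) / k <= T.
Proof.
  intros Hx0. assert (Hk := ep_k _ _ _ _ (el_params _ _ _ _ _ _ HL)).
  assert (HA := el_A _ _ _ _ _ _ HL).
  exists (x0 * A * exp (- (k * T))). intros g Hg HG.
  apply Rmult_le_reg_r with k; [exact Hk|].
  replace (ln (x0 * A / g) / k * k) with (ln (x0 * A / g)) by (field; lra).
  rewrite <- (ln_exp (T * k)). apply ln_le; [apply Rdiv_lt_0_compat; nra|].
  apply Rmult_le_reg_r with g; [lra|]. replace (x0 * A / g * g) with (x0 * A) by (field; lra).
  apply Rle_trans with (exp (T * k) * (x0 * A * exp (- (k * T)))).
  - right. rewrite exp_Ropp, (Rmult_comm T k). field. pose proof (exp_pos (k * T)). lra.
  - apply Rmult_le_compat_l; [left; apply exp_pos|exact HG].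
Qed.

(** From [tz] to [b] the distance grows by at most a fixed factor, while the contraction before [tz]
    makes it as small as desired; the slopes follow because the field is Lipschitz on bounded
    sets. *)
Lemma branch_converges (tz x0 T1 C ka b e : R) :
  0 < x0 -> 0 < C -> 0 < ka -> tz <= b -> 0 < e ->
  (forall g, 2 <= g -> ln (x0 * A / g) / k + T1 <= tz ->
      dist2 (yy g) (cc g) y c tz <= C * exp (- ka * (tz - (ln (x0 * A / g) / k + T1)))) ->
  exists G, 2 <= G /\ forall g, G <= g ->
    close (cc g) (slope p be m (yy g) (cc g)) c (slope p be m y c) e tz b.
Proof.
  intros Hx0 HC Hka Hb He Hdec.
  assert (HL' := HL). destruct HL' as [[Hp Hk Hkb Hkb1 Hm Hsc Hfo] Hn Hdim HA Hamp].
  assert (HP := el_params _ _ _ _ _ _ HL).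
  set (B := amplitude p (eps m b)).
  destruct (dist2_growth p k be m B b HP) as [K [HK HG]].
  pose proof (eps_pos m b Hm) as Hepb.
  set (Lp := p * Rpower B (p - 1)).
  assert (HLp : 0 < Lp). { unfold Lp. pose proof (Rpower_pos B (p - 1)). nra. }
  set (M := 1 + be + eps m b + Lp). assert (HM : 1 < M) by (unfold M; lra).
  set (e1 := e / (2 * M)). assert (He1 : 0 < e1) by (apply Rdiv_lt_0_compat; lra).
  assert (HMe : M * e1 < e). { unfold e1. replace (M * (e / (2 * M))) with (e / 2) by (field; lra). lra. }
  set (X := exp (K * (b - tz))). assert (HX : 0 < X) by apply exp_pos.
  destruct (decaying_exp_below (C * X) ka (e1 ^ 2)) as [L0 [HL0 HLe]];
    [nra|exact Hka|now apply pow_lt|].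
  destruct (scaling_time_small x0 (tz - T1 - L0) Hx0) as [G0 HG0].
  exists (Rmax 2 G0). split; [apply Rmax_l|]. intros g Hg.
  pose proof (Rmax_l 2 G0). pose proof (Rmax_r 2 G0).
  specialize (HG0 g ltac:(lra) ltac:(lra)). specialize (Hdec g ltac:(lra) ltac:(lra)).
  destruct (branch_global g ltac:(lra)) as (_ & S1 & E1).
  set (tk := ln (x0 * A / g) / k) in *.
  assert (HyB : forall t, t <= b -> yy g t <= B /\ y t <= B).
  { intros t Ht. pose proof (eps_le m t b Hm Ht).
    split; [apply (energy_upper p k be m _ (cc g) t)|apply (energy_upper p k be m _ c t)]; auto.
    - apply S1.
    - apply Hsol. }
  intros t Ht.
  destruct (HG (yy g) (cc g) y c tz t) as [Hgr _]; [lra| | |].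
  { intros r Hr. split; [apply S1|apply HyB; lra]. }
  { intros r Hr. split; [apply Hsol|apply HyB; lra]. }
  assert (Hd : dist2 (yy g) (cc g) y c t <= e1 ^ 2).
  { apply Rle_trans with (1 := Hgr).
    apply Rle_trans with (C * exp (- ka * (tz - (tk + T1))) * X).
    - apply Rmult_le_compat; [|left; apply exp_pos|exact Hdec|].
      + unfold dist2. pose proof (pow2_ge_0 (yy g tz - y tz)).
        pose proof (pow2_ge_0 (cc g tz - c tz)). lra.
      + unfold X. assert (Hle : K * (t - tz) <= K * (b - tz)) by (apply Rmult_le_compat_l; lra).
        destruct Hle as [Hlt| ->]; [left; now apply exp_increasing|lra].
    - specialize (HLe (tz - (tk + T1)) ltac:(lra)). lra. }
  assert (Dy : Rabs (yy g t - y t) <= e1 /\ Rabs (cc g t - c t) <= e1).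
  { unfold dist2 in Hd. pose proof (pow2_ge_0 (yy g t - y t)). pose proof (pow2_ge_0 (cc g t - c t)).
    split; (apply Rsqr_incr_0_var; [|lra]; rewrite <- Rsqr_abs, !Rsqr_pow2; lra). }
  destruct Dy as [Dy Dc].
  pose proof (Rpower_lipschitz p B (yy g t) (y t) Hp) as HR. fold Lp in HR.
  specialize (HR (conj (proj1 (S1 t)) (proj1 (HyB t ltac:(lra))))
    (conj (proj1 (Hsol t)) (proj2 (HyB t ltac:(lra))))).
  pose proof (eps_pos m t Hm). pose proof (eps_le m t b Hm ltac:(lra)).
  assert (HeM : e1 < e).
  { apply Rle_lt_trans with (2 := HMe). rewrite <- (Rmult_1_l e1) at 1.
    apply Rmult_le_compat_r; lra. }
  split; [lra|].
  unfold slope.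
  replace (- be * cc g t + eps m t * yy g t - Rpower (yy g t) p
      - (- be * c t + eps m t * y t - Rpower (y t) p))
    with (- be * (cc g t - c t) + eps m t * (yy g t - y t) - (Rpower (yy g t) p - Rpower (y t) p)) by ring.
  set (z := yy g t - y t) in *. set (w := cc g t - c t) in *.
  set (r := Rpower (yy g t) p - Rpower (y t) p) in *.
  assert (HR' : Rabs r <= Lp * e1).
  { apply Rle_trans with (1 := HR). apply Rmult_le_compat_l; lra. }
  assert (Hw : Rabs (be * w) <= be * e1).
  { rewrite Rabs_mult, (Rabs_right be) by lra. apply Rmult_le_compat_l; lra. }
  assert (Hz : Rabs (eps m t * z) <= eps m b * e1).
  { rewrite Rabs_mult, (Rabs_right (eps m t)) by lra.
    apply Rmult_le_compat; [lra|apply Rabs_pos|lra|exact Dy]. }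
  apply Rabs_le_between in Hw, Hz, HR'.
  assert (HMe' : e1 + be * e1 + eps m b * e1 + Lp * e1 < e).
  { apply Rle_lt_trans with (2 := HMe). right. unfold M. ring. }
  apply Rabs_def1; lra.
Qed.

Lemma branch_oscillates (tz x0 T1 ka t1 f0 M : R) :
  0 < x0 -> 0 < ka -> tz <= t1 -> (forall t, t <= tz -> 1 / 2 < y t) ->
  (forall g, 2 <= g -> forall t, ln (x0 * A / g) / k + T1 <= t <= tz ->
      (yy g t - y t) * (slope p be m (yy g) (cc g) t - slope p be m y c t)
        - (cc g t - c t) * (cc g t - c t + k * (yy g t - y t))
      <= - ka * dist2 (yy g) (cc g) y c t) ->
  exists g r, M < g /\ 2 < g /\ 0 < r /\
    yy g t1 - y t1 = r * cos f0 /\ cc g t1 - c t1 = r * sin f0.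
Proof.
  intros Hx0 Hka Ht1 Hyhalf Hrot.
  assert (HL' := HL). destruct HL' as [[Hp Hk Hkb Hkb1 Hm Hsc Hfo] Hn Hdim HA Hamp].
  assert (HP := el_params _ _ _ _ _ _ HL).
  assert (HB : forall g T t, 2 < g -> t <= T ->
    yy g t <= amplitude p (eps m T) /\ y t <= amplitude p (eps m T)).
  { intros g T t Hg Ht. destruct (branch_global g ltac:(lra)) as (_ & S1 & E1).
    pose proof (eps_le m t T Hm Ht).
    split; [apply (energy_upper p k be m _ (cc g) t)|apply (energy_upper p k be m _ c t)]; auto.
    - apply S1.
    - apply Hsol. }
  (* For [g <= G] the regular [y] is at most [exp (k t) G' / A], which tends to 0 at minus infinity,
     while the singular one exceeds [1 / 2]. *)
  assert (Hbase : forall G, exists tb, forall g t, 2 < g <= G -> t <= tb -> yy g t - y t < 0).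
  { intros G. set (G' := Rmax G 1). assert (1 <= G') by apply Rmax_r. assert (G <= G') by apply Rmax_l.
    exists (Rmin tz (ln (A / (2 * G')) / k)). intros g t Hg Ht.
    pose proof (Rmin_l tz (ln (A / (2 * G')) / k)). pose proof (Rmin_r tz (ln (A / (2 * G')) / k)).
    specialize (Hyhalf t ltac:(lra)).
    destruct (branch_global g ltac:(lra)) as (U1 & _ & _).
    destruct (U1 (exp (m * t)) (exp_pos _)) as [_ HUg].
    assert (HAG : 0 < A / (2 * G')) by (apply Rdiv_lt_0_compat; lra).
    assert (Hexp : exp (k * t) <= A / (2 * G')).
    { rewrite <- (exp_ln (A / (2 * G'))) by exact HAG.
      assert (Hle : k * t <= ln (A / (2 * G'))).
      { apply Rle_trans with (k * (ln (A / (2 * G')) / k)); [apply Rmult_le_compat_l; lra|].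
        right; field; lra. }
      destruct Hle as [Hlt| ->]; [left; now apply exp_increasing|lra]. }
    assert (Hyy : yy g t <= A / (2 * G') * G' / A).
    { unfold yy, emden_y. apply Rmult_le_compat_r; [left; now apply Rinv_0_lt_compat|].
      apply Rmult_le_compat; [left; apply exp_pos|left; apply U1, exp_pos|exact Hexp|lra]. }
    replace (A / (2 * G') * G' / A) with (1 / 2) in Hyy by (field; lra). lra. }
  (* Backward uniqueness: solutions that meet at [t] agree at all earlier times, against [Hbase]. *)
  assert (Hpos : forall g t, 2 < g -> 0 < (yy g t - y t) ^ 2 + (cc g t - c t) ^ 2).
  { intros g t Hg. destruct (Rle_lt_dec ((yy g t - y t) ^ 2 + (cc g t - c t) ^ 2) 0) as [Hle|];
      [exfalso|assumption].
    destruct (Hbase g) as [tb Htb]. set (a := Rmin t tb).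
    assert (a <= t) by apply Rmin_l. assert (a <= tb) by apply Rmin_r.
    specialize (Htb g a ltac:(lra) ltac:(lra)).
    destruct (branch_global g ltac:(lra)) as (_ & S1 & _).
    destruct (dist2_growth p k be m (amplitude p (eps m t)) t HP) as [K [_ HG]].
    destruct (HG (yy g) (cc g) y c a t) as [_ H1]; [lra| | |].
    { intros r Hr. split; [apply S1|apply HB; lra]. }
    { intros r Hr. split; [apply Hsol|apply (HB g); lra]. }
    unfold dist2 in H1. pose proof (exp_pos (K * (t - a))).
    pose proof (pow2_ge_0 (cc g a - c a)). assert (0 < (yy g a - y a) ^ 2) by nra. nra. }
  assert (Hcont : forall g0 a b s, 2 < g0 -> 0 < s -> exists d, 0 < d /\
     forall g t, 2 < g -> Rabs (g - g0) < d -> a <= t <= b ->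
       (yy g t - y t - (yy g0 t - y t)) ^ 2 + (cc g t - c t - (cc g0 t - c t)) ^ 2
       <= s ^ 2 * ((yy g0 t - y t) ^ 2 + (cc g0 t - c t) ^ 2)).
  { intros g0 a b s Hg0 Hs.
    destruct (Rle_lt_dec a b) as [Hab|Hab].
    2:{ exists 1. split; [lra|]. intros; lra. }
    destruct (radial_continuous_dependence p n (g0 + 1) Hp Hn ltac:(lra)) as [K [HK HR]].
    destruct (dist2_growth p k be m (amplitude p (eps m b)) b HP) as [K' [HK' HG]].
    destruct (branch_global g0 ltac:(lra)) as (U0 & S0 & _).
    (* A positive lower bound, on [[a, b]], for the squared distance to the singular solution: it
       turns absolute closeness of two regular solutions into relative closeness of their
       differences with the singular one. *)
    set (mu := dist2 (yy g0) (cc g0) y c a * exp (- K' * (b - a))).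
    assert (Hmu : 0 < mu). { apply Rmult_lt_0_compat; [now apply Hpos|apply exp_pos]. }
    assert (Hlow : forall t, a <= t <= b -> mu <= (yy g0 t - y t) ^ 2 + (cc g0 t - c t) ^ 2).
    { intros t Ht. fold (dist2 (yy g0) (cc g0) y c t).
      destruct (HG (yy g0) (cc g0) y c a t) as [_ H1]; [lra| | |].
      { intros r Hr. split; [apply S0|apply HB; lra]. }
      { intros r Hr. split; [apply Hsol|apply (HB g0); lra]. }
      unfold mu. pose proof (Hpos g0 t Hg0) as Pt. fold (dist2 (yy g0) (cc g0) y c t) in Pt.
      apply Rle_trans with (dist2 (yy g0) (cc g0) y c t * exp (K' * (t - a)) * exp (- K' * (b - a))).
      - apply Rmult_le_compat_r; [left; apply exp_pos|exact H1].
      - rewrite Rmult_assoc, <- exp_plus.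
        rewrite <- (Rmult_1_r (dist2 (yy g0) (cc g0) y c t)) at 2.
        apply Rmult_le_compat_l; [lra|]. rewrite <- exp_0.
        assert (Hle : K' * (t - a) + - K' * (b - a) <= 0) by nra.
        destruct Hle as [Hlt| ->]; [left; now apply exp_increasing|lra]. }
    set (Mf := (exp (k * b) / A) ^ 2 + (m * exp (k * b) * exp (m * b) / A) ^ 2).
    assert (HMf : 0 < Mf).
    { unfold Mf. assert (0 < exp (k * b) / A) by (apply Rdiv_lt_0_compat; [apply exp_pos|lra]).
      pose proof (pow2_ge_0 (m * exp (k * b) * exp (m * b) / A)). nra. }
    set (Q := Mf * exp (K * exp (m * b))).
    assert (HQ : 0 < Q) by (apply Rmult_lt_0_compat; [exact HMf|apply exp_pos]).
    assert (Hq : 0 < s ^ 2 * mu / Q).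
    { apply Rdiv_lt_0_compat; [|exact HQ]. apply Rmult_lt_0_compat; [now apply pow_lt|exact Hmu]. }
    exists (Rmin 1 (sqrt (s ^ 2 * mu / Q))).
    split; [apply Rmin_glb_lt; [lra|now apply sqrt_lt_R0]|].
    intros g t Hg Hgd Ht.
    pose proof (Rmin_l 1 (sqrt (s ^ 2 * mu / Q))). pose proof (Rmin_r 1 (sqrt (s ^ 2 * mu / Q))).
    assert (Hg1 : g <= g0 + 1).
    { assert (Hlt : Rabs (g - g0) < 1) by lra. apply Rabs_def2 in Hlt. lra. }
    assert (Hg2 : (g - g0) ^ 2 * Q <= s ^ 2 * mu).
    { apply Rle_trans with (s ^ 2 * mu / Q * Q); [|right; field; lra].
      apply Rmult_le_compat_r; [lra|].
      assert (Hlt : Rabs (g - g0) < sqrt (s ^ 2 * mu / Q)) by lra.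
      rewrite <- (pow2_abs (g - g0)). pose proof (Rabs_pos (g - g0)).
      rewrite <- (sqrt_sqrt (s ^ 2 * mu / Q)) by lra. nra. }
    destruct (branch_global g ltac:(lra)) as (U1 & _ & _).
    pose proof (HR g (U g) (Derive (U g)) g0 (U g0) (Derive (U g0)) (HU g ltac:(lra)) (HU g0 ltac:(lra))) as H1.
    specialize (H1 ltac:(intros r Hr; specialize (U1 r Hr); lra)
       ltac:(intros r Hr; specialize (U0 r Hr); lra) (exp (m * t)) (exp_pos _)).
    set (w := U g (exp (m * t)) - U g0 (exp (m * t))) in *.
    set (w1 := Derive (U g) (exp (m * t)) - Derive (U g0) (exp (m * t))) in *.
    assert (Hexp : forall x, 0 < x -> exp (x * t) <= exp (x * b)).
    { intros x Hx. assert (Hle : x * t <= x * b) by nra.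
      destruct Hle as [Hlt| ->]; [left; now apply exp_increasing|lra]. }
    assert (H2 : (yy g t - y t - (yy g0 t - y t)) ^ 2 + (cc g t - c t - (cc g0 t - c t)) ^ 2
       <= Mf * (w ^ 2 + w1 ^ 2)).
    { replace (yy g t - y t - (yy g0 t - y t)) with (exp (k * t) / A * w).
      2:{ unfold w, yy, emden_y. field. lra. }
      replace (cc g t - c t - (cc g0 t - c t)) with (m * exp (k * t) * exp (m * t) / A * w1).
      2:{ unfold w1, cc, emden_c. field. lra. }
      rewrite !Rpow_mult_distr. unfold Mf.
      pose proof (exp_pos (k * t)). pose proof (exp_pos (m * t)).
      assert (Hi : 0 < / A) by now apply Rinv_0_lt_compat.
      assert (I1 : (exp (k * t) / A) ^ 2 <= (exp (k * b) / A) ^ 2).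
      { apply pow_incr. split; [left; now apply Rdiv_lt_0_compat|].
        apply Rmult_le_compat_r; [lra|now apply Hexp]. }
      assert (I2 : (m * exp (k * t) * exp (m * t) / A) ^ 2 <= (m * exp (k * b) * exp (m * b) / A) ^ 2).
      { apply pow_incr. split.
        - left. apply Rdiv_lt_0_compat; [|exact HA]. now repeat apply Rmult_lt_0_compat.
        - apply Rmult_le_compat_r; [lra|].
          apply Rmult_le_compat; [apply Rmult_le_pos; lra|lra| |now apply Hexp].
          apply Rmult_le_compat_l; [lra|now apply Hexp]. }
      pose proof (pow2_ge_0 w). pose proof (pow2_ge_0 w1).
      pose proof (pow2_ge_0 (exp (k * b) / A)).
      pose proof (pow2_ge_0 (m * exp (k * b) * exp (m * b) / A)).
      rewrite Rmult_plus_distr_l.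
      apply Rplus_le_compat; apply Rmult_le_compat_r; lra. }
    apply Rle_trans with (1 := H2).
    apply Rle_trans with (Mf * ((g - g0) ^ 2 * exp (K * exp (m * b)))).
    - apply Rmult_le_compat_l; [lra|]. apply Rle_trans with (1 := H1).
      apply Rmult_le_compat_l; [apply pow2_ge_0|].
      assert (Hle : K * exp (m * t) <= K * exp (m * b)).
      { apply Rmult_le_compat_l; [lra|now apply Hexp]. }
      destruct Hle as [Hlt| ->]; [left; now apply exp_increasing|lra].
    - apply Rle_trans with ((g - g0) ^ 2 * Q); [right; unfold Q; ring|].
      apply Rle_trans with (1 := Hg2). apply Rmult_le_compat_l; [apply pow2_ge_0|now apply Hlow]. }
  destruct (@winding_attains (fun g t => yy g t - y t) (fun g t => cc g t - c t)
    (fun g t => cc g t - c t + k * (yy g t - y t))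
    (fun g t => slope p be m (yy g) (cc g) t - slope p be m y c t) 2 t1) with (f0 := f0) (M := M)
    as (g & r & Hg1 & Hg2 & Hr & E1 & E2).
  - intros g t Hg. destruct (branch_global g ltac:(lra)) as (_ & S1 & _).
    destruct (S1 t) as [_ [D1 _]]. destruct (Hsol t) as [_ [D2 _]].
    set (f := yy g) in *. clearbody f. derive_auto. ring.
  - intros g t Hg. destruct (branch_global g ltac:(lra)) as (_ & S1 & _).
    destruct (S1 t) as [_ [_ D1]]. destruct (Hsol t) as [_ [_ D2]]. unfold slope.
    set (f := yy g) in *. set (h := cc g) in *. clearbody f h. derive_auto. ring.
  - intros g t Hg. destruct (branch_global g ltac:(lra)) as (_ & S1 & _).
    destruct (S1 t) as [_ [D1 D2]]. destruct (Hsol t) as [_ [D3 D4]].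
    apply ex_derive_continuity_pt.
    set (f := yy g) in *. set (h := cc g) in *. clearbody f h.
    auto_derive. repeat split; eexists; eassumption.
  - intros g t Hg. destruct (branch_global g ltac:(lra)) as (_ & S1 & _).
    destruct (S1 t) as [P1 [D1 D2]]. destruct (Hsol t) as [P2 [D3 D4]].
    apply ex_derive_continuity_pt. unfold slope, eps, Rpower.
    set (f := yy g) in *. set (h := cc g) in *. clearbody f h.
    auto_derive. repeat split; try assumption; eexists; eassumption.
  - exact Hpos.
  - intros g t Hg E. rewrite E. ring.
  - exact Hbase.
  - exact Hcont.
  - exists ka, tz. split; [exact Hka|]. split; [exact Ht1|]. intros L.
    destruct (scaling_time_small x0 (tz - L - T1) Hx0) as [G HG].
    exists G. intros g Hg HgG. exists (ln (x0 * A / g) / k + T1).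
    split; [specialize (HG g ltac:(lra) HgG); lra|].
    intros t Ht. apply (Hrot g ltac:(lra) t Ht).
  - exists g, r. auto.
Qed.

End Branch.

(** * Critical points on the branch and the alternating sequence *)

Lemma branch_nth_crit (k m A n : R) (U : R -> R) (p ga : R) (j : nat) (t : R) :
  0 < m -> 0 < A -> radial_sol p n ga U (Derive U) ->
  nth_zero (emden_c A k m (Derive U)) j t -> is_nth_crit U j (exp (m * t)).
Proof.
  intros Hm HA HU.
  apply (nth_crit_of_nth_zero m U (fun s => A / (m * exp (k * (ln s / m)) * s))); [exact Hm|].
  intros s Hs. pose proof (exp_pos (k * (ln s / m))) as He. split.
  - apply Rdiv_lt_0_compat; [exact HA|]. apply Rmult_lt_0_compat; nra.
  - replace (A / (m * exp (k * (ln s / m)) * s) * emden_c A k m (Derive U) (ln s / m))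
      with (Derive U s); [now apply (rs_deriv _ _ _ _ _ HU)|].
    unfold emden_c. replace (exp (m * (ln s / m))) with s.
    + field. repeat split; lra.
    + replace (m * (ln s / m)) with (ln s) by (field; lra). now rewrite exp_ln.
Qed.

Lemma alternating_sequence (P : bool -> R -> Prop) (a : R) :
  (forall b M, exists g, M < g /\ P b g) ->
  exists g : nat -> R, a < g 0%nat /\ (forall j, g j < g (S j)) /\
    (forall M, exists j, M < g j) /\ (forall j, P (Nat.even j) (g j)).
Proof.
  intros H.
  destruct (functional_choice (fun (bM : bool * R) g => snd bM < g /\ P (fst bM) g)) as [F HF].
  { intros [b M]. apply H. }
  (* Each later term exceeds its predecessor and its own index, so the sequence increases without
     bound; the parity of the index selects the property. *)
  set (g := fix g j := match j with
    | O => F (true, a)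
    | S i => F (Nat.even (S i), Rmax (g i) (INR (S i))) end).
  assert (Hg : forall j, g j < g (S j) /\ INR (S j) < g (S j)).
  { intros j. destruct (HF (Nat.even (S j), Rmax (g j) (INR (S j)))) as [H1 _].
    change (F (Nat.even (S j), Rmax (g j) (INR (S j)))) with (g (S j)) in H1. cbv [snd] in H1.
    pose proof (Rmax_l (g j) (INR (S j))). pose proof (Rmax_r (g j) (INR (S j))). lra. }
  exists g. split; [|split; [|split]].
  - destruct (HF (true, a)) as [H1 _]. exact H1.
  - intros j. apply Hg.
  - intros M. destruct (INR_unbounded M) as [j Hj]. exists (S j).
    destruct (Hg j) as [_ H1]. rewrite S_INR in H1. lra.
  - intros [|j].
    + destruct (HF (true, a)) as [_ H1]. exact H1.
    + destruct (HF (Nat.even (S j), Rmax (g j) (INR (S j)))) as [_ H1]. exact H1.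
Qed.

Theorem theorem6p1 (N : nat) (p : R) (n : nat)
  (HN : (3 <= N)%nat) (HpS : pS N < p) (HpJL : lt_pJL N p) (Hn : (1 <= n)%nat)
  (U : R -> R -> R)
  (HU : forall gamma, 1 < gamma -> is_radial_sol N p gamma (U gamma))
  (y : R -> R) (Hy : is_ystar N p y) :
  exists sstar : R, is_nth_crit (ustar N p y) n sstar /\
  exists (g : nat -> R) (s : nat -> R),
    1 < g 0%nat /\
    (forall j, g j < g (S j)) /\
    (forall M, exists j, M < g j) /\
    (forall j, is_nth_crit (U (g j)) n (s j)) /\
    (forall j, (s j ^ 2 - sstar ^ 2) * (s (S j) ^ 2 - sstar ^ 2) < 0).
Proof.
  pose proof (emden_link_intro N p HN HpS HpJL) as HL.
  set (m := mcst N p) in *. set (A := Acst N p) in *.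
  set (k := m * theta p) in *. set (be := m * (INR N - 2 - theta p)) in *.
  assert (HU' : forall g, 1 < g -> radial_sol p (INR N) g (U g) (Derive (U g))).
  { intros g Hg. now apply radial_sol_intro, HU. }
  destruct (ystar_sol N p k be A (INR N) y HL) as (c & Hsol & Hlim & (Tl & e1 & He1 & HEl) & HE);
    [unfold alpha, be, k; fold m; ring|exact Hy|].
  fold m in Hsol, HEl, HE.
  assert (HL' := HL). destruct HL' as [[Hp Hk Hkb Hkb1 Hm Hsc _] HNr _ HA _].
  assert (Hth : k / m = theta p) by (unfold k; field; lra).
  destruct (branch_trapped HL HU' Hsol Hlim HE) as (tz & x0 & T1 & C & ka & Hx0 & HC & Hka & Hst & Hbr).
  assert (Dc : forall t, is_derive c t (slope p be m y c t)) by (intros t; apply Hsol).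
  destruct (@nth_zero_stable c (slope p be m y c) tz Dc) with (n := n)
    as (tau & b & e & Htau & He & Hnz & Hd & Hstab); auto.
  - intros t. destruct (Hsol t) as [P [D1 D2]].
    apply ex_derive_continuity_pt. unfold slope, eps, Rpower.
    auto_derive. repeat split; try assumption; eexists; eassumption.
  - intros t E. apply (singular_zero_nondegenerate p k be m A (INR N) y c t); auto.
    intros e' He'. destruct (Hlim e' He') as [T HT]. exists T. intros r Hr. now apply HT.
  - intros t Ht. specialize (Hst t Ht). lra.
  - apply (singular_zeros_unbounded p k be m A (INR N) Tl e1 y c); auto.
  - destruct (branch_converges HL HU' Hsol HE tz x0 T1 C ka b e) as (G & HG2 & HG); auto; try lra.
    { intros g Hg. now apply Hbr. }
    exists (exp (m * tau)). split.
    { apply (nth_crit_of_nth_zero m _ (fun s => A * Rpower s (- (k / m)) / (m * s)) c); auto.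
      intros s Hs. pose proof (Rpower_pos s (- (k / m))). split.
      - apply Rdiv_lt_0_compat; nra.
      - replace (A * Rpower s (- (k / m)) / (m * s) * c (ln s / m))
          with (A * Rpower s (- (k / m)) * c (ln s / m) / (m * s)) by (field; lra).
        unfold ustar. fold A m. rewrite <- Hth.
        apply (is_derive_ustar p k be m A (INR N)); auto. apply Hsol. }
    set (P := fun (b : bool) g => 1 < g /\ exists s, is_nth_crit (U g) n s /\
      if b then 0 < s < exp (m * tau) else exp (m * tau) < s).
    assert (Hctau : c tau = 0) by apply Hnz.
    assert (HP : forall b M, exists g, M < g /\ P b g).
    { intros sg M.
      set (q := slope p be m y c tau) in *.
      (* At the angles [PI / 2] and [- (PI / 2)] the value of [c] at [tau] is [r] and [- r]. The
         sign is chosen so that [q] times this value is positive exactly when [sg] asks for a zero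
         before [tau]. *)
      set (f0 := if Bool.eqb sg (if Rlt_dec 0 q then true else false) then PI / 2 else - (PI / 2)).
      destruct (branch_oscillates HL HU' Hsol HE tz x0 T1 ka tau f0 (Rmax M G))
        as (g & r & Hg1 & Hg2 & Hr & _ & Ec); auto; try lra.
      { intros t Ht. apply Hst. exact Ht. }
      { intros g Hg. apply Hbr. exact Hg. }
      pose proof (Rmax_l M G). pose proof (Rmax_r M G).
      rewrite Hctau, Rminus_0_r in Ec.
      exists g. split; [lra|]. split; [lra|].
      destruct (branch_global HL HU' g ltac:(lra)) as (_ & S1 & _).
      destruct (Hstab (emden_c A k m (Derive (U g)))
        (slope p be m (emden_y A k m (U g)) (emden_c A k m (Derive (U g)))))
        as (t & Ht & H1 & H2).
      { intros t. apply S1. }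
      { intros t Ht. destruct (Hbr g ltac:(lra)) as [H1 _]. specialize (H1 t Ht). lra. }
      { apply HG. lra. }
      exists (exp (m * t)). split.
      { apply (branch_nth_crit k m A (INR N) (U g) p g n t); auto. apply HU'. lra. }
      assert (Hord : forall x x', x < x' -> exp (m * x) < exp (m * x')).
      { intros x x' Hx. apply exp_increasing. now apply Rmult_lt_compat_l. }
      rewrite Ec in H1, H2. unfold f0 in H1, H2.
      destruct (Rlt_dec 0 q) as [Hq|Hq]; destruct sg; simpl in H1, H2;
        rewrite ?sin_neg, ?sin_PI2 in H1, H2.
      - split; [apply exp_pos|]. apply Hord, H1. nra.
      - apply Hord, H2. nra.
      - split; [apply exp_pos|]. apply Hord, H1. assert (q < 0) by lra. nra.
      - apply Hord, H2. assert (q < 0) by lra. nra. }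
    destruct (alternating_sequence P 1 HP) as (g & Hg0 & Hg1 & Hg2 & Hg3).
    destruct (functional_choice (fun j s => is_nth_crit (U (g j)) n s /\
      if Nat.even j then 0 < s < exp (m * tau) else exp (m * tau) < s)) as [s Hs].
    { intros j. destruct (Hg3 j) as [_ Hj]. exact Hj. }
    exists g, s. split; [exact Hg0|]. split; [exact Hg1|]. split; [exact Hg2|].
    split; [intros j; apply Hs|]. intros j.
    destruct (Hs j) as [_ H1]. destruct (Hs (S j)) as [_ H2].
    rewrite Nat.even_succ, <- Nat.negb_even in H2.
    pose proof (exp_pos (m * tau)).
    destruct (Nat.even j); simpl in H2; set (x := exp (m * tau)) in *.
    + assert (s j ^ 2 < x ^ 2) by nra. assert (x ^ 2 < s (S j) ^ 2) by nra. nra.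
    + assert (x ^ 2 < s j ^ 2) by nra. assert (s (S j) ^ 2 < x ^ 2) by nra. nra.
Qed.
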